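(* For every $1 \leq p < q < \infty$, \[ \mho(q,p,x) = \exp\left( \frac{\log x}{\log_2 x} \left( \log\sqrt{\frac{q}{p}} + O\left( \frac{\log_3 x}{\log_2 x} \right) \right) \right) \qquad (x \to \infty), \] where $\mho(q,p,x) := \sup \frac{\|D\|_{\mathcal{H}_q}}{\|D\|_{\mathcal{H}_p}}$, the supremum being taken over all non-zero Dirichlet polynomials of the form $D(s) = \sum_{n \leq x} a_n n^{-s}$.
   Context: A Dirichlet polynomial is a finite sum $D(s) = \sum_{n} a_n n^{-s}$ with $a_n \in \mathbb{C}$, $n \in \mathbb{N} = \{1,2,\dots\}$. For $1 \leq p < \infty$ its $p$-norm is \[ \|D\|_{\mathcal{H}_p} := \lim_{T \to \infty} \left( \frac{1}{2T} \int_{-T}^{T} |D(it)|^p \, dt \right)^{1/p} \] (the limit exists). Equivalently, $\|D\|_{\mathcal{H}_p} = \|\mathcal{L}D\|_{L_p(\mathbb{T}^{\mathbb{N}})}$, where $\mathbb{T}^{\mathbb{N}}$ carries its normalized Haar measure and $\mathcal{L}D(z) = \sum_{\alpha} a_{\mathfrak{p}^\alpha} z^\alpha$ is the Bohr lift: $\alpha$ runs over the eventually null sequences of non-negative integers, $\mathfrak{p}_1 < \mathfrak{p}_2 < \dots$ is the sequence of primes, and $\mathfrak{p}^\alpha = \mathfrak{p}_1^{\alpha_1} \mathfrak{p}_2^{\alpha_2} \cdots$. For $x$ large enough, $\log_1 x := \log x$ and $\log_k x := \log_{k-1} \log x$ for $k > 1$ (iterated logarithms). The $O$-term is understood as $x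 \to \infty$ with $p,q$ fixed. *)

(* Defs.v *)
From HB Require Import structures.
From mathcomp Require Import all_boot all_order all_algebra.
From mathcomp Require Import all_classical all_reals all_analysis.
From mathcomp Require Import complex.

Set Implicit Arguments.
Unset Strict Implicit.
Unset Printing Implicit Defensive.

Import Order.TTheory GRing.Theory Num.Theory.
Import numFieldNormedType.Exports.

Local Open Scope classical_set_scope.
Local Open Scope ring_scope.
Local Open Scope complex_scope.

(* Lets Landau notations be used along the filter +oo. *)
Canonical pinfty_filter_on (R : numFieldType) :=
  FilterType (pinfty_nbhs R) _.

Definition cexp (R : realType) (z : R[i]) : R[i] :=
  (expR (complex.Re z))%:C * (cos (complex.Im z) +i* sin (complex.Im z)).

(* The complex power n^s; only meaningful for n > 0. *)
Definition natpowC (R : realType) (n : nat) (s : R[i]) : R[i] :=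
  cexp (s * (ln n%:R)%:C).

(* D is a Dirichlet polynomial of the form sum_(n <= x) a_n n^(-s).  Dirichlet
   polynomials are taken as functions of s; their coefficients are determined
   by that function, so "non-zero" has the same meaning for both. *)
Definition dirichlet_poly (R : realType) (x : R) (D : R[i] -> R[i]) : Prop :=
  exists a : nat -> R[i], forall s : R[i],
    D s = \sum_(1 <= n < (Num.truncn x).+1) a n * natpowC n (- s).

(* The limit exists when D is a Dirichlet polynomial and 1 <= p; otherwise the
   value may be meaningless. *)
Definition Hnorm (R : realType) (p : R) (D : R[i] -> R[i]) : R :=
  lim ((fun T : R =>
    ((2 * T)^-1 * \int[@lebesgue_measure R]_(t in `[- T, T])
       (ComplexField.Normc.normc (D (t *i)) `^ p)) `^ p^-1) @ +oo).

Definition mho (R : realType) (q p x : R) : \bar R :=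
  ereal_sup [set (Hnorm q D / Hnorm p D)%:E | D in
    [set D | dirichlet_poly x D /\ exists s, D s != 0]].

(* iln k x is the k-fold iterated logarithm log_k x.  As ln vanishes on
   nonpositive reals, it is only meaningful for x large enough. *)
Definition iln (R : realType) (k : nat) (x : R) : R := iter k (@ln R) x.

(* Main.v *)
(* Let V = log x / log log x. By Bohr's correspondence the norms are moments of
   polynomials on a torus, and we replace the Haar measure by averages over the
   points whose coordinates are M-th roots of unity, M large.

   Upper bound. Weissler's inequality says that z -> r z is a contraction from
   H_p to H_q on the disc when r^2 = p / q. To prove it, approximate f by the exponential of a
   polynomial Phi; by Gibbs' variational principle the claim becomes an entropy
   estimate: e(rho) = avg (U log U), U = Re G (rho z), G (0) = 1, satisfies
   e(r) <= r^2 e(1). This holds since rho e' = rho^2 J up to o(1), where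
   J(rho) = avg (|G' (rho z)|^2 / Re G (rho z)) is nondecreasing by the Poisson
   formula and Cauchy-Schwarz. Minkowski's inequality
   tensorizes it. Finally split D according to the exponents of the primes <= Y and
   to the number of prime factors > Y, with Y = log x / (log log x)^3: there are only
   exp (o(V)) pieces, each is an H_p-contraction of D, and on each piece
   the dilation acts on the primes > Y as a scalar r^k with k <= log x / log Y ~ V.

   Lower bound. Take D = (sum_(l <= y) l^-s)^m over primes l, with y about
   log x (log log x)^2 and m = log x / log y ~ V. The 2k-th moment of the sum lies
   between k! P (P - 1) ... (P - k + 1) and k! P^k, where P = pi(y) >> m, so that
   the ratio of the norms is about (q / p)^(m / 2) by Stirling's formula. *)

Require Import Defs.
From HB Require Import structures.
From mathcomp Require Import all_boot all_order all_algebra.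
From mathcomp Require Import all_classical all_reals all_analysis.
From mathcomp Require Import complex ring lra.

Set Implicit Arguments.
Unset Strict Implicit.
Unset Printing Implicit Defensive.

Import Order.TTheory GRing.Theory Num.Theory.
Import numFieldNormedType.Exports.
Import ComplexField ComplexField.Normc.

Local Open Scope classical_set_scope.
Local Open Scope ring_scope.
Local Notation Re := complex.Re.
Local Notation Im := complex.Im.

(** * Averages over roots of unity *)

(** Finite grids keep every average a finite sum: a trigonometric polynomial has its exact mean on
    any grid with more points than its degree, and |.|^p is within eps of a polynomial in |.|^2. The
    price is that inequalities hold up to eps and for large M only. Differentiation in the radius
    commutes with the average, but integration by parts in the angle costs O(1/M). With exact
    averages (rho e')' = rho J; as J is nondecreasing, rho e' >= 2 e, so that e / rho^2 is
    nondecreasing, whence the power r^2.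

    Two demands shape the tensor step: the threshold on M must be common to all slices of a
    polynomial, and eps must sit inside the s-th power, s = q / p, to survive Minkowski's
    inequality.

    Undoing the dilation costs r^-k = (q / p)^(k / 2), the origin of sqrt (q / p). The choice of Y
    keeps two errors small: log Y is about log log x - 3 log log log x, so that log x / log Y
    exceeds V by a factor 1 + O(log log log x / log log x) only, while the pieces number (log
    x)^O(Y) = exp (O(V / log log x)). *)

Section Cis.
Variable R : realType.
Local Notation C := R[i].
Implicit Types (x y t : R) (z w : C).

Lemma ReD z w : Re (z + w) = Re z + Re w. Proof. by case: z; case: w. Qed.
Lemma ImD z w : Im (z + w) = Im z + Im w. Proof. by case: z; case: w. Qed.
Lemma ReN z : Re (- z) = - Re z. Proof. by case: z. Qed.
Lemma ImN z : Im (- z) = - Im z. Proof. by case: z. Qed.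
Lemma ReM z w : Re (z * w) = Re z * Re w - Im z * Im w.
Proof. by case: z; case: w. Qed.
Lemma ImM z w : Im (z * w) = Re z * Im w + Im z * Re w.
Proof. by case: z; case: w. Qed.
Lemma ReZ x z : Re (x%:C%C * z) = x * Re z.
Proof. by rewrite ReM /= mul0r subr0. Qed.
Lemma ImZ x z : Im (x%:C%C * z) = x * Im z.
Proof. by rewrite ImM /= mul0r addr0. Qed.
Lemma Re_sum I (r : seq I) (P : pred I) (F : I -> C) :
  Re (\sum_(i <- r | P i) F i) = \sum_(i <- r | P i) Re (F i).
Proof. exact: (big_morph _ ReD). Qed.

Lemma sqr_normc z : normc z ^+ 2 = Re z ^+ 2 + Im z ^+ 2.
Proof. by case: z => a b /=; rewrite sqr_sqrtr// addr_ge0 ?sqr_ge0. Qed.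

Lemma normc_ge0 z : 0 <= normc z.
Proof. by case: z => a b; rewrite /= sqrtr_ge0. Qed.

Lemma normcJ z : normc (conjc z) = normc z.
Proof. by case: z => a b; rewrite /= sqrrN. Qed.

Lemma Re_le_normc z : `|Re z| <= normc z.
Proof.
rewrite -[normc z]ger0_norm ?normc_ge0// -ler_sqr ?nnegrE ?normr_ge0//.
by rewrite !real_normK ?num_real// sqr_normc lerDl sqr_ge0.
Qed.

Lemma normc_real x : normc x%:C%C = `|x|.
Proof. by rewrite /= expr0n /= addr0 sqrtr_sqr. Qed.

Lemma normcX z n : normc (z ^+ n) = normc z ^+ n.
Proof.
elim: n => [|n IH]; first by rewrite !expr0 normc1.
by rewrite !exprS normcM IH.
Qed.

Lemma normc_sum I (r : seq I) (P : pred I) (F : I -> C) :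
  normc (\sum_(i <- r | P i) F i) <= \sum_(i <- r | P i) normc (F i).
Proof.
elim/big_rec2 : _ => [|i y1 y2 _ h]; first by rewrite normc0.
by apply: le_trans (le_normcD _ _) _; rewrite lerD2l.
Qed.

Lemma normc_prod I (r : seq I) (P : pred I) (F : I -> C) :
  normc (\prod_(i <- r | P i) F i) = \prod_(i <- r | P i) normc (F i).
Proof. by apply: (big_morph _ (@normcM R)); rewrite normc1. Qed.

Lemma ler_dist_normc z w : `|normc z - normc w| <= normc (z - w).
Proof.
rewrite ler_norml; have h (u v : C) : normc u - normc v <= normc (u - v).
  by rewrite lerBlDr; apply: le_trans (le_normcD _ _); rewrite subrK.
have := h w z; rewrite -[w - z]opprB normcN => hw; have hz := h z w.
by apply/andP; split; lra.
Qed.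

Lemma mulcJ z : z * conjc z = (normc z ^+ 2)%:C%C.
Proof.
case: z => a b; rewrite sqr_normc /=; apply/eqP; rewrite eq_complex /=.
by apply/andP; split; apply/eqP; ring.
Qed.

Definition cis t : C := (cos t +i* sin t)%C.
Arguments cis : simpl never.

Lemma Re_cis t : Re (cis t) = cos t. Proof. by []. Qed.
Lemma Im_cis t : Im (cis t) = sin t. Proof. by []. Qed.

Lemma cis0 : cis 0 = 1.
Proof. by rewrite /cis cos0 sin0. Qed.

Lemma cisD x y : cis (x + y) = cis x * cis y.
Proof.
by apply/eqP; rewrite /cis eq_complex /= cosD sinD; apply/andP; split; apply/eqP; ring.
Qed.

Lemma normc_cis t : normc (cis t) = 1.
Proof. by rewrite /cis /= cos2Dsin2 sqrtr1. Qed.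

Lemma conj_cis t : conjc (cis t) = cis (- t).
Proof. by rewrite /cis /= cosN sinN. Qed.

Lemma cis_conjV t : cis t * conjc (cis t) = 1.
Proof. by rewrite mulcJ normc_cis expr1n. Qed.

Lemma cis_neq0 t : cis t != 0.
Proof. by apply: contraTneq isT => h; move: (cis_conjV t); rewrite h mul0r => /eqP; rewrite eq_sym oner_eq0. Qed.

Lemma cis_inv t : (cis t)^-1 = conjc (cis t).
Proof. by apply: (mulfI (cis_neq0 t)); rewrite cis_conjV divff ?cis_neq0. Qed.

Lemma cisX t n : cis t ^+ n = cis (n%:R * t).
Proof.
elim: n => [|n IH]; first by rewrite mul0r cis0.
by rewrite exprS IH -cisD -natr1 mulrDl mul1r addrC.
Qed.

Lemma cis2pi : cis (pi *+ 2) = 1.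
Proof. by rewrite /cis cos2pi sin2pi. Qed.

Lemma cis_neq1 t : 0 < t < pi *+ 2 -> cis t != 1.
Proof.
move=> /andP[t0 tpi]; apply/eqP => -[/eqP c _].
have : 0 < sin (t / 2) by apply: sin_gt0_pi; apply/andP; split; lra.
move: c; rewrite {1}[t](_ : _ = (t / 2) *+ 2); last by lra.
rewrite cos_mulr2n cos2sin2 => /eqP c.
have : sin (t / 2) ^+ 2 = 0 by lra.
by move/eqP; rewrite sqrf_eq0 => /eqP ->; rewrite ltxx.
Qed.

End Cis.

Arguments cis : simpl never.

(** * Orthogonality on the grid of M-th roots of unity *)

Section Grid.
Variable R : realType.
Local Notation C := R[i].

Definition gpt (M k : nat) : R := k%:R * (pi *+ 2) / M%:R.

Definition gavg (M : nat) (F : R -> R) : R := M%:R^-1 * \sum_(k < M) F (gpt M k).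

Lemma cis_gpt M k : cis (gpt M k) = cis (gpt M 1) ^+ k.
Proof. by rewrite cisX /gpt mul1r mulrA. Qed.

Lemma cis_gptM M k : (0 < M)%N -> cis (gpt M k) ^+ M = 1.
Proof.
move=> M0; rewrite cis_gpt exprAC cisX /gpt mul1r mulrCA divff ?pnatr_eq0 -?lt0n// mulr1.
by rewrite cis2pi expr1n.
Qed.

Lemma cis_gpt_prim M : (0 < M)%N -> M.-primitive_root (cis (gpt M 1)).
Proof.
move=> M0; rewrite /primitive_root_of_unity M0 /=; apply/forallP => i.
apply/eqP; rewrite unity_rootE.
have [->|iM] := eqVneq i.+1 M; first by rewrite cis_gptM// eqxx.
apply/negbTE; rewrite -cis_gpt; apply: cis_neq1.
have pi0 := @pi_gt0 R.
have iM' : (i.+1 < M)%N by rewrite ltn_neqAle iM ltn_ord.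
rewrite /gpt; apply/andP; split.
  by rewrite divr_gt0 ?mulr_gt0 ?ltr0n// pmulrn_lgt0.
rewrite ltr_pdivrMr ?ltr0n// mulrC ltr_pM2l ?ltr_nat//.
by rewrite pmulrn_lgt0.
Qed.

Lemma grid_orth M n m : (0 < M)%N ->
  \sum_(k < M) cis (gpt M k) ^+ n * conjc (cis (gpt M k)) ^+ m =
  (if (n == m %[mod M])%N then M%:R else 0 : C).
Proof.
move=> M0.
pose w := cis (gpt M 1); pose u := w ^+ n / w ^+ m.
have w0 : w != 0 by exact: cis_neq0.
have E k : cis (gpt M k) ^+ n * conjc (cis (gpt M k)) ^+ m = u ^+ k.
  rewrite -cis_inv cis_gpt -/w /u expr_div_n -!exprVn exprAC.
  by congr (_ * _); rewrite !exprVn exprAC.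
rewrite (eq_bigr (fun k : 'I_M => u ^+ k)) => [|k _]; last exact: E.
have hu : (u == 1) = (n == m %[mod M])%N.
  rewrite -(eq_prim_root_expr (cis_gpt_prim M0)) -/w /u.
  by rewrite -[RHS](inj_eq (mulIf (invr_neq0 (expf_neq0 m w0)))) divff ?expf_neq0.
have uM : u ^+ M = 1.
  by rewrite /u expr_div_n ![_ ^+ _ ^+ M]exprAC /w cis_gptM// !expr1n divr1.
rewrite -hu; case: eqVneq => [->|u1].
  by under eq_bigr do rewrite expr1n; rewrite sumr_const card_ord.
apply/eqP; have : (u - 1) * (\sum_(i < M) u ^+ i) = 0.
  by rewrite -subrX1 uM subrr.
by move/eqP; rewrite mulf_eq0 subr_eq0 (negbTE u1).
Qed.

Lemma grid_orth0 M n : (0 < M)%N ->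
  \sum_(k < M) cis (gpt M k) ^+ n = (if (n == 0 %[mod M])%N then M%:R else 0 : C).
Proof.
by move=> M0; rewrite -grid_orth//; apply: eq_bigr => i _; rewrite expr0 mulr1.
Qed.

Lemma gavg_ge0 M F : (forall t, 0 <= F t) -> 0 <= gavg M F.
Proof. by move=> h; rewrite mulr_ge0 ?invr_ge0 ?ler0n// sumr_ge0. Qed.

Lemma ler_gavg M F G : (forall t, F t <= G t) -> gavg M F <= gavg M G.
Proof. by move=> h; rewrite ler_wpM2l ?invr_ge0 ?ler0n// ler_sum. Qed.

Lemma eq_gavg M F G : F =1 G -> gavg M F = gavg M G.
Proof. by move=> h; rewrite /gavg; congr (_ * _); apply: eq_bigr. Qed.

Lemma gavgD M F G : gavg M (fun t => F t + G t) = gavg M F + gavg M G.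
Proof. by rewrite /gavg big_split /= mulrDr. Qed.

Lemma gavgZ M c F : gavg M (fun t => c * F t) = c * gavg M F.
Proof. by rewrite /gavg -mulr_sumr mulrCA. Qed.

Lemma gavgN M F : gavg M (fun t => - F t) = - gavg M F.
Proof. by rewrite /gavg sumrN mulrN. Qed.

Lemma gavgB M F G : gavg M (fun t => F t - G t) = gavg M F - gavg M G.
Proof. by rewrite gavgD gavgN. Qed.

Lemma gavg_cst M c : (0 < M)%N -> gavg M (fun=> c) = c.
Proof.
move=> M0; rewrite /gavg sumr_const card_ord -[c *+ M]mulr_natl mulKf//.
by rewrite pnatr_eq0 -lt0n.
Qed.

Lemma gavg_sum M I (r : seq I) (P : pred I) (F : I -> R -> R) :
  gavg M (fun t => \sum_(i <- r | P i) F i t) = \sum_(i <- r | P i) gavg M (F i).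
Proof. by rewrite /gavg exchange_big /= mulr_sumr. Qed.

(** Each unit of the shift permutes the summands cyclically; the one that wraps around is brought
    back by periodicity. *)
Lemma gavg_shift M F j : (forall t, F (t + pi *+ 2) = F t) ->
  gavg M (fun t => F (gpt M j + t)) = gavg M F.
Proof.
move=> hF; rewrite /gavg; congr (_ * _).
have [->|M0] := posnP M; first by rewrite !big_ord0.
have Mn : M%:R != 0 :> R by rewrite pnatr_eq0 -lt0n.
elim: j => [|j IH].
  by apply: eq_bigr => k _; rewrite /gpt !mul0r add0r.
rewrite -IH; case: M M0 Mn IH => // M _ Mn IH.
rewrite big_ord_recr [RHS]big_ord_recl /= addrC; congr (_ + _).
  rewrite -[RHS]hF; congr F; rewrite /gpt -!natr1; field.
  by rewrite natr1.
apply: eq_bigr => k _; congr F; rewrite /gpt /bump /= add1n -!natr1; field.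
by rewrite natr1.
Qed.

End Grid.

(** * The truncated Poisson kernel *)

Section Kernel.
Variable R : realType.
Local Notation C := R[i].

(** The Poisson kernel of radius rho, cut off at frequency m. *)
Definition pkern m (rho t : R) : R :=
  1 + 2 * \sum_(k < m) rho ^+ k.+1 * cos (k.+1%:R * t).

(** For the full kernel the right-hand side would be 1 - rho^2; the truncation leaves the two cosine
    terms. *)
Lemma pkernE m rho t : (1 - 2 * rho * cos t + rho ^+ 2) * pkern m rho t =
  1 - rho ^+ 2 - 2 * rho ^+ m.+1 * cos (m.+1%:R * t)
    + 2 * rho ^+ m.+2 * cos (m%:R * t).
Proof.
rewrite /pkern; elim: m => [|m IH].
  by rewrite big_ord0 mul0r cos0 mul1r; ring.
rewrite big_ord_recr /=; move: IH; set S := \sum_(k < m) _ => IH.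
rewrite [2 * (S + _)]mulrDr addrA [LHS]mulrDr IH.
have -> : m.+2%:R * t = m.+1%:R * t + t by rewrite -[m.+2%:R]natr1; ring.
have -> : m%:R * t = m.+1%:R * t - t by rewrite -[m.+1%:R]natr1; ring.
by rewrite cosB cosD !exprS; ring.
Qed.

(* Nonnegative only at the (2m+1)-st roots of unity, where the two cosines of [pkernE] agree. *)
Lemma pkern_ge0 m rho j : 0 <= rho < 1 -> 0 <= pkern m rho (gpt R m.*2.+1 j).
Proof.
move=> /andP[r0 r1]; set t := gpt _ _ _.
have D : 0 < 1 - 2 * rho * cos t + rho ^+ 2.
  have c1 : cos t <= 1 by exact: cos_le1.
  have h : rho * cos t <= rho * 1 by rewrite ler_wpM2l.
  have : 0 < (1 - rho) ^+ 2 by rewrite exprn_gt0// subr_gt0.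
  by lra.
rewrite -(pmulr_rge0 _ D) pkernE.
have -> : cos (m%:R * t) = cos (m.+1%:R * t).
  have : cis (m%:R * t) * cis (m.+1%:R * t) = 1 :> C.
    rewrite -!cisX -exprD addnS addnn; exact: cis_gptM.
  move/(congr1 (fun w : C => w * conjc (cis (m.+1%:R * t)))).
  by rewrite -mulrA cis_conjV mulr1 mul1r conj_cis => -[-> _]; rewrite cosN.
have c1 := cos_le1 (m.+1%:R * t).
have e1 : rho ^+ m.+1 <= rho by rewrite exprS -[leRHS]mulr1 ler_wpM2l// exprn_ile1// ltW.
have e0 : 0 <= rho ^+ m.+1 by rewrite exprn_ge0.
have : rho ^+ m.+1 * cos (m.+1%:R * t) <= rho ^+ m.+1 by rewrite -[leRHS]mulr1 ler_wpM2l.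
rewrite [rho ^+ m.+2]exprS => h.
have -> : 1 - rho ^+ 2 - 2 * rho ^+ m.+1 * cos (m.+1%:R * t) +
  2 * (rho * rho ^+ m.+1) * cos (m.+1%:R * t) =
  (1 - rho) * (1 + rho - 2 * (rho ^+ m.+1 * cos (m.+1%:R * t))) by ring.
by apply: mulr_ge0; lra.
Qed.

Lemma poisson_average m rho : 0 <= rho < 1 -> exists kap : 'I_m.*2.+1 -> R,
  [/\ forall j, 0 <= kap j, \sum_j kap j = 1 &
   forall A : {poly C}, (size A <= m.+1)%N -> forall z,
     A.[rho%:C%C * z] = \sum_j (kap j)%:C%C * A.[cis (gpt R m.*2.+1 j) * z]].
Proof.
move=> r01; set M := m.*2.+1.
have M0 : (0 < M)%N by [].
have MC : M%:R != 0 :> C by rewrite pnatr_eq0.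
pose kap (j : 'I_M) := M%:R^-1 * pkern m rho (gpt R M j).
have kapC j : (kap j)%:C%C = M%:R^-1 * (1 + \sum_(k < m) rho%:C%C ^+ k.+1 *
   (cis (gpt R M j) ^+ k.+1 + conjc (cis (gpt R M j)) ^+ k.+1)) :> C.
  rewrite /kap /pkern rmorphM fmorphV rmorph_nat; congr (_ * _).
  rewrite rmorphD rmorph1 rmorphM rmorph_nat; congr (1 + _).
  rewrite rmorph_sum mulr_sumr; apply: eq_bigr => k _.
  rewrite rmorphM rmorphXn mulrCA; congr (_ * _).
  by rewrite -[X in _ = _ + X]rmorphXn cisX addcJ.
have key n : (n < m.+1)%N ->
  \sum_j (kap j)%:C%C * cis (gpt R M j) ^+ n = rho%:C%C ^+ n :> C.
  rewrite ltnS => nm.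
  under eq_bigr => j _ do rewrite kapC -mulrA mulrDl mul1r mulr_suml.
  rewrite -mulr_sumr big_split /= exchange_big /=.
  have Mm : (m < M)%N by rewrite ltnS -addnn leq_addr.
  have E (k : 'I_m) : \sum_(i < M) rho%:C%C ^+ k.+1 *
     (cis (gpt R M i) ^+ k.+1 + conjc (cis (gpt R M i)) ^+ k.+1) *
      cis (gpt R M i) ^+ n = if n == k.+1 then rho%:C%C ^+ n * M%:R else 0 :> C.
    under eq_bigr => i _ do rewrite -mulrA mulrDl -exprD.
    rewrite -mulr_sumr big_split /=.
    have -> : \sum_(i < M) cis (gpt R M i) ^+ (k.+1 + n) = 0 :> C.
      rewrite grid_orth0// mod0n modn_small ?addSn//.
      rewrite /M -addnn ltnS -addSn leq_add// ; exact: ltn_ord.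
    rewrite add0r; under eq_bigr do rewrite mulrC.
    rewrite grid_orth// !modn_small ?(leq_ltn_trans nm)//; last first.
      by apply: leq_ltn_trans Mm; exact: ltn_ord.
    by case: eqP => [->|]; rewrite ?mulr0.
  under [X in _ + X]eq_bigr => k _ do rewrite E.
  rewrite grid_orth0// mod0n modn_small ?(leq_ltn_trans nm)//.
  case: n nm E => [|n] nm E.
    by rewrite big1 ?addr0 ?expr0 ?mulVf.
  rewrite /= add0r (bigD1 (Ordinal nm)) //= eqxx big1 ?addr0.
    by rewrite mulrCA mulVf// mulr1.
  by move=> i; rewrite eqSS -val_eqE /= eq_sym => /negbTE ->.
exists kap; split.
- by move=> j; rewrite mulr_ge0 ?invr_ge0 ?ler0n ?pkern_ge0.
- apply: complexI; rewrite -[RHS](expr0 rho%:C%C) -key//.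
  by rewrite rmorph_sum; apply: eq_bigr => j _; rewrite expr0 mulr1.
- move=> A sA z; rewrite (horner_coef_wide _ sA).
  under [RHS]eq_bigr => j _ do rewrite (horner_coef_wide _ sA) mulr_sumr.
  rewrite exchange_big /=; apply: eq_bigr => i _.
  rewrite exprMn -key// mulr_suml mulr_sumr; apply: eq_bigr => j _.
  by rewrite exprMn; ring.
Qed.

End Kernel.

(** * Entropy along circles *)

Section Calculus.
Variable R : realType.
Local Notation C := R[i].
Implicit Types (f g : R -> R) (x : R).

Definition dv f x (d : R) : Prop := is_derive x 1 f d.

Lemma dv_eq f x d d' : dv f x d -> d = d' -> dv f x d'.
Proof. by move=> h <-. Qed.

Lemma dvD f g x df dg : dv f x df -> dv g x dg ->
  dv (fun y => f y + g y) x (df + dg).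
Proof. by move=> hf hg; exact: (@is_deriveD _ _ _ f g). Qed.

Lemma dvN f x df : dv f x df -> dv (fun y => - f y) x (- df).
Proof. by move=> hf; exact: (@is_deriveN _ _ _ f). Qed.

Lemma dvB f g x df dg : dv f x df -> dv g x dg ->
  dv (fun y => f y - g y) x (df - dg).
Proof. by move=> hf hg; apply: dvD => //; exact: dvN. Qed.

Lemma dvM f g x df dg : dv f x df -> dv g x dg ->
  dv (fun y => f y * g y) x (df * g x + f x * dg).
Proof.
move=> hf hg; have := @is_deriveM _ _ f g x 1 df dg hf hg.
by move/is_derive_eq; apply; rewrite addrC [g x *: _]mulrC.
Qed.

Lemma dv_cst x (c : R) : dv (fun=> c) x 0.
Proof. exact: is_derive_cst. Qed.

Lemma dv_id x : dv (fun y : R => y) x 1.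
Proof. exact: is_derive_id. Qed.

Lemma dvV f x df : f x != 0 -> dv f x df ->
  dv (fun y => (f y)^-1) x (- df / f x ^+ 2).
Proof.
by move=> fx hf; apply: dv_eq (is_deriveV fx hf) _; rewrite /= [_ *: _]mulrC mulrN mulNr.
Qed.

Lemma dv_comp f g x df dg : dv f (g x) df -> dv g x dg ->
  dv (fun y => f (g y)) x (df * dg).
Proof. by move=> hf hg; exact: (@is_derive1_comp _ f g). Qed.

Lemma dv_ln f x df : 0 < f x -> dv f x df ->
  dv (fun y => ln (f y)) x (df / f x).
Proof.
by move=> f0 hf; rewrite mulrC; apply: dv_comp => //; exact: is_derive1_ln.
Qed.

Lemma dv_sum n (F : 'I_n -> R -> R) (dF : 'I_n -> R) x :
  (forall i, dv (F i) x (dF i)) ->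
  dv (fun y => \sum_(i < n) F i y) x (\sum_(i < n) dF i).
Proof.
move=> h; have := @is_derive_sum _ _ _ n F x 1 dF h.
rewrite /dv (_ : (fun y => _) = \sum_(i < n) F i)//.
by apply/funext => y; rewrite fct_sumE.
Qed.

Lemma dv_gavg M (F : R -> R -> R) (dF : R -> R) x :
  (forall t, dv (F^~ t) x (dF t)) ->
  dv (fun y => gavg M (F y)) x (gavg M dF).
Proof.
move=> h; rewrite /gavg; apply: dv_eq.
  by apply: dvM; [exact: dv_cst | apply: dv_sum => i; exact: h].
by rewrite mul0r add0r.
Qed.

Lemma mvt_open f df (a b : R) : a < b ->
  (forall x, a <= x <= b -> dv f x (df x)) ->
  exists2 c, a < c < b & f b - f a = df c * (b - a).
Proof.
move=> ab h; have [x xab|//|c cab E] := @MVT R f df a b ab.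
- by apply: h; move: xab; rewrite in_itv /= => /andP[/ltW-> /ltW->].
- apply: derivable_within_continuous => x; rewrite in_itv /= => /h.
  by case.
- by exists c => //; move: cab; rewrite in_itv.
Qed.

Lemma mvt_seg f df (a b : R) : a <= b ->
  (forall x, a <= x <= b -> dv f x (df x)) ->
  exists2 c, a <= c <= b & f b - f a = df c * (b - a).
Proof.
rewrite le_eqVlt => /orP[/eqP<- _|ab h].
  by exists a; rewrite ?lexx// !subrr mulr0.
by have [c /andP[/ltW ac /ltW cb] E] := mvt_open ab h; exists c; rewrite ?ac.
Qed.

Lemma derive_mono f df (a b : R) : a <= b ->
  (forall x, a <= x <= b -> dv f x (df x)) ->
  (forall x, a < x < b -> 0 <= df x) -> f a <= f b.
Proof.
rewrite le_eqVlt => /orP[/eqP<-//|ab h p]; have [c /p cab E] := mvt_open ab h.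
by rewrite -subr_ge0 E mulr_ge0// subr_ge0 ltW.
Qed.

(** Chain rule along a real curve, with real derivatives only; both parts go through one induction
    because multiplication by X mixes them. *)
Lemma dv_horner (P : {poly C}) (u v : R -> R) x u1 v1 :
  dv u x u1 -> dv v x v1 ->
  dv (fun t => Re P.[(u t +i* v t)%C]) x
     (Re (P^`().[(u x +i* v x)%C] * (u1 +i* v1)%C)) /\
  dv (fun t => Im P.[(u t +i* v t)%C]) x
     (Im (P^`().[(u x +i* v x)%C] * (u1 +i* v1)%C)).
Proof.
move=> hu hv; elim/poly_ind: P => [|P c [IHr IHi]].
  split.
    apply: dv_eq; last by rewrite deriv0 horner0 mul0r.
    under eq_fun do rewrite horner0; exact: dv_cst.
  apply: dv_eq; last by rewrite deriv0 horner0 mul0r.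
  under eq_fun do rewrite horner0; exact: dv_cst.
rewrite derivD derivM derivX derivC addr0 mulr1 hornerD hornerM hornerX.
split.
  under eq_fun do rewrite hornerD hornerM hornerX hornerC ReD ReM /=.
  apply: dv_eq.
    apply: dvD; last exact: dv_cst.
    apply: dvB; apply: dvM; [exact: IHr | exact: hu | exact: IHi | exact: hv].
  rewrite mulrDl !(ReD, ReM, ImM, ImD) /=; ring.
under eq_fun do rewrite hornerD hornerM hornerX hornerC ImD ImM /=.
apply: dv_eq.
  apply: dvD; last exact: dv_cst.
  apply: dvD; apply: dvM; [exact: IHr | exact: hv | exact: IHi | exact: hu].
rewrite mulrDl !(ReD, ReM, ImM, ImD) /=; ring.
Qed.

(** Cartesian form of rho e^(it), the shape that [dv_horner] differentiates. *)
Definition rc (rho t : R) : C := (rho * cos t +i* (rho * sin t))%C.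

Lemma rcE rho t : rc rho t = rho%:C%C * cis t.
Proof.
by apply/eqP; rewrite eq_complex ReZ ImZ /= !eqxx.
Qed.

Lemma dv_horner_rho P t rho :
  dv (fun r => Re P.[rc r t]) rho (Re (P^`().[rc rho t] * cis t)) /\
  dv (fun r => Im P.[rc r t]) rho (Im (P^`().[rc rho t] * cis t)).
Proof.
have E : cis t = (cos t +i* sin t)%C by [].
rewrite E; apply: dv_horner; apply: dv_eq.
- by apply: dvM; [exact: dv_id|exact: dv_cst].
- by rewrite mul1r mulr0 addr0.
- by apply: dvM; [exact: dv_id|exact: dv_cst].
- by rewrite mul1r mulr0 addr0.
Qed.

Lemma dv_horner_theta P rho t :
  dv (fun s => Re P.[rc rho s]) t (Re (P^`().[rc rho t] * rc rho t * 'i%C)) /\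
  dv (fun s => Im P.[rc rho s]) t (Im (P^`().[rc rho t] * rc rho t * 'i%C)).
Proof.
have E : rc rho t * 'i%C = (- (rho * sin t) +i* (rho * cos t))%C.
  by apply/eqP; rewrite eq_complex ReM ImM /=; apply/andP; split; apply/eqP; ring.
rewrite -mulrA E; apply: dv_horner; apply: dv_eq.
- by apply: dvM; [exact: dv_cst|exact: is_derive_cos].
- by rewrite mul0r add0r mulrN.
- by apply: dvM; [exact: dv_cst|exact: is_derive_sin].
- by rewrite mul0r add0r.
Qed.

(** Discrete form of the vanishing of the integral of F' over a period: with step h, each h f
    differs from the increment of F by at most K h^2, and the increments telescope to 0. It replaces
    integration by parts in the angle. *)
Lemma gavg_derive_small M F f K : (0 < M)%N -> (forall t, F (t + pi *+ 2) = F t) ->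
  (forall t, dv F t (f t)) ->
  (forall t s, `|f t - f s| <= K * `|t - s|) ->
  `|gavg M f| <= K * (pi *+ 2 / M%:R).
Proof.
move=> M0 Fp dF fK; pose h : R := pi *+ 2 / M%:R.
have Mn : M%:R != 0 :> R by rewrite pnatr_eq0 -lt0n.
have h0 : 0 < h by rewrite divr_gt0 ?ltr0n// pmulrn_lgt0// pi_gt0.
have step k : `|h * f (gpt R M k) - (F (gpt R M k.+1) - F (gpt R M k))| <= K * h * h.
  have E : gpt R M k.+1 - gpt R M k = h by rewrite /gpt /h -natr1; field.
  have [|c /andP[c1 c2] ->] := @mvt_seg F f (gpt R M k) (gpt R M k.+1) _ (fun x _ => dF x).
    by rewrite -subr_ge0 E ltW.
  rewrite E mulrC -mulrBl normrM (gtr0_norm h0); apply: ler_wpM2r; first exact: ltW.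
  apply: le_trans (fK _ _) _; rewrite distrC ger0_norm ?subr_ge0//.
  have K0 : 0 <= K.
    by have := fK 1 0; rewrite subr0 normr1 mulr1; apply: le_trans; exact: normr_ge0.
  by rewrite ler_wpM2l// -E lerB.
have tel : \sum_(k < M) (F (gpt R M k.+1) - F (gpt R M k)) = 0.
  rewrite -(big_mkord xpredT (fun k => F (gpt R M k.+1) - F (gpt R M k))).
  rewrite telescope_sumr// /gpt mul0r mul0r mulrAC divff// mul1r.
  by rewrite -[X in F X - _]add0r Fp subrr.
have : `|h * \sum_(k < M) f (gpt R M k)| <= M%:R * (K * h * h).
  have -> : h * \sum_(k < M) f (gpt R M k) = \sum_(k < M)
      (h * f (gpt R M k) - (F (gpt R M k.+1) - F (gpt R M k))).
    by rewrite sumrB tel subr0 mulr_sumr.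
  apply: le_trans (ler_norm_sum _ _ _) _.
  apply: (@le_trans _ _ (\sum_(k < M) K * h * h)).
    by apply: ler_sum => k _; exact: step.
  by rewrite sumr_const card_ord mulr_natl.
rewrite normrM (gtr0_norm h0) /gavg normrM (@gtr0_norm _ M%:R^-1) ?invr_gt0 ?ltr0n// => H.
rewrite -(ler_pM2l h0) -/h mulrCA ler_pdivrMl ?ltr0n//; apply: le_trans H _.
by rewrite le_eqVlt; apply/orP; left; apply/eqP; ring.
Qed.

End Calculus.

(** * Uniform Lipschitz bounds and the weighted Dirichlet energy *)

Section Entropy.
Variable R : realType.
Local Notation C := R[i].
Implicit Types (f g : R -> R -> R).

Lemma mvt_lip (f df : R -> R) K : (forall x, dv f x (df x)) ->
  (forall x, `|df x| <= K) -> forall a b, `|f a - f b| <= K * `|a - b|.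
Proof.
move=> hf hK a b; wlog ab : a b / b <= a => [H|].
  by have [/H//|/ltW/H] := leP b a; rewrite distrC [X in _ -> _ <= _ * X]distrC.
have [c _ ->] := mvt_seg ab (fun x _ => hf x).
by rewrite normrM ler_wpM2r.
Qed.

Lemma cos_lip (a b : R) : `|cos a - cos b| <= `|a - b|.
Proof.
rewrite -[leRHS]mul1r; apply: (@mvt_lip _ (fun x => - sin x)) => x.
  exact: is_derive_cos.
by rewrite normrN sin_max.
Qed.

Lemma sin_lip (a b : R) : `|sin a - sin b| <= `|a - b|.
Proof.
rewrite -[leRHS]mul1r; apply: (@mvt_lip _ (@cos R)) => x; last exact: cos_max.
exact: is_derive_sin.
Qed.

(** The bound is carried along with the Lipschitz constant so that the class is closed under
    products. Uniformity in the radius makes the error of [gavg_derive_small] independent of rho. *)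
Definition unif_lip f := exists K : R, forall rho t s, 0 <= rho <= 1 ->
  `|f rho t| <= K /\ `|f rho t - f rho s| <= K * `|t - s|.

Lemma unif_lip_cst (c : R) : unif_lip (fun _ _ => c).
Proof.
by exists `|c| => rho t s _; rewrite subrr normr0; split=> //; rewrite mulr_ge0.
Qed.

Lemma unif_lip_rho : unif_lip (fun rho _ => rho).
Proof.
exists 1 => rho t s /andP[r0 r1]; rewrite subrr normr0 mul1r; split => //.
by rewrite ger0_norm.
Qed.

Lemma unif_lip_cos : unif_lip (fun _ t => cos t).
Proof.
exists 1 => rho t s _; split; first exact: cos_max.
by rewrite mul1r; exact: cos_lip.
Qed.

Lemma unif_lip_sin : unif_lip (fun _ t => sin t).
Proof.
exists 1 => rho t s _; split; first exact: sin_max.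
by rewrite mul1r; exact: sin_lip.
Qed.

Lemma unif_lipD f g : unif_lip f -> unif_lip g ->
  unif_lip (fun rho t => f rho t + g rho t).
Proof.
move=> [K hK] [L hL]; exists (K + L) => rho t s h.
have [k1 k2] := hK rho t s h; have [l1 l2] := hL rho t s h; split.
  by apply: le_trans (ler_normD _ _) _; rewrite lerD.
rewrite opprD addrACA mulrDl.
by apply: le_trans (ler_normD _ _) _; rewrite lerD.
Qed.

Lemma unif_lipN f : unif_lip f -> unif_lip (fun rho t => - f rho t).
Proof.
move=> [K hK]; exists K => rho t s h; have [k1 k2] := hK rho t s h.
by rewrite normrN -opprD normrN.
Qed.

Lemma unif_lipM f g : unif_lip f -> unif_lip g ->
  unif_lip (fun rho t => f rho t * g rho t).
Proof.
move=> [K hK] [L hL]; exists (K * L + K * L) => rho t s h.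
have [k1 k2] := hK rho t s h; have [l1 l2] := hL rho t s h.
have [k3 _] := hK rho s t h.
have KL : 0 <= K * L by rewrite mulr_ge0 //; apply: le_trans (normr_ge0 _) _; eassumption.
split.
  by rewrite normrM; apply: le_trans (ler_pM _ _ k1 l1) _; rewrite ?normr_ge0// lerDl.
rewrite (_ : _ - _ = (f rho t - f rho s) * g rho t + f rho s * (g rho t - g rho s)); last by ring.
apply: le_trans (ler_normD _ _) _; rewrite [leRHS]mulrDl; apply: lerD; rewrite normrM.
  by rewrite mulrAC; apply: ler_pM.
by rewrite -mulrA; apply: ler_pM.
Qed.

Lemma unif_lip_horner (P : {poly C}) :
  unif_lip (fun rho t => Re P.[rc rho t]) /\ unif_lip (fun rho t => Im P.[rc rho t]).
Proof.
elim/poly_ind: P => [|P c [IHr IHi]].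
  by split; (under eq_fun do under eq_fun do rewrite horner0); exact: unif_lip_cst.
have Lc : unif_lip (fun rho t => rho * cos t).
  by apply: unif_lipM; [exact: unif_lip_rho|exact: unif_lip_cos].
have Ls : unif_lip (fun rho t => rho * sin t).
  by apply: unif_lipM; [exact: unif_lip_rho|exact: unif_lip_sin].
split; under eq_fun do under eq_fun do rewrite hornerD hornerM hornerX hornerC ?(ReD, ImD) ?(ReM, ImM) /=.
  apply: unif_lipD; last exact: unif_lip_cst.
  by apply: unif_lipD; [|apply: unif_lipN]; apply: unif_lipM.
apply: unif_lipD; last exact: unif_lip_cst.
by apply: unif_lipD; apply: unif_lipM.
Qed.

Lemma unif_lipV f c : 0 < c -> (forall rho t, 0 <= rho <= 1 -> c <= f rho t) ->
  unif_lip f -> unif_lip (fun rho t => (f rho t)^-1).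
Proof.
move=> c0 hc [K hK]; exists (c^-1 + K * (c^-1 * c^-1)) => rho t s h.
have [k1 k2] := hK rho t s h; have ct := hc rho t h; have cs := hc rho s h.
have K0 : 0 <= K by apply: le_trans k1.
have ft : 0 < f rho t by apply: lt_le_trans ct.
have fs : 0 < f rho s by apply: lt_le_trans cs.
have ci : 0 <= c^-1 by rewrite invr_ge0 ltW.
have it : (f rho t)^-1 <= c^-1 by rewrite lef_pV2.
have its : (f rho s)^-1 <= c^-1 by rewrite lef_pV2.
split.
  rewrite ger0_norm; last by rewrite invr_ge0 ltW.
  apply: le_trans it _.
  by rewrite lerDl mulr_ge0// mulr_ge0.
rewrite (_ : _ - _ = (f rho s - f rho t) * ((f rho t)^-1 * (f rho s)^-1)); last first.
  by field; rewrite !gt_eqF.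
rewrite normrM distrC [X in _ * X]ger0_norm; last by rewrite mulr_ge0 ?invr_ge0// ltW.
rewrite mulrDl; apply: (@le_trans _ _ (K * (c^-1 * c^-1) * `|t - s|)); last first.
  by rewrite lerDr mulr_ge0.
rewrite mulrAC; apply: ler_pM => //; first by rewrite mulr_ge0 ?invr_ge0// ltW.
by apply: ler_pM => //; rewrite invr_ge0 ltW.
Qed.

Lemma ln_lip (c a b : R) : 0 < c -> c <= a -> c <= b -> `|ln a - ln b| <= c^-1 * `|a - b|.
Proof.
move=> c0; wlog ab : a b / b <= a => [H|ca cb].
  have [/H H'|/ltW/H H'] := leP b a; first exact: H'.
  by rewrite distrC [X in _ -> _ -> _ <= _ * X]distrC => ca cb; exact: H'.
have b0 : 0 < b by apply: lt_le_trans cb.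
have a0 : 0 < a by apply: lt_le_trans ab.
rewrite ger0_norm; last by rewrite subr_ge0 ler_ln.
rewrite [X in _ * X]ger0_norm ?subr_ge0//.
rewrite -ln_div//; have -> : a / b = 1 + (a - b) / b by field; rewrite gt_eqF.
apply: le_trans (le_ln1Dx _) _.
  by apply: (@lt_le_trans _ _ 0) => //; rewrite divr_ge0 ?subr_ge0// ltW.
by rewrite mulrC ler_wpM2r ?subr_ge0// lef_pV2.
Qed.

Lemma unif_lip_ln f c : 0 < c -> (forall rho t, 0 <= rho <= 1 -> c <= f rho t) ->
  unif_lip f -> unif_lip (fun rho t => ln (f rho t)).
Proof.
move=> c0 hc [K hK]; exists (`|ln c| + K + c^-1 * K) => rho t s h.
have [k1 k2] := hK rho t s h; have ct := hc rho t h; have cs := hc rho s h.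
have K0 : 0 <= K by apply: le_trans k1.
have ft : 0 < f rho t by apply: lt_le_trans ct.
have ci : 0 <= c^-1 by rewrite invr_ge0 ltW.
split.
  apply: (@le_trans _ _ (`|ln c| + K)); last by rewrite lerDl mulr_ge0.
  have l1 : ln c <= ln (f rho t) by rewrite ler_ln.
  have l2 : ln (f rho t) <= f rho t by apply/ltW/ln_sublinear.
  have l3 : f rho t <= K by apply: le_trans (ler_norm _) k1.
  have := ler_norm (- ln c); rewrite normrN => l4.
  by have := normr_ge0 (ln c); rewrite ler_norml; move=> ?; apply/andP; split; lra.
apply: le_trans (ln_lip c0 ct cs) _; rewrite mulrDl.
apply: (@le_trans _ _ (c^-1 * K * `|t - s|)); last by rewrite lerDr mulr_ge0// addr_ge0.
by rewrite -mulrA ler_wpM2l.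
Qed.

(** Convexity of (a, b) -> |a|^2 / b, which is the supremum over mu of 2 mu |a| - mu^2 b; the proof
    takes the optimal mu for the sums. *)
Lemma weighted_cauchy n (kap : 'I_n -> R) (a : 'I_n -> C) (b : 'I_n -> R) :
  (forall j, 0 <= kap j) -> (forall j, 0 < b j) ->
  normc (\sum_j (kap j)%:C%C * a j) ^+ 2 / (\sum_j kap j * b j) <=
  \sum_j kap j * (normc (a j) ^+ 2 / b j).
Proof.
move=> k0 b0; set S := \sum_j kap j * b j; set N := normc _; set T := \sum_j _.
have T0 : 0 <= T.
  by apply: sumr_ge0 => j _; rewrite mulr_ge0// divr_ge0 ?sqr_ge0// ltW.
(* If S = 0 the quotient on the left is 0, as x / 0 = 0. *)
have [S0|Sn0] := eqVneq S 0; first by rewrite S0 invr0 mulr0.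
have N0 : 0 <= N by exact: normc_ge0.
have S0 : 0 <= S by apply: sumr_ge0 => j _; rewrite mulr_ge0// ltW.
pose mu := N / S.
have mu0 : 0 <= mu by rewrite divr_ge0.
have NT : N <= \sum_j kap j * normc (a j).
  apply: le_trans (normc_sum _ _ _) _; apply: ler_sum => j _.
  by rewrite normcM normc_real ger0_norm.
have : 2 * mu * (\sum_j kap j * normc (a j)) - mu ^+ 2 * S <= T.
  rewrite /T /S !mulr_sumr -sumrB; apply: ler_sum => j _.
  have -> : 2 * mu * (kap j * normc (a j)) - mu ^+ 2 * (kap j * b j) =
    kap j * (2 * mu * normc (a j) - mu ^+ 2 * b j) by ring.
  apply: ler_wpM2l => //; rewrite -subr_ge0.
  rewrite (_ : _ - _ = (normc (a j) - mu * b j) ^+ 2 / b j); last first.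
    by field; rewrite gt_eqF.
  by rewrite divr_ge0 ?sqr_ge0// ltW.
apply: le_trans.
have -> : N ^+ 2 / S = 2 * mu * N - mu ^+ 2 * S by rewrite /mu; field.
by rewrite lerB// ler_wpM2l// mulr_ge0.
Qed.

Lemma cis_rc rho t s : cis t * rc rho s = rc rho (t + s) :> C.
Proof. by rewrite !rcE cisD; ring. Qed.

Lemma rc_per rho t : rc rho (t + pi *+ 2) = rc rho t :> C.
Proof. by rewrite !rcE cisD cis2pi mulr1. Qed.

(* Poisson averages rotations of the circle of radius sig, and (w, u) |-> |w|^2 / u is jointly convex. *)
Lemma dirichlet_energy_mono (G : {poly C}) c m rho sig : 0 < c -> (size G <= m.+1)%N ->
  (forall rho t, 0 <= rho <= 1 -> c <= Re G.[rc rho t]) ->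
  0 <= rho -> rho <= sig -> sig <= 1 ->
  gavg m.*2.+1 (fun t => normc G^`().[rc rho t] ^+ 2 / Re G.[rc rho t]) <=
  gavg m.*2.+1 (fun t => normc G^`().[rc sig t] ^+ 2 / Re G.[rc sig t]).
Proof.
move=> c0 sG hc r0; rewrite le_eqVlt => /orP[/eqP->//|rs] s1.
have s0 : 0 < sig by apply: le_lt_trans rs.
have sP t : 0 < Re G.[rc sig t].
  by apply: lt_le_trans c0 (hc _ _ _); rewrite ltW.
have [|kap [k0 k1 kA]] := @poisson_average R m (rho / sig).
  by rewrite divr_ge0// 1?ltW//= ltr_pdivrMr// mul1r.
have sG' : (size G^`() <= m.+1)%N.
  have [->|G0] := eqVneq G 0; first by rewrite deriv0 size_poly0.
  by apply: leq_trans sG; apply/ltnW/lt_size_deriv.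
pose F t := normc G^`().[rc sig t] ^+ 2 / Re G.[rc sig t].
have E (A : {poly C}) t : (size A <= m.+1)%N ->
    A.[rc rho t] = \sum_j (kap j)%:C%C * A.[rc sig (gpt R m.*2.+1 j + t)].
  move=> sA; have -> : rc rho t = (rho / sig)%:C%C * rc sig t :> C.
    by rewrite !rcE mulrA -rmorphM /= divfK// gt_eqF.
  by rewrite kA//; under eq_bigr do rewrite cis_rc.
apply: (@le_trans _ _ (gavg m.*2.+1 (fun t => \sum_j kap j * F (gpt R m.*2.+1 j + t)))).
  apply: ler_gavg => t; rewrite (E _ _ sG) (E _ _ sG') Re_sum.
  under [X in _ / X]eq_bigr do rewrite ReZ.
  exact: weighted_cauchy.
rewrite gavg_sum.
have FM j : gavg m.*2.+1 (fun t => kap j * F (gpt R m.*2.+1 j + t)) =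
    kap j * gavg m.*2.+1 F.
  by rewrite gavgZ gavg_shift// => t; rewrite /F rc_per.
under eq_bigr do rewrite FM.
rewrite -mulr_suml k1 mul1r; exact: lexx.
Qed.

End Entropy.

(** * Entropy of a positive harmonic polynomial under dilation *)

Section EntropyContraction.
Variable R : realType.
Local Notation C := R[i].
Variables (G : {poly C}) (c : R).
Hypotheses (c0 : 0 < c) (Gc : forall rho t, 0 <= rho <= 1 -> c <= Re G.[rc rho t]).
Hypothesis G0 : G.[0] = 1.

(** On the circle of radius rho, [X] is dU / d rho and rho [Y] is dU / dt, so that [X]^2 + [Y]^2 =
    |G'|^2; [X'] is dX / d rho. The entropy is [e], and [i] is rho e'. The function [f] is the
    angular derivative of [Y] [L]: its average is O(1/M), and it is the only defect in the identity
    i' = rho J. *)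
Let U rho t : R := Re G.[rc rho t].
Let X rho t : R := Re (G^`().[rc rho t] * cis t).
Let Y rho t : R := - Im (G^`().[rc rho t] * cis t).
Let X' rho t : R := Re (G^`()^`().[rc rho t] * cis t * cis t).
Let L rho t : R := ln (U rho t) + 1.
Let e M rho := gavg M (fun t => U rho t * ln (U rho t)).
Let i M rho := gavg M (fun t => rho * X rho t * L rho t).
Let J M rho := gavg M (fun t => normc G^`().[rc rho t] ^+ 2 / U rho t).
Let f rho t := (- (X rho t + rho * X' rho t)) * L rho t + Y rho t * (rho * Y rho t / U rho t).

Let U_gt0 rho t : 0 <= rho <= 1 -> 0 < U rho t.
Proof. by move=> h; apply: lt_le_trans c0 (Gc _ h). Qed.

Let dUr t rho : dv (U^~ t) rho (X rho t).
Proof. exact: (proj1 (dv_horner_rho G t rho)). Qed.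

Let dXr t rho : dv (X^~ t) rho (X' rho t).
Proof.
rewrite /X; under eq_fun do rewrite ReM.
have [h1 h2] := dv_horner_rho G^`() t rho.
apply: dv_eq; first by apply: dvB; apply: dvM; [exact: h1|exact: dv_cst|exact: h2|exact: dv_cst].
by rewrite /X' !(ReM, ImM, Re_cis, Im_cis); ring.
Qed.

Let dUt t rho : dv (U rho) t (rho * Y rho t).
Proof.
apply: dv_eq; first exact: (proj1 (dv_horner_theta G rho t)).
by rewrite /Y rcE !(ReM, ImM, Re_cis, Im_cis) /=; ring.
Qed.

Let dYt t rho : dv (Y rho) t (- (X rho t + rho * X' rho t)).
Proof.
rewrite /Y; under eq_fun do rewrite ImM.
have [h1 h2] := dv_horner_theta G^`() rho t.
apply: dv_eq.
  by apply/dvN/dvD; apply: dvM; [exact: h1|exact: is_derive_sin|exact: h2|exact: is_derive_cos].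
by rewrite /X /X' rcE !(ReM, ImM, Re_cis, Im_cis) /=; ring.
Qed.

Let dLr t rho : 0 <= rho <= 1 -> dv (L^~ t) rho (X rho t / U rho t).
Proof.
move=> h; apply: dv_eq; first by apply: dvD; [apply: dv_ln; [exact: U_gt0|exact: dUr]|exact: dv_cst].
by rewrite addr0.
Qed.

Let de M rho : 0 <= rho <= 1 -> dv (e M) rho (gavg M (fun t => X rho t * L rho t)).
Proof.
move=> h; apply: dv_gavg => t; apply: dv_eq.
  by apply: dvM; [exact: dUr|apply: dv_ln; [exact: U_gt0|exact: dUr]].
by rewrite /L; field; rewrite gt_eqF ?U_gt0.
Qed.

Let di M rho : 0 <= rho <= 1 -> dv (i M) rho (rho * J M rho - gavg M (f rho)).
Proof.
move=> h; apply: dv_eq.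
  apply: dv_gavg => t; apply: dvM; last exact: dLr.
  by apply: dvM; [exact: dv_id|exact: dXr].
rewrite -gavgZ -gavgB; apply: eq_gavg => t.
have -> : normc G^`().[rc rho t] ^+ 2 = X rho t ^+ 2 + Y rho t ^+ 2.
  by rewrite /Y sqrrN -sqr_normc normcM normc_cis mulr1.
by rewrite /f; field; rewrite gt_eqF ?U_gt0.
Qed.

Let f_small : exists2 K, 0 <= K & forall M rho, (0 < M)%N -> 0 <= rho <= 1 ->
  `|gavg M (f rho)| <= K / M%:R.
Proof.
have [Ur _] := unif_lip_horner G.
have [G1r G1i] := unif_lip_horner G^`().
have [G2r G2i] := unif_lip_horner G^`()^`().
have hc := unif_lip_cos R; have hs := unif_lip_sin R; have hr := unif_lip_rho R.
have hX : unif_lip X.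
  rewrite /X; under eq_fun do under eq_fun do rewrite ReM.
  by apply: unif_lipD; [|apply: unif_lipN]; apply: unif_lipM.
have hY : unif_lip Y.
  rewrite /Y; under eq_fun do under eq_fun do rewrite ImM.
  by apply/unif_lipN/unif_lipD; apply: unif_lipM.
have hX' : unif_lip X'.
  rewrite /X'; under eq_fun do under eq_fun do rewrite ReM ReM ImM.
  apply: unif_lipD; [|apply: unif_lipN]; apply: unif_lipM => //.
    by apply: unif_lipD; [|apply: unif_lipN]; apply: unif_lipM.
  by apply: unif_lipD; apply: unif_lipM.
have hL : unif_lip L.
  by apply: unif_lipD; [exact: (unif_lip_ln c0)|exact: unif_lip_cst].
have [K hK] : unif_lip f.
  apply: unif_lipD; apply: unif_lipM => //.
    by apply/unif_lipN/unif_lipD => //; exact: unif_lipM.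
  by apply: unif_lipM; [exact: unif_lipM|exact: (unif_lipV c0)].
have K0 : 0 <= K.
  by have [h _] := hK 0 0 0 (introT andP (conj (lexx _) ler01)); apply: le_trans h.
exists (K * pi *+ 2); first by rewrite mulrn_wge0// mulr_ge0// pi_ge0.
move=> M rho M0 h; rewrite -mulrnAr -mulrA.
apply: (@gavg_derive_small _ _ (fun t => Y rho t * L rho t)) => //.
- by move=> t; rewrite /Y /L /U rc_per cisD cis2pi mulr1.
- move=> t; apply: dv_eq.
    apply: dvM; first exact: dYt.
    by apply: dvD; [apply: dv_ln; [exact: U_gt0|exact: dUt]|exact: dv_cst].
  by rewrite addr0 /f /L.
- by move=> t s; have [] := hK rho t s h.
Qed.

(** With eta bounding the average of [f]: integrating i' = rho J up to eta and using that J is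
    nondecreasing gives i <= J rho^2 / 2 + eta rho ([step1]). Hence i - 2 e has derivative at least
    -3 eta, so i >= 2 e - 3 eta rho ([step2]), which says that e / rho^2 is nondecreasing up to an
    error. *)
Lemma entropy_contraction r eps : 0 < r <= 1 -> 0 < eps ->
  exists m0, forall m, (m0 <= m)%N -> e m.*2.+1 r <= r ^+ 2 * e m.*2.+1 1 + eps.
Proof.
move=> /andP[r0 r1] eps0; have [K K0 hK] := f_small.
exists (maxn (size G) (Num.truncn (3 * K / eps)).+1) => m.
rewrite geq_max => /andP[sm Km]; set M := m.*2.+1.
have M0 : (0 < M)%N by [].
have MR : 0 < M%:R :> R by rewrite ltr0n.
pose eta := K / M%:R.
have eta0 : 0 <= eta by rewrite divr_ge0// ltW.
have eta3 : 3 * eta <= eps.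
  rewrite /eta mulrA ler_pdivrMr// [leRHS]mulrC -ler_pdivrMr//.
  apply/ltW/(lt_le_trans (truncnS_gt _)); rewrite ler_nat.
  by apply: leq_trans Km _; rewrite /M -addnn leqW// leq_addr.
have fs x : 0 <= x <= 1 -> - eta <= gavg M (f x) /\ gavg M (f x) <= eta.
  by move=> h; have := hK M x M0 h; rewrite ler_norml => /andP[].
have iE x : i M x = x * gavg M (fun t => X x t * L x t).
  by rewrite -gavgZ; apply: eq_gavg => t; rewrite mulrA.
have step1 rho : 0 <= rho <= 1 -> i M rho <= J M rho * rho ^+ 2 / 2 + eta * rho.
  move=> /andP[p0 p1].
  pose g x := J M rho * x ^+ 2 / 2 + eta * x - i M x.
  have g0 : g 0 = 0 by rewrite /g iE; ring.
  suff : g 0 <= g rho by rewrite g0 /g subr_ge0.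
  apply: (@derive_mono _ g (fun x => J M rho * x + eta - (x * J M x - gavg M (f x))) 0 rho); first exact: p0.
    move=> x /andP[x0 xr]; have x1 : 0 <= x <= 1 by rewrite x0 (le_trans xr).
    apply: dvB; last exact: di.
    rewrite /g; under eq_fun do rewrite expr2; apply: dv_eq.
      apply: dvD; apply: dvM; [|exact: dv_cst|exact: dv_cst|exact: dv_id].
      by apply: dvM; [exact: dv_cst|apply: dvM; exact: dv_id].
    by rewrite /=; lra.
  move=> x /andP[x0 xr].
  have xJ : J M x <= J M rho.
    by apply: (dirichlet_energy_mono c0 (leq_trans sm (leqnSn m)) Gc) => //; apply/ltW.
  have [f1 f2] : - eta <= gavg M (f x) /\ gavg M (f x) <= eta.
    by apply: fs; rewrite (ltW x0) (le_trans (ltW xr)).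
  by have := ler_wpM2l (ltW x0) xJ; lra.
have step2 rho : 0 <= rho <= 1 -> 0 <= i M rho - 2 * e M rho + 3 * eta * rho.
  move=> /andP[p0 p1].
  (* The normalisation G (0) = 1 enters here: U is 1 at the centre, where its entropy therefore
     vanishes. *)
  have U0 t : U 0 t = 1 by rewrite /U /rc !mul0r; have -> : (0 +i* 0)%C = 0 :> C by []; rewrite G0.
  pose g x := i M x - 2 * e M x + 3 * eta * x.
  have g0 : g 0 = 0.
    rewrite /g iE mul0r /e (@eq_gavg _ _ _ (fun=> 0)) ?gavg_cst//; first by ring.
    by move=> t; rewrite U0 ln1 mulr0.
  rewrite -/(g rho) -g0.
  apply: (@derive_mono _ g
    (fun x => (x * J M x - gavg M (f x)) - 2 * gavg M (fun t => X x t * L x t) + 3 * eta) 0 rho); first exact: p0.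
    move=> x /andP[x0 xr]; have x1 : 0 <= x <= 1 by rewrite x0 (le_trans xr).
    apply: dv_eq.
      apply: dvD; last by apply: dvM; [exact: dv_cst|exact: dv_id].
      apply: dvB; first exact: di.
      by apply: dvM; [exact: dv_cst|exact: de].
    by rewrite /=; ring.
  move=> x /andP[x0 xr]; have x1 : 0 <= x <= 1 by rewrite (ltW x0) (le_trans (ltW xr)).
  have [f1 f2] := fs _ x1.
  have := step1 _ x1; rewrite iE.
  rewrite (_ : J M x * x ^+ 2 / 2 + eta * x = x * (J M x * x / 2 + eta)); last by ring.
  by rewrite ler_pM2l// => h; lra.
(* The derivative of e / x^2 is at least -3 eta / x^2; on [r, 1] the linear term compensates for
   it. *)
pose a x := e M x / x ^+ 2 + 3 * eta / r ^+ 2 * x.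
have a1 : a r <= a 1.
  apply: (@derive_mono _ a (fun x => (i M x - 2 * e M x) / x ^+ 3 + 3 * eta / r ^+ 2) r 1); first exact: r1.
    move=> x /andP[rx x1]; have x0 : 0 < x by apply: lt_le_trans rx.
    have xn : x != 0 by rewrite gt_eqF.
    apply: dv_eq.
      apply: dvD; last by apply: dvM; [exact: dv_cst|exact: dv_id].
      apply: dvM; first by apply: de; rewrite (ltW x0).
      apply: (@dvV _ (fun x => x ^+ 2)); first by rewrite expf_neq0.
      by under eq_fun do rewrite expr2; apply: dvM; exact: dv_id.
    by rewrite /= iE; field; rewrite xn gt_eqF.
  move=> x /andP[rx x1]; have x0 : 0 < x by apply: lt_trans rx.
  have h : 0 <= x <= 1 by rewrite !ltW.
  have s2 := step2 _ h.
  have : - (3 * eta) / r ^+ 2 <= (i M x - 2 * e M x) / x ^+ 3; last by rewrite mulNr -subr_ge0 opprK.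
  apply: (@le_trans _ _ (- (3 * eta) / x ^+ 2)).
    rewrite !mulNr lerN2 ler_wpM2l ?mulr_ge0// lef_pV2 ?posrE ?exprn_gt0//.
    by rewrite ler_sqr ?nnegrE ltW.
  have -> : - (3 * eta) / x ^+ 2 = (- (3 * eta * x)) / x ^+ 3 by field; rewrite gt_eqF.
  by apply: ler_wpM2r; [rewrite invr_ge0 exprn_ge0// ltW|lra].
move: a1; rewrite /a expr1n divr1 mulr1.
have r2 : 0 < r ^+ 2 by rewrite exprn_gt0.
rewrite -(ler_pM2l r2) => H.
have rn : r != 0 by rewrite gt_eqF.
have E1 : r ^+ 2 * (e M r / r ^+ 2 + 3 * eta / r ^+ 2 * r) = e M r + 3 * eta * r by field.
have E2 : r ^+ 2 * (e M 1 + 3 * eta / r ^+ 2) = r ^+ 2 * e M 1 + 3 * eta by field.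
move: H; rewrite E1 E2 => H; have : 0 <= 3 * eta * r by rewrite !mulr_ge0// ltW.
by move=> ?; lra.
Qed.

End EntropyContraction.

(** * Weissler's inequality in one variable *)

Section Approx.
Variable R : realType.
Local Notation C := R[i].

(** The tail of the exponential series at x is bounded by the tail at B, so one truncation serves
    the whole interval. *)
Lemma exp_poly_approx (B eps : R) : 0 <= B -> 0 < eps ->
  exists Q : {poly R}, forall x, `|x| <= B -> `|Q.[x] - expR x| <= eps.
Proof.
move=> B0 e0.
have SE (x : R) n : series (exp_coeff x) n = \sum_(k < n) (k`!%:R)^-1 * x ^+ k.
  by rewrite /series /= big_mkord; apply: eq_bigr => k _; rewrite exp_coeffE.
have cv (x : R) : series (exp_coeff x) @ \oo --> expR x.
  exact: is_cvg_series_exp_coeff.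
have /cvgrPdist_le /(_ _ e0) [n _ hn] := cv B.
exists (\poly_(k < n) (k`!%:R)^-1) => x xB.
rewrite horner_poly -SE.
have step N : (n <= N)%N -> `|series (exp_coeff x) n - series (exp_coeff x) N| <= eps.
  move=> nN; apply: le_trans (hn n (leqnn n)).
  have mono m1 m2 : (m1 <= m2)%N -> series (exp_coeff B) m1 <= series (exp_coeff B) m2.
    move=> m12; rewrite -subr_ge0 sub_series_geq//; apply: sumr_ge0 => k _.
    by rewrite exp_coeffE mulr_ge0 ?invr_ge0 ?ler0n ?exprn_ge0.
  have up m1 : series (exp_coeff B) m1 <= expR B.
    rewrite -(cvg_lim _ (cv B))//; apply: limr_ge; first by apply/cvg_ex; exists (expR B).
    by exists m1 => // k; exact: mono.
  rewrite (@ger0_norm _ (expR B - _)) ?subr_ge0 ?up// distrC sub_series_geq//.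
  apply: le_trans (ler_norm_sum _ _ _) _.
  apply: (@le_trans _ _ (series (exp_coeff B) N - series (exp_coeff B) n)); last first.
    by rewrite lerB// up.
  rewrite sub_series_geq//; apply: ler_sum => k _.
  rewrite !exp_coeffE normrM normrX ger0_norm ?invr_ge0 ?ler0n// ler_wpM2l ?invr_ge0 ?ler0n//.
  by rewrite lerXn2r ?nnegrE.
have cx : (fun N => `|series (exp_coeff x) n - series (exp_coeff x) N|) @ \oo -->
    `|series (exp_coeff x) n - expR x|.
  by apply: cvg_norm; apply: cvgB; [exact: cvg_cst|exact: cv].
rewrite -(cvg_lim _ cx)//; apply: limr_le; first by apply/cvg_ex; eexists; exact: cx.
by exists n => // N; exact: step.
Qed.

(* truncation of - ln (1 - X); the constant coefficient is 0^-1 = 0 *)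
Definition lnpoly (n : nat) : {poly R} := \poly_(k < n.+1) k%:R^-1.

Definition lnpolyC n : {poly C} := map_poly (real_complex R) (lnpoly n).

Lemma lnpolyC_deriv n (w : C) : (lnpolyC n)^`().[w] * (1 - w) = 1 - w ^+ n.
Proof.
have -> : (lnpolyC n)^`() = \poly_(k < n) 1.
  apply/polyP => k; rewrite coef_deriv coef_map !coef_poly ltnS.
  case: ltnP => kn; last by rewrite raddf0 mul0rn.
  by rewrite -raddfMn -[_ *+ _]mulr_natl divff// pnatr_eq0.
rewrite horner_poly; under eq_bigr do rewrite mul1r.
by rewrite mulrC -opprB -[1 - _ ^+ _]opprB subrX1 mulNr.
Qed.

(** A complex logarithm is avoided by working along the segment w = r z, 0 <= r <= 1: there the
    quantity has derivative - Re (z w^n / (1 - w)), bounded by tau^(n+1) / (1 - tau), and it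
    vanishes at r = 0. *)
Lemma ln_normc_approx n (z : C) (tau : R) : normc z <= tau -> tau < 1 ->
  `|ln (normc (1 - z)) + Re (lnpolyC n).[z]| <= tau ^+ n.+1 / (1 - tau).
Proof.
case: z => a b ht t1; set z : C := (a +i* b)%C in ht *.
have t0 : 0 <= tau by apply: le_trans ht; exact: normc_ge0.
pose w r : C := (r * a +i* (r * b))%C.
have wE r : w r = r%:C%C * z.
  by apply/eqP; rewrite eq_complex ReZ ImZ /= !eqxx.
pose D r : R := (1 - r * a) * (1 - r * a) + (r * b) * (r * b).
have DE r : D r = normc (1 - w r) ^+ 2.
  by rewrite sqr_normc /= /D; ring.
have wt r : 0 <= r <= 1 -> normc (w r) <= tau.
  move=> /andP[r0 r1]; rewrite wE normcM normc_real ger0_norm//.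
  by apply: le_trans ht; rewrite ler_piMl ?normc_ge0.
have w1 r : 0 <= r <= 1 -> 1 - tau <= normc (1 - w r).
  move=> /wt h; have := ler_dist_normc 1 (w r); rewrite normc1 => h2.
  have := ler_dist_normc 1 (1 - w r); rewrite normc1 opprB addrCA subrr addr0 => h3.
  by have := le_trans (ler_norm _) h3; lra.
have D0 r : 0 <= r <= 1 -> 0 < D r.
  by move=> h; rewrite DE exprn_gt0//; apply: lt_le_trans (w1 _ h); rewrite subr_gt0.
pose h r := 2^-1 * ln (D r) + Re (lnpolyC n).[w r].
pose dh r := - Re (z * w r ^+ n * conjc (1 - w r)) / D r.
have hd r : 0 <= r <= 1 -> dv h r (dh r).
  move=> hr; apply: dv_eq.
    apply: dvD.
      apply: dvM; first exact: dv_cst.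
      apply: dv_ln; first exact: D0.
      apply: dvD; apply: dvM.
      - by apply: dvB; [exact: dv_cst|apply: dvM; [exact: dv_id|exact: dv_cst]].
      - by apply: dvB; [exact: dv_cst|apply: dvM; [exact: dv_id|exact: dv_cst]].
      - by apply: dvM; [exact: dv_id|exact: dv_cst].
      - by apply: dvM; [exact: dv_id|exact: dv_cst].
    apply: (proj1 (dv_horner _ _ _)).
    - by apply: dvM; [exact: dv_id|exact: dv_cst].
    - by apply: dvM; [exact: dv_id|exact: dv_cst].
  have Dn : D r != 0 by rewrite gt_eqF ?D0.
  have E : Re (((lnpolyC n)^`()).[w r] * z) =
     Re ((1 - w r ^+ n) * z * conjc (1 - w r)) / D r.
    rewrite -(lnpolyC_deriv n); apply: (mulIf Dn); rewrite divfK// mulrC -ReZ DE -mulcJ.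
    by congr complex.Re; ring.
  rewrite !mul1r !mulr0 !addr0 -/(w r) -/z E /dh.
  have -> : Re ((1 - w r ^+ n) * z * conjc (1 - w r)) =
     Re (z * conjc (1 - w r)) - Re (z * w r ^+ n * conjc (1 - w r)).
    by rewrite -ReN -ReD; congr complex.Re; ring.
  have -> : Re (z * conjc (1 - w r)) = a * (1 - r * a) - r * b * b.
    by rewrite ReM /=; ring.
  by field.
have [c c01 E] := mvt_seg ler01 hd.
have h0 : h 0 = 0.
  rewrite /h /D !mul0r subr0 mulr1 addr0 ln1 mulr0 add0r wE rmorph0 mul0r.
  by rewrite horner_coef0 coef_map coef_poly /= mulr0n invr0.
have h1 : h 1 = ln (normc (1 - z)) + Re (lnpolyC n).[z].
  rewrite /h DE wE mul1r; congr (_ + _).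
  rewrite lnXn; first by rewrite -[ln _ *+ 2]mulr_natl mulKf// pnatr_eq0.
  have := w1 1; rewrite wE mul1r ler01 lexx => /(_ isT); apply: lt_le_trans.
  by rewrite subr_gt0.
rewrite -h1 -[h 1]subr0 -{1}h0 E subr0 mulr1 /dh mulNr normrN normrM.
have nz : 0 < normc (1 - w c) by apply: lt_le_trans (w1 _ c01); rewrite subr_gt0.
rewrite normfV (gtr0_norm (D0 _ c01)) DE ler_pdivrMr ?exprn_gt0//.
apply: le_trans (Re_le_normc _) _; rewrite !normcM normcX normcJ expr2 mulrA.
rewrite ler_pM2r//; apply: (@le_trans _ _ (tau ^+ n.+1)).
  rewrite exprS; apply: ler_pM; rewrite ?normc_ge0 ?exprn_ge0 ?normc_ge0//.
  by rewrite lerXn2r ?nnegrE ?normc_ge0// wt.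
rewrite mulrAC -[leLHS]mulr1 -mulrA ler_wpM2l ?exprn_ge0//.
by rewrite ler_pdivlMr ?subr_gt0// mul1r w1.
Qed.

Lemma expn_small (tau eps : R) : 0 <= tau < 1 -> 0 < eps ->
  exists n, forall k, (n <= k)%N -> tau ^+ k <= eps.
Proof.
move=> /andP[t0 t1] e0.
have /cvgrPdist_le /(_ _ e0) [n _ hn] : (fun k => tau ^+ k) @ \oo --> (0 : R).
  by apply: cvg_expr; rewrite ger0_norm.
by exists n => k /hn; rewrite /= sub0r normrN ger0_norm// exprn_ge0.
Qed.

Lemma ln_poly_approx (c B eps : R) : 0 < c -> c <= B -> 0 < eps ->
  exists Q : {poly R}, forall x, c <= x <= B -> `|Q.[x] - ln x| <= eps.
Proof.
move=> c0 cB e0; have B0 : 0 < B by exact: lt_le_trans cB.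
(* Expansion at the right end: ln x = ln B + ln (1 - y), where y = 1 - x / B stays in [0, tau] and
   tau < 1. *)
pose tau := 1 - c / B.
have cB1 : c / B <= 1 by rewrite ler_pdivrMr// mul1r.
have cB0 : 0 < c / B by rewrite divr_gt0.
have t01 : 0 <= tau < 1 by rewrite /tau; apply/andP; split; lra.
have /andP[t0 t1] := t01.
have [|n hn] := @expn_small tau (eps * (1 - tau)) t01.
  by rewrite mulr_gt0// subr_gt0.
exists ((ln B)%:P - (lnpoly n \Po (1 - B^-1 *: 'X))) => x /andP[cx xB].
have x0 : 0 < x by exact: lt_le_trans cx.
pose y := 1 - x / B.
have y0 : 0 <= y by rewrite /y subr_ge0 ler_pdivrMr// mul1r.
have yt : y <= tau by rewrite /y /tau lerB// ler_wpM2r// invr_ge0 ltW.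
rewrite !hornerE horner_comp !hornerE mulrC -/y.
have -> : ln x = ln B + ln (1 - y).
  by rewrite /y opprB addrCA subrr addr0 -lnM ?posrE ?divr_gt0//; congr ln; field; rewrite gt_eqF.
have ny : normc (y%:C%C : C) <= tau by rewrite normc_real ger0_norm.
have := ln_normc_approx n ny t1.
have -> : (1 - y%:C%C : C) = (1 - y)%:C%C by apply/eqP; rewrite eq_complex /= subr0 !eqxx.
rewrite horner_map normc_real (@ger0_norm _ (1 - y)) /=; last by lra.
move=> H; rewrite (_ : _ - _ = - (ln (1 - y) + (lnpoly n).[y])); last by ring.
rewrite normrN; apply: le_trans H _; rewrite ler_pdivrMr ?subr_gt0//.
exact: hn.
Qed.

End Approx.

(** * Real trigonometric polynomials, duality and the Gibbs inequality *)

Section Trig.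
Variable R : realType.
Local Notation C := R[i].
Implicit Types (F H : R -> R) (G : {poly C}).

Lemma rc1 t : rc 1 t = cis t :> C.
Proof. by rewrite rcE mul1r. Qed.

(** Negative frequencies are folded onto positive ones by conjugation, so these are all real
    trigonometric polynomials. The analytic polynomial G provides the harmonic extension to the
    disc. *)
Definition trig F := exists G, forall t, F t = Re G.[cis t].

Lemma trig_cst c : trig (fun=> c).
Proof. by exists (c%:C%C)%:P => t; rewrite hornerC. Qed.

Lemma trigD F H : trig F -> trig H -> trig (fun t => F t + H t).
Proof. by move=> [A hA] [B hB]; exists (A + B) => t; rewrite hornerD ReD hA hB. Qed.

Lemma trigZ c F : trig F -> trig (fun t => c * F t).
Proof. by move=> [A hA]; exists (c%:C%C *: A) => t; rewrite hornerZ ReZ hA. Qed.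

Lemma trig_sum I (r : seq I) (F : I -> R -> R) :
  (forall i, trig (F i)) -> trig (fun t => \sum_(i <- r) F i t).
Proof.
move=> h; elim: r => [|i r IH].
  by under eq_fun do rewrite big_nil; exact: trig_cst.
by under eq_fun do rewrite big_cons; exact: trigD.
Qed.

Lemma cis_conjX (t : R) n : cis t ^+ n * conjc (cis t) ^+ n = 1.
Proof. by rewrite -exprMn cis_conjV expr1n. Qed.

Lemma trig_mono (c : C) n m : trig (fun t => Re (c * cis t ^+ n * conjc (cis t) ^+ m)).
Proof.
have mono (d : C) k : trig (fun t => Re (d * cis t ^+ k)).
  by exists (d *: 'X^k) => t; rewrite hornerZ hornerXn.
have [mn|/ltnW nm] := leqP m n.
  have [G hG] := mono c (n - m)%N; exists G => t; rewrite -hG.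
  by rewrite -{1}(subnK mn) exprD mulrA -mulrA cis_conjX mulr1.
have [G hG] := mono (conjc c) (m - n)%N; exists G => t; rewrite -hG.
rewrite -{1}(subnK nm) [_ ^+ (m - n + n)]exprD mulrACA -mulrA cis_conjX mulr1.
have -> : c * conjc (cis t) ^+ (m - n) = conjc (conjc c * cis t ^+ (m - n)).
  by rewrite rmorphM rmorphXn /= conjcK.
by case: (conjc c * _).
Qed.

Lemma Re_mul (z w : C) : Re z * Re w = 2^-1 * (Re (z * w) + Re (z * conjc w)).
Proof. by case: z w => a b [d e] /=; field. Qed.

Lemma Re_mono_mul (a b : C) t j k :
  Re (a * cis t ^+ j) * Re (b * cis t ^+ k) =
  2^-1 * (Re (a * b * cis t ^+ (j + k) * conjc (cis t) ^+ 0) +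
          Re (a * conjc b * cis t ^+ j * conjc (cis t) ^+ k)).
Proof.
rewrite Re_mul rmorphM rmorphXn expr0 mulr1 exprD.
by congr (_ * (Re _ + Re _)); ring.
Qed.

Lemma trigM F H : trig F -> trig H -> trig (fun t => F t * H t).
Proof.
move=> [A hA] [B hB].
have -> : (fun t => F t * H t) = (fun t => \sum_(j < size A) \sum_(k < size B)
    Re (A`_j * cis t ^+ j) * Re (B`_k * cis t ^+ k)).
  apply/funext => t; rewrite hA hB !horner_coef !Re_sum mulr_suml.
  by apply: eq_bigr => j _; rewrite mulr_sumr.
apply: trig_sum => j; apply: trig_sum => k.
under eq_fun do rewrite Re_mono_mul.
by apply/trigZ/trigD; exact: trig_mono.
Qed.

Lemma trig_horner F (Q : {poly R}) : trig F -> trig (fun t => Q.[F t]).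
Proof.
move=> hF; elim/poly_ind: Q => [|Q c IH].
  by under eq_fun do rewrite horner0; exact: trig_cst.
under eq_fun do rewrite hornerMXaddC.
by apply: trigD; [exact: trigM | exact: trig_cst].
Qed.

Lemma gavg_orth M n m (c : C) : (0 < M)%N ->
  gavg M (fun t => Re (c * cis t ^+ n * conjc (cis t) ^+ m)) =
  if (n == m %[mod M])%N then Re c else 0.
Proof.
move=> M0; rewrite /gavg -Re_sum; under eq_bigr do rewrite -mulrA.
rewrite -mulr_sumr grid_orth//; case: ifP => _; last by rewrite mulr0 /= mulr0.
have -> : (M%:R : C) = (M%:R)%:C%C by rewrite rmorph_nat.
by rewrite [c * _]mulrC ReZ mulKf// pnatr_eq0 -lt0n.
Qed.

Lemma gavg_horner M G rho : (0 < M)%N -> (size G <= M)%N ->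
  gavg M (fun t => Re G.[rc rho t]) = Re G.[0].
Proof.
move=> M0 sG.
rewrite (@eq_gavg _ _ _ (fun t => \sum_(k < size G)
    Re (G`_k * rho%:C%C ^+ k * cis t ^+ k * conjc (cis t) ^+ 0))); last first.
  move=> t; rewrite horner_coef Re_sum rcE; apply: eq_bigr => k _.
  by rewrite exprMn expr0 mulr1 mulrA.
rewrite gavg_sum; under eq_bigr do rewrite gavg_orth//.
rewrite horner_coef0; case E: (size G) => [|n].
  by rewrite big_ord0 nth_default ?E.
rewrite big_ord_recl eqxx expr0 mulr1 big1 ?addr0//.
move=> k _; have kM : (lift ord0 k < M)%N.
  by apply: leq_trans sG; rewrite E ltn_ord.
by rewrite [in RHS]/= (modn_small kM) (modn_small M0).
Qed.

(** Only pairs of equal frequencies contribute to the average of a product, and the dilation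
    multiplies frequency j by r^j whichever factor it acts on. The bound on the sizes excludes
    aliasing. *)
Lemma gavg_adjoint M G (H : {poly C}) r : (0 < M)%N -> (size G + size H <= M)%N ->
  gavg M (fun t => Re G.[rc 1 t] * Re H.[rc r t]) =
  gavg M (fun t => Re G.[rc r t] * Re H.[rc 1 t]).
Proof.
move=> M0 sM.
have exp_ (rho sig : R) : gavg M (fun t => Re G.[rc rho t] * Re H.[rc sig t]) =
    \sum_(j < size G) \sum_(k < size H)
    rho ^+ j * sig ^+ k * gavg M (fun t => Re (G`_j * cis t ^+ j) * Re (H`_k * cis t ^+ k)).
  rewrite (@eq_gavg _ _ _ (fun t => \sum_(j < size G) \sum_(k < size H)
      rho ^+ j * sig ^+ k * (Re (G`_j * cis t ^+ j) * Re (H`_k * cis t ^+ k)))).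
    rewrite gavg_sum; apply: eq_bigr => j _; rewrite gavg_sum.
    by apply: eq_bigr => k _; rewrite gavgZ.
  move=> t; rewrite !horner_coef !Re_sum mulr_suml !rcE; apply: eq_bigr => j _.
  rewrite mulr_sumr; apply: eq_bigr => k _; rewrite !exprMn.
  rewrite -!rmorphXn !(mulrCA _ (_%:C%C)) !ReZ; ring.
rewrite !exp_; apply: eq_bigr => j _; apply: eq_bigr => k _.
have [->|jk] := eqVneq (j : nat) k; first by rewrite !expr1n mulr1 mul1r.
suff -> : gavg M (fun t => Re (G`_j * cis t ^+ j) * Re (H`_k * cis t ^+ k)) = 0.
  by rewrite !mulr0.
under eq_gavg do rewrite Re_mono_mul.
have jM : (j + k < M)%N by apply: leq_trans sM; rewrite -addSn leq_add// ltnW.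
rewrite gavgZ gavgD !gavg_orth// mod0n !modn_small//.
- by rewrite (negbTE jk) addr0; case: (j : nat) (k : nat) jk => [|?] [|?]; rewrite ?mulr0.
- by apply: leq_ltn_trans jM; rewrite leq_addl.
- by apply: leq_ltn_trans jM; rewrite leq_addr.
Qed.

(** The inequality ln y <= y - 1 at y = exp a / (S u), where S is the average of exp a, averaged
    against the probability density u. *)
Lemma gibbs M (u a : R -> R) : (0 < M)%N -> (forall t, 0 < u t) -> gavg M u = 1 ->
  gavg M (fun t => u t * (a t - ln (u t))) <= ln (gavg M (fun t => expR (a t))).
Proof.
move=> M0 u0 u1; set S := gavg M (fun t => expR (a t)).
have S0 : 0 < S.
  rewrite /S mulr_gt0 ?invr_gt0 ?ltr0n//; case: M M0 {u1 S} => // M _.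
  by rewrite big_ord_recl ltr_wpDr ?expR_gt0// sumr_ge0// => k _; exact: expR_ge0.
rewrite -subr_le0.
have -> : 0 = gavg M (fun t => expR (a t) / S - u t).
  rewrite gavgB u1 (@eq_gavg _ _ _ (fun t => S^-1 * expR (a t))).
    by rewrite gavgZ -/S mulVf ?subrr// gt_eqF.
  by move=> t; rewrite mulrC.
have -> : gavg M (fun t => u t * (a t - ln (u t))) - ln S =
    gavg M (fun t => u t * (a t - ln (u t) - ln S)).
  under [RHS]eq_gavg do rewrite mulrBr.
  rewrite gavgB (@eq_gavg _ _ (fun t => u t * ln S) (fun t => ln S * u t)).
    by rewrite gavgZ u1 mulr1.
  by move=> t; rewrite mulrC.
apply: ler_gavg => t.
have -> : expR (a t) / S - u t = u t * (expR (a t) / S / u t - 1).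
  by field; rewrite !gt_eqF.
rewrite ler_pM2l//.
have p : 0 < expR (a t) / S / u t by rewrite !divr_gt0// expR_gt0.
have := @le_ln1Dx _ (expR (a t) / S / u t - 1).
rewrite addrCA subrr addr0 !ln_div ?posrE ?divr_gt0 ?expR_gt0// expRK.
by move=> h; rewrite addrAC h//; lra.
Qed.

End Trig.

(** * Weissler's inequality for exponentials of polynomials *)

Section ExpHyper.
Variable R : realType.
Local Notation C := R[i].
Implicit Types (G Phi : {poly C}).

Lemma Re_horner_bound Phi : exists2 K : R, 0 <= K &
  forall rho t, 0 <= rho <= 1 -> `|Re Phi.[rc rho t]| <= K.
Proof.
have [[K hK] _] := unif_lip_horner Phi; exists K; last first.
  by move=> rho t h; have [] := hK rho t 0 h.
have [h _] := hK 0 0 0 (introT andP (conj (lexx _) ler01)).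
exact: le_trans h.
Qed.

(** Minimum principle for harmonic functions, through the convex combination of
    [poisson_average]. *)
Lemma Re_horner_min G (c : R) : (forall t, c <= Re G.[cis t]) ->
  forall rho t, 0 <= rho <= 1 -> c <= Re G.[rc rho t].
Proof.
move=> h rho t /andP[r0]; rewrite le_eqVlt => /orP[/eqP->|r1].
  by rewrite rc1.
have [|kap [k0 k1 kA]] := @poisson_average R (size G) rho; first by rewrite r0.
rewrite rcE kA// Re_sum -[c]mul1r -k1 mulr_suml; apply: ler_sum => j _.
by rewrite ReZ -cisD ler_wpM2l.
Qed.

(* Duality: with u = exp (s Re Phi (r z)) / Z, Z the average of the exponential,
   ln Z = avg (u (s a_r)) - avg (u ln u), the contraction r is moved from a = Re Phi to u by
   [gavg_adjoint], the entropy of u_r is at most r^2 times that of u, and [gibbs] concludes. *)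
Lemma exp_hypercontractive Phi (s r eps : R) : 1 <= s -> 0 < r -> r ^+ 2 * s = 1 -> 0 < eps ->
  exists m0, forall m, (m0 <= m)%N ->
  gavg m.*2.+1 (fun t => expR (s * Re Phi.[rc r t])) <=
  gavg m.*2.+1 (fun t => expR (Re Phi.[rc 1 t])) `^ s + eps.
Proof.
move=> s1 r0 rs e0; have s0 : 0 < s by apply: lt_le_trans s1.
have r1 : r <= 1.
  have : r ^+ 2 <= 1 by rewrite -[leRHS]rs ler_peMr// exprn_ge0// ltW.
  by rewrite expr_le1// ltW.
have r01 : 0 <= r <= 1 by rewrite ltW.
have i01 : 0 <= (1 : R) <= 1 by rewrite ler01 lexx.
have [K K0 hK] := Re_horner_bound Phi.
pose be := s * K.
have be0 : 0 <= be by rewrite mulr_ge0// ltW.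
pose B t := s * Re Phi.[rc r t].
have hB t : `|B t| <= be by rewrite normrM gtr0_norm// ler_pM2l// hK.
(* At the end a factor exp eta multiplies exp (s ln S) <= exp be; this eta makes the excess at most
   eps. *)
pose eta := ln (1 + eps * expR (- be)).
have ee0 : 0 < eps * expR (- be) by rewrite mulr_gt0// expR_gt0.
have eta0 : 0 < eta by rewrite ln_gt0// ltrDl.
pose de := Num.min 2^-1 (eta / 6).
have de0 : 0 < de by rewrite lt_min invr_gt0 ltr0n/= divr_gt0.
have de2 : de <= 2^-1 by rewrite ge_min lexx.
have de6 : de <= eta / 6 by rewrite ge_min lexx orbT.
have d0 : 0 < expR (- be) * de by rewrite mulr_gt0// expR_gt0.
(* The density exp B is replaced by a trigonometric polynomial v, of relative error de, since
   duality and entropy contraction are available for these only. *)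
have [Q hQ] := exp_poly_approx be0 d0.
pose v t := Q.[B t].
have Bge t : expR (- be) <= expR (B t).
  by rewrite ler_expR; have := hB t; rewrite ler_norml => /andP[].
have v1 t : v t <= expR (B t) * (1 + de).
  have := hQ _ (hB t); rewrite ler_norml -/(v t) => /andP[_ h].
  by have := ler_wpM2r (ltW de0) (Bge t); lra.
have v2 t : expR (B t) - expR (- be) * de <= v t.
  by have := hQ _ (hB t); rewrite ler_norml -/(v t) => /andP[h _]; lra.
pose c := expR (- be) / 2.
have c0 : 0 < c by rewrite divr_gt0// expR_gt0.
have vc t : c <= v t.
  apply: le_trans (v2 t); have := Bge t.
  by have := ler_wpM2l (expR_ge0 (- be)) de2; rewrite /c; lra.
have [G hG] : trig v.
  apply/trig_horner/trigZ; exists (Phi \Po (r%:C%C *: 'X)) => t.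
  by rewrite horner_comp hornerZ hornerX rcE.
pose g0 := Re G.[0].
have gc : c <= g0.
  have := @Re_horner_min G c _ 0 0; rewrite /rc !mul0r.
  by apply; [move=> t; rewrite -hG|rewrite lexx ler01].
have g0p : 0 < g0 by apply: lt_le_trans gc.
(* Normalisation to G2 (0) = 1: the imaginary constant does not affect the real part, and g0 is the
   mean of v on fine grids. *)
pose G2 := (g0^-1)%:C%C *: (G - ('i%C * (Im G.[0])%:C%C)%:P).
have G2E w : Re G2.[w] = g0^-1 * Re G.[w].
  by rewrite hornerZ ReZ hornerD hornerN hornerC ReD ReN ReM /= mul0r mulr0 subrr subr0.
have G20 : G2.[0] = 1.
  apply/eqP; rewrite eq_complex; apply/andP; split; apply/eqP.
    by rewrite G2E /= mulVf// gt_eqF.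
  by rewrite hornerZ ImZ hornerD hornerN hornerC ImD ImN ImM /= mul0r add0r mul1r subrr mulr0.
have G2c t : c / g0 <= Re G2.[cis t].
  by rewrite G2E mulrC ler_pM2l ?invr_gt0// -hG.
have G2c' := Re_horner_min G2c.
have cg0 : 0 < c / g0 by rewrite divr_gt0.
pose e2 := eta / (2 * s).
have e20 : 0 < e2 by rewrite divr_gt0// mulr_gt0.
have [|m0 hm0] := entropy_contraction cg0 G2c' G20 (r := r) (eps := e2) _ e20.
  by rewrite r0.
exists (maxn m0 (size G2 + size Phi + size G)) => m; rewrite geq_max => /andP[mm0 msz].
set M := m.*2.+1; have M0 : (0 < M)%N by [].
have MG : (size G2 + size Phi + size G <= M)%N.
  by apply: leq_trans msz _; rewrite /M -addnn leqW// leq_addr.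
pose u rho t := Re G2.[rc rho t].
have u0 rho t : 0 <= rho <= 1 -> 0 < u rho t.
  by move=> h; apply: lt_le_trans cg0 (G2c' _ _ h).
have uavg rho : gavg M (u rho) = 1.
  by rewrite gavg_horner// ?G20// (leq_trans _ MG)// -addnA leq_addr.
have uv t : u 1 t = g0^-1 * v t by rewrite /u rc1 G2E hG.
pose A := gavg M (fun t => expR (B t)).
pose S := gavg M (fun t => expR (Re Phi.[rc 1 t])).
have avgM (F H : R -> R) : (forall t, F t <= H t) -> gavg M F <= gavg M H by exact: ler_gavg.
have Age : expR (- be) <= A.
  by rewrite -(gavg_cst (expR (- be)) M0); apply: avgM.
have A0 : 0 < A by apply: lt_le_trans Age; exact: expR_gt0.
have g0A : (1 - de) * A <= g0.
  have -> : g0 = gavg M v.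
    rewrite (@eq_gavg _ _ _ (fun t => Re G.[rc 1 t])); last by move=> t; rewrite rc1 hG.
    by rewrite gavg_horner// (leq_trans _ MG)// leq_addl.
  apply: (@le_trans _ _ (A - expR (- be) * de)).
    by have := ler_wpM2r (ltW de0) Age; lra.
  rewrite -(gavg_cst (expR (- be) * de) M0) -gavgB; exact: avgM.
have ent := hm0 m mm0; rewrite -/M in ent.
have gib : gavg M (fun t => u r t * (Re Phi.[rc 1 t] - ln (u r t))) <= ln S.
  by apply: gibbs => // t; exact: u0.
have adj : gavg M (fun t => u 1 t * Re Phi.[rc r t]) = gavg M (fun t => u r t * Re Phi.[rc 1 t]).
  by apply: gavg_adjoint => //; rewrite (leq_trans _ MG)// leq_addr.
have vp t : 0 < v t by apply: lt_le_trans (vc t).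
have low : ln g0 - de <= gavg M (fun t => u 1 t * (B t - ln (u 1 t))).
  have -> : ln g0 - de = gavg M (fun t => u 1 t * (ln g0 - de)).
    rewrite (@eq_gavg _ _ _ (fun t => (ln g0 - de) * u 1 t)); last by move=> t; rewrite mulrC.
    by rewrite gavgZ uavg mulr1.
  apply: avgM => t; rewrite ler_wpM2l ?(ltW (u0 _ _ i01))//.
  rewrite uv lnM ?posrE ?invr_gt0// lnV ?posrE// opprD opprK addrCA lerD2l.
  have : ln (v t) <= B t + de; last by lra.
  apply: (@le_trans _ _ (ln (expR (B t) * (1 + de)))).
    by rewrite ler_ln ?posrE ?mulr_gt0 ?expR_gt0 ?addr_gt0.
  rewrite lnM ?posrE ?expR_gt0 ?addr_gt0// expRK lerD2l le_ln1Dx//.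
  by apply: lt_trans de0; rewrite oppr_lt0.
have chain : ln g0 - de <= s * ln S + s * e2.
  apply: le_trans low _.
  have -> : gavg M (fun t => u 1 t * (B t - ln (u 1 t))) =
      s * gavg M (fun t => u r t * Re Phi.[rc 1 t]) - gavg M (fun t => u 1 t * ln (u 1 t)).
    rewrite -adj -gavgZ -gavgB; apply: eq_gavg => t; rewrite /B; ring.
  have : s * gavg M (fun t => u r t * ln (u r t)) <=
         gavg M (fun t => u 1 t * ln (u 1 t)) + s * e2.
    have := ler_wpM2l (ltW s0) ent; rewrite mulrDr (mulrA s (r ^+ 2)) (_ : s * r ^+ 2 = 1) ?mul1r; last by rewrite mulrC.
    exact.
  have := ler_wpM2l (ltW s0) gib.
  rewrite (@eq_gavg _ _ _ (fun t => u r t * Re Phi.[rc 1 t] - u r t * ln (u r t))); last first.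
    by move=> t; rewrite mulrBr.
  by rewrite gavgB mulrBr; lra.
have S0 : 0 < S.
  apply: (@lt_le_trans _ _ (expR (- K))); first exact: expR_gt0.
  rewrite -(gavg_cst (expR (- K)) M0); apply: avgM => t; rewrite ler_expR.
  by have := hK 1 t i01; rewrite ler_norml => /andP[].
have SK : S <= expR K.
  rewrite -(gavg_cst (expR K) M0); apply: avgM => t; rewrite ler_expR.
  by have := hK 1 t i01; rewrite ler_norml => /andP[].
have lnde : - (2 * de) <= ln (1 - de).
  have dl : 0 < 1 - de by lra.
  rewrite -[leRHS]opprK lerN2 -lnV ?posrE//.
  have -> : (1 - de)^-1 = 1 + de / (1 - de) by field; rewrite gt_eqF.
  apply: le_trans (le_ln1Dx _) _.
    by apply: (@lt_trans _ _ 0); rewrite ?divr_gt0// oppr_lt0.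
  by rewrite ler_pdivrMr//; nra.
have lnA : ln A <= s * ln S + eta.
  have : ln (1 - de) + ln A <= ln g0.
    have dl : 0 < 1 - de by lra.
    by rewrite -lnM ?posrE// ler_ln ?posrE// mulr_gt0.
  have -> : eta = 6 * (eta / 6) / 2 + s * e2 by rewrite /e2; field; rewrite gt_eqF.
  by lra.
rewrite -/A -/S -[A]lnK ?posrE//.
have -> : S `^ s = expR (s * ln S) by rewrite /powR gt_eqF.
apply: (@le_trans _ _ (expR (s * ln S + eta))); first by rewrite ler_expR.
rewrite expRD /eta lnK ?posrE ?addr_gt0// mulrDr mulr1 lerD2l.
have : expR (s * ln S) <= expR be.
  rewrite ler_expR ler_wpM2l ?(ltW s0)//.
  by rewrite -[K]expRK ler_ln ?posrE ?expR_gt0.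
move=> h; apply: (@le_trans _ _ (expR be * (eps * expR (- be)))).
  by rewrite ler_wpM2r// ltW.
by rewrite mulrCA -expRD subrr expR0 mulr1.
Qed.

End ExpHyper.

(** * Zero-free majorants of polynomials *)

Section Majorant.
Variable R : realType.
Local Notation C := R[i].
Implicit Types (f Phi : {poly C}).

Lemma normc_rc (rho t : R) : 0 <= rho -> normc (rc rho t) = rho.
Proof. by move=> r0; rewrite rcE normcM normc_real normc_cis mulr1 ger0_norm. Qed.

Lemma log_approx (b : C) (eps : R) : normc b < 1 -> 0 < eps ->
  exists Phi, forall w, normc w <= 1 ->
    `|normc (1 - b * w) - expR (Re Phi.[w])| <= eps.
Proof.
(* Since |1 - b w| <= 2, both it and its approximation are at most 2 + eps, so a relative error eps
   / (2 + eps) is an absolute error at most eps. *)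
move=> b1 e0; pose de := ln (1 + eps / (2 + eps)).
have q0 : 0 < eps / (2 + eps) by rewrite divr_gt0// addr_gt0.
have de0 : 0 < de by rewrite ln_gt0// ltrDl.
have b01 : 0 <= normc b < 1 by rewrite normc_ge0.
have [|n hn] := @expn_small R (normc b) (de * (1 - normc b)) b01.
  by rewrite mulr_gt0// subr_gt0.
exists (- (lnpolyC R n \Po (b *: 'X))) => w w1.
rewrite hornerN horner_comp hornerZ hornerX ReN.
have bw : normc (b * w) <= normc b by rewrite normcM ler_piMr ?normc_ge0.
have := ln_normc_approx n bw b1.
set T := Re _; set N := normc (1 - _).
have N0 : 0 < N.
  have := ler_dist_normc 1 (1 - b * w); rewrite normc1 opprB addrCA subrr addr0 -/N => h3.
  by have := le_trans (ler_norm _) h3; lra.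
have N2 : N <= 2.
  have := le_normcD 1 (- (b * w)); rewrite normc1 normcN -/N; lra.
move=> h; have {h} : `|ln N + T| <= de.
  by apply: le_trans h _; rewrite ler_pdivrMr ?subr_gt0// hn.
rewrite ler_norml => /andP[h1 h2].
have ede : expR de = 1 + eps / (2 + eps) by rewrite lnK// posrE addr_gt0.
have e1 : N <= expR (- T) * (1 + eps / (2 + eps)).
  by rewrite -[N]lnK ?posrE// -ede -expRD ler_expR; lra.
have e2 : expR (- T) <= N * (1 + eps / (2 + eps)).
  by rewrite -[N]lnK ?posrE// -ede -expRD ler_expR; lra.
have e3 : (2 + eps) * (eps / (2 + eps)) = eps by field; rewrite gt_eqF// addr_gt0.
move: q0 e1 e2 e3; set q := eps / (2 + eps) => q0 e1 e2 e3.
have Nq := ler_wpM2r (ltW q0) N2.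
have eq0 : 0 <= eps * q by rewrite mulr_ge0// ltW.
have e4 : expR (- T) <= 2 + eps by lra.
have := ler_wpM2r (ltW q0) e4; rewrite e3 => e5.
by rewrite ler_norml; apply/andP; split; lra.
Qed.

(** Up to eps, exp (Re Phi) is the modulus of the outer factor of f: above |f| in the closed disc,
    equal to it on the circle. This removes the zeros of f, whose logarithm would be singular. *)
Definition majorant f := forall eps : R, 0 < eps -> exists Phi,
  (forall rho t, 0 <= rho <= 1 -> normc f.[rc rho t] <= expR (Re Phi.[rc rho t]) + eps) /\
  (forall t, expR (Re Phi.[cis t]) <= normc f.[cis t] + eps).

Lemma majorantC (c : C) : majorant c%:P.
Proof.
move=> eps e0; pose d := if c == 0 then eps else normc c.
have d0 : 0 < d.
  rewrite /d; case: eqVneq => // cn; rewrite lt_neqAle normc_ge0 andbT eq_sym.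
  by apply: contra cn => /eqP/eq0_normc->.
exists (ln d)%:C%C%:P; split => [rho t _|t]; rewrite !hornerC /= lnK ?posrE// /d.
  by case: eqVneq => [->|_]; rewrite ?normc0; lra.
by case: eqVneq => [->|_]; rewrite ?normc0; lra.
Qed.

(* If |a| < 1 use 1 - conj a z, larger than z - a inside the disc and of the same modulus on the circle;
   otherwise push a outwards to (1 + eta) a. *)
Lemma majorantXsub (a : C) : majorant ('X - a%:P).
Proof.
move=> eps e0.
have sq_le (z w : C) : normc z ^+ 2 <= normc w ^+ 2 -> normc z <= normc w.
  by rewrite ler_sqr ?nnegrE ?normc_ge0.
have key2 (b w : C) (h : R) : normc (w - (1 + h)%:C%C * b) ^+ 2 - normc (w - b) ^+ 2 =
    (2 * h + h ^+ 2) * normc b ^+ 2 - 2 * h * Re (w * conjc b).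
  by case: b w => b1 b2 [w1 w2]; rewrite !sqr_normc /=; ring.
have [a1|a1] := ltP (normc a) 1.
  have [|Phi hPhi] := @log_approx (conjc a) eps _ e0; first by rewrite normcJ.
  have key (w : C) : normc (1 - conjc a * w) ^+ 2 - normc (w - a) ^+ 2 =
      (1 - normc a ^+ 2) * (1 - normc w ^+ 2).
    by case: a w {a1 hPhi} => a b [c d]; rewrite !sqr_normc /=; ring.
  exists Phi; split => [rho t /andP[r0 r1]|t]; rewrite !hornerE.
    have nw : normc (rc rho t) <= 1 by rewrite normc_rc.
    have := hPhi _ nw; rewrite ler_norml => /andP[_ h].
    apply: (@le_trans _ _ (normc (1 - conjc a * rc rho t))); last by lra.
    apply: sq_le; rewrite -subr_ge0 key normc_rc//.
    by rewrite mulr_ge0// subr_ge0 exprn_ile1// ?normc_ge0// ltW.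
  have nw : normc (cis t) <= 1 by rewrite normc_cis.
  have := hPhi _ nw; rewrite ler_norml => /andP[h _].
  apply: (@le_trans _ _ (normc (1 - conjc a * cis t) + eps)); first by lra.
  rewrite lerD2r; apply: sq_le; rewrite -subr_le0 key normc_cis.
  by rewrite expr1n subrr mulr0.
have a0 : 0 < normc a by apply: lt_le_trans a1.
(* The root then moves by eta |a| = eps / 2. *)
pose eta := eps / (2 * normc a).
have eta0 : 0 < eta by rewrite divr_gt0// mulr_gt0.
pose a' := (1 + eta)%:C%C * a.
have na' : normc a' = (1 + eta) * normc a.
  by rewrite normcM normc_real ger0_norm// addr_ge0// ltW.
have a'1 : 1 < normc a' by rewrite na'; nra.
have a'0 : a' != 0 by apply: contraTneq a'1 => ->; rewrite normc0 -leNgt.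
have na'0 : 0 < normc a' by apply: lt_trans a'1.
have [||Phi hPhi] := @log_approx a'^-1 (eps / (2 * normc a')).
- by rewrite normcV invf_lt1.
- by rewrite divr_gt0// mulr_gt0.
have dist (w : C) : normc w <= 1 ->
    `|normc (w - a') - expR (Re (Phi + (ln (normc a'))%:C%C%:P).[w])| <= eps / 2.
  move=> w1; rewrite hornerD hornerC ReD /= expRD lnK ?posrE//.
  have -> : normc (w - a') = normc a' * normc (1 - a'^-1 * w).
    by rewrite -normcM mulrBr mulr1 mulrA divff// mul1r -normcN opprB.
  rewrite [X in _ - X]mulrC -mulrBr normrM (gtr0_norm na'0).
  have -> : eps / 2 = normc a' * (eps / (2 * normc a')) by field; rewrite gt_eqF.
  by rewrite ler_pM2l// hPhi.
exists (Phi + (ln (normc a'))%:C%C%:P); split => [rho t /andP[r0 r1]|t]; rewrite hornerXsubC.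
  have nw : normc (rc rho t) <= 1 by rewrite normc_rc.
  have := dist _ nw; rewrite ler_norml => /andP[_ h].
  apply: (@le_trans _ _ (normc (rc rho t - a'))); last by lra.
  apply: sq_le; rewrite -subr_ge0.
  have -> : normc (rc rho t - a') ^+ 2 - normc (rc rho t - a) ^+ 2 =
      (2 * eta + eta ^+ 2) * normc a ^+ 2 - 2 * eta * Re (rc rho t * conjc a).
    exact: key2.
  have h1 : Re (rc rho t * conjc a) <= normc a.
    apply: le_trans (ler_norm _) (le_trans (Re_le_normc _) _).
    by rewrite normcM normcJ ler_piMl ?normc_ge0.
  have h2 : normc a <= normc a ^+ 2 by rewrite expr2 ler_peMl ?normc_ge0.
  have h3 := ler_wpM2l (ltW eta0) (le_trans h1 h2).
  have h4 : 0 <= eta ^+ 2 * normc a ^+ 2 by rewrite mulr_ge0 ?sqr_ge0.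
  by lra.
have nw : normc (cis t) <= 1 by rewrite normc_cis.
have := dist _ nw; rewrite ler_norml => /andP[h _].
apply: (@le_trans _ _ (normc (cis t - a') + eps / 2)); first by lra.
have -> : cis t - a' = (cis t - a) - eta%:C%C * a.
  have E1 : (1 + eta)%:C%C = 1 + eta%:C%C :> C.
    by apply/eqP; rewrite eq_complex /= addr0 !eqxx.
  by rewrite /a' E1; ring.
have := le_normcD (cis t - a) (- (eta%:C%C * a)).
rewrite normcN normcM normc_real (gtr0_norm eta0).
have -> : eta * normc a = eps / 2 by rewrite /eta; field; rewrite gt_eqF.
lra.
Qed.

Lemma normc_horner_bound f : exists2 K : R, 0 <= K &
  forall rho t, 0 <= rho <= 1 -> normc f.[rc rho t] <= K.
Proof.
have [[K hK] [L hL]] := unif_lip_horner f.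
have le_ReIm (z : C) : normc z <= `|Re z| + `|Im z|.
  have h : 0 <= `|Re z| + `|Im z| by rewrite addr_ge0.
  rewrite -[leLHS]ger0_norm ?normc_ge0// -[leRHS]ger0_norm//.
  rewrite -ler_sqr ?nnegrE// ?normr_ge0// !real_normK ?num_real// sqr_normc sqrrD.
  rewrite !real_normK ?num_real// -addrA lerD2l lerDr mulrn_wge0// mulr_ge0//.
have h : forall rho t, 0 <= rho <= 1 -> normc f.[rc rho t] <= K + L.
  move=> rho t r01; apply: le_trans (le_ReIm _) _; apply: lerD.
    by have [] := hK rho t 0 r01.
  by have [] := hL rho t 0 r01.
exists (K + L) => //; apply: le_trans (h 0 0 _); first exact: normc_ge0.
by rewrite lexx ler01.
Qed.

Lemma majorantM f (a : C) : majorant f -> majorant (f * ('X - a%:P)).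
Proof.
move=> hf eps e0; have ha := majorantXsub a.
have [K K0 hK] := normc_horner_bound f.
have [L L0 hL] := normc_horner_bound ('X - a%:P).
pose D := K + L + 3.
have D0 : 0 < D by rewrite /D; lra.
pose de := Num.min 1 (eps / D).
have de0 : 0 < de by rewrite lt_min ltr01 divr_gt0.
have de1 : de <= 1 by rewrite ge_min lexx.
have deD : de * D <= eps by rewrite -ler_pdivlMr// ge_min lexx orbT.
have [Phi [P1 P2]] := hf _ de0; have [Psi [Q1 Q2]] := ha _ de0.
have i01 : 0 <= (1 : R) <= 1 by rewrite ler01 lexx.
(* To multiply the two estimates, each exponential must be bounded inside the disc too; the minimum
   principle for - Re T carries the bound over from the circle. *)
have maxp (g T : {poly C}) (B : R) : 0 <= B -> (forall t, expR (Re T.[cis t]) <= normc g.[cis t] + de) ->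
    (forall rho t, 0 <= rho <= 1 -> normc g.[rc rho t] <= B) ->
    forall rho t, 0 <= rho <= 1 -> expR (Re T.[rc rho t]) <= B + de.
  move=> B0 h1 h2 rho t r01.
  have Bd : 0 < B + de by rewrite ltr_wpDl.
  rewrite -[leRHS]lnK ?posrE// ler_expR -lerN2 -ReN -hornerN.
  apply: Re_horner_min r01 => s; rewrite hornerN ReN lerN2.
  rewrite -[Re _]expRK ler_ln ?posrE ?expR_gt0//; apply: le_trans (h1 s) _.
  by rewrite lerD2r -rc1; exact: h2.
have EP := maxp _ _ _ K0 P2 hK; have EQ := maxp _ _ _ L0 Q2 hL.
exists (Phi + Psi); split => [rho t r01|t]; rewrite hornerD hornerM normcM ReD expRD.
  have x0 := normc_ge0 f.[rc rho t]; have y0 := normc_ge0 ('X - a%:P).[rc rho t].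
  apply: le_trans (ler_pM x0 y0 (P1 _ _ r01) (Q1 _ _ r01)) _.
  have := EP rho t r01; have := EQ rho t r01.
  have := expR_gt0 (Re Phi.[rc rho t]); have := expR_gt0 (Re Psi.[rc rho t]).
  set x := expR _; set y := expR _ => px py hx hy.
  by rewrite /D in deD; nra.
apply: le_trans (ler_pM (expR_ge0 _) (expR_ge0 _) (P2 t) (Q2 t)) _.
have := hK 1 t i01; have := hL 1 t i01; rewrite rc1.
have := normc_ge0 f.[cis t]; have := normc_ge0 ('X - a%:P).[cis t].
set x := normc _; set y := normc _ => px py hx hy.
by rewrite /D in deD; nra.
Qed.

Lemma majorant_poly f : majorant f.
Proof.
have [s ->] := closed_field_poly_normal f.
elim/last_ind: s => [|s a IH].
  by rewrite big_nil alg_polyC; exact: majorantC.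
by rewrite -cats1 big_cat big_seq1 /= scalerAl; exact: majorantM.
Qed.

End Majorant.

(** * Convexity of real powers *)

Section PowR.
Variable R : realType.
Implicit Types (x y s K : R).

(** The tangent of y^s at 1, read off Young's inequality with second factor 1. The Lipschitz and
    Jensen inequalities for powers are rescalings of it. *)
Lemma powR_tangent s y : 1 <= s -> 0 <= y -> s * y - (s - 1) <= y `^ s.
Proof.
rewrite le_eqVlt => /orP[/eqP<-|s1] y0; first by rewrite powRr1//; lra.
have s0 : 0 < s by lra.
have c0 : 0 < s / (s - 1) by rewrite divr_gt0// subr_gt0.
have E : s^-1 + (s / (s - 1))^-1 = 1.
  by field; apply/andP; split; lra.
have := conjugate_powR y0 ler01 s0 c0 E.
rewrite powR1 mulr1 invfM mul1r invrK => h.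
have := ler_wpM2l (ltW s0) h.
have -> : s * (y `^ s / s + s^-1 * (s - 1)) = y `^ s + (s - 1) by field; lra.
by lra.
Qed.

Lemma powR_lip s K x y : 1 <= s -> 0 <= x <= K -> 0 <= y <= K ->
  `|x `^ s - y `^ s| <= s * K `^ (s - 1) * `|x - y|.
Proof.
move=> s1; have s0 : 0 <= s by lra.
wlog xy : x y / x <= y => [H hx hy|/andP[x0 xK] /andP[y0 yK]].
  have [/H|/ltW/H] := leP x y; first exact.
  by rewrite distrC [X in _ -> _ -> _ <= _ * X]distrC; apply.
rewrite distrC ger0_norm; last by rewrite subr_ge0 ge0_ler_powR.
rewrite distrC ger0_norm ?subr_ge0//.
move: y0; rewrite le_eqVlt => /orP[/eqP y0|y0].
  have -> : x = y by apply/eqP; rewrite eq_le xy -y0 x0.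
  by rewrite !subrr mulr0.
have yn : y != 0 by rewrite gt_eqF.
have yE : y `^ s = y * y `^ (s - 1).
  by rewrite mulr_powRB1 ?ltW//; lra.
have := @powR_tangent s (x / y) s1 (divr_ge0 x0 (ltW y0)).
rewrite powRM ?invr_ge0 ?(ltW y0)// => h.
have y1 : (y^-1) `^ s = (y `^ s)^-1.
  by rewrite -powR_inv1 ?(ltW y0)// powRAC powR_inv1 ?powR_ge0.
have ys : 0 < y `^ s by rewrite powR_gt0.
have := ler_wpM2l (ltW ys) h; rewrite y1.
have -> : y `^ s * (x `^ s / y `^ s) = x `^ s by field; rewrite gt_eqF.
have -> : y `^ s * (s * (x / y) - (s - 1)) = y `^ s - s * y `^ (s - 1) * (y - x).
  by rewrite yE; field.
move=> h2; apply: (@le_trans _ _ (s * y `^ (s - 1) * (y - x))); first by lra.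
rewrite ler_wpM2r ?subr_ge0// ler_wpM2l// ge0_ler_powR ?subr_ge0 ?nnegrE ?(ltW y0)//.
exact: le_trans (ltW y0) yK.
Qed.

(** Serves to move an additive error from outside an s-th power to the inside. *)
Lemma powR_superadd s x y : 1 <= s -> 0 <= x -> 0 <= y -> x `^ s + y `^ s <= (x + y) `^ s.
Proof.
move=> s1 x0 y0; have s0 : 0 < s by lra.
rewrite -(mulr_powRB1 x0 s0) -(mulr_powRB1 y0 s0) -(mulr_powRB1 (addr_ge0 x0 y0) s0).
have s10 : 0 <= s - 1 by lra.
by rewrite mulrDl; apply: lerD; apply: ler_wpM2l => //; apply: ge0_ler_powR;
  rewrite // ?nnegrE ?addr_ge0 ?lerDl ?lerDr.
Qed.

End PowR.

Section OneVariable.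
Variable R : realType.
Local Notation C := R[i].
Implicit Types (f : {poly C}) (p q s r : R).

(** The fine grid falls into M blocks of M' points, each block within distance 2 pi / M of its
    coarse point. *)
Lemma gavg_refine M M' (F : R -> R) L : (0 < M)%N -> (0 < M')%N ->
  (forall t u, `|F t - F u| <= L * `|t - u|) ->
  `|gavg M F - gavg (M * M') F| <= L * (pi *+ 2) / M%:R.
Proof.
move=> M0 M'0 hL; have L0 : 0 <= L.
  by have := hL 1 0; rewrite subr0 normr1 mulr1; apply: le_trans; exact: normr_ge0.
have Mn : M%:R != 0 :> R by rewrite pnatr_eq0 -lt0n.
have M'n : M'%:R != 0 :> R by rewrite pnatr_eq0 -lt0n.
have E : gavg (M * M') F = M%:R^-1 * \sum_(k < M) (M'%:R^-1 *
    \sum_(l < M') F (gpt R (M * M') (k * M' + l))).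
  rewrite /gavg natrM invfM -mulrA -mulr_sumr; congr (_ * (_ * _)).
  rewrite -(big_mkord xpredT (fun i => F (gpt R (M * M') i))) big_nat_mul big_mkord.
  apply: eq_bigr => k _; rewrite mulSn addnC -{1}[(k * M')%N]add0n big_addn addKn big_mkord.
  by apply: eq_bigr => l _; rewrite addnC.
rewrite E /gavg -mulrBr normrM ger0_norm ?invr_ge0 ?ler0n// mulrC.
apply: ler_wpM2r; first by rewrite invr_ge0 ler0n.
rewrite -sumrB; apply: le_trans (ler_norm_sum _ _ _) _.
apply: (@le_trans _ _ (\sum_(k < M) L * (pi *+ 2) / M%:R)); last first.
  by rewrite sumr_const card_ord -[_ *+ M]mulr_natr divfK.
apply: ler_sum => k _.
have -> : F (gpt R M k) = M'%:R^-1 * \sum_(l < M') F (gpt R M k).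
  by rewrite sumr_const card_ord -[F _ *+ M']mulr_natl mulKf.
rewrite -mulrBr -sumrB normrM ger0_norm ?invr_ge0 ?ler0n// mulrC ler_pdivrMr ?ltr0n//.
apply: le_trans (ler_norm_sum _ _ _) _.
apply: (@le_trans _ _ (\sum_(l < M') L * (pi *+ 2) / M%:R)); last first.
  by rewrite sumr_const card_ord -[_ *+ M']mulr_natr.
apply: ler_sum => l _; apply: le_trans (hL _ _) _; rewrite -mulrA ler_wpM2l//.
rewrite /gpt distrC natrD !natrM.
have -> : (k%:R * M'%:R + l%:R) * (pi *+ 2) / (M%:R * M'%:R) - k%:R * (pi *+ 2) / M%:R =
  (l%:R / M'%:R) * (pi *+ 2 / M%:R) :> R by field; rewrite Mn M'n.
have pp : 0 <= pi *+ 2 / M%:R :> R by rewrite divr_ge0 ?ler0n// mulrn_wge0// pi_ge0.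
rewrite ger0_norm; last by rewrite mulr_ge0// divr_ge0 ?ler0n.
by rewrite ler_piMl// ler_pdivrMr ?ltr0n// mul1r ler_nat ltnW.
Qed.

(** The function exp (p Re Phi), with exp (Re Phi) a majorant of f, stands in for |f|^p: the bound
    inside the disc is used at radius r, on the left, and the bound on the circle on the right. *)
Lemma one_var_hypercontractive f p s r eps : 1 <= p -> 1 <= s -> 0 < r -> r ^+ 2 * s = 1 ->
  0 < eps -> exists m0, forall m, (m0 <= m)%N ->
  gavg m.*2.+1 (fun t => normc f.[rc r t] `^ (p * s)) <=
  gavg m.*2.+1 (fun t => normc f.[cis t] `^ p) `^ s + eps.
Proof.
move=> p1 s1 r0 rs e0; have s0 : 0 < s by lra.
have p0 : 0 < p by lra.
have ps1 : 1 <= p * s by rewrite -[leLHS]mulr1 ler_pM.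
have r01 : 0 <= r <= 1.
  rewrite ltW//=.
  have : r ^+ 2 <= 1 by rewrite -[leRHS]rs ler_peMr// exprn_ge0// ltW.
  by rewrite expr_le1// ltW.
have i01 : 0 <= (1 : R) <= 1 by rewrite ler01 lexx.
have [K K0 hK] := normc_horner_bound f.
(* [D1] and [D2] are Lipschitz constants of the powers p s and p on [0, K + 2]; [D3] is that of the
   power s on [0, B + 1], times [D2]. *)
pose D1 := p * s * (K + 2) `^ (p * s - 1).
pose D2 := p * (K + 2) `^ (p - 1).
pose B := (K + 2) `^ p.
pose D3 := s * (B + 1) `^ (s - 1) * D2.
have B0 : 0 <= B by exact: powR_ge0.
have D10 : 0 <= D1.
  by apply: mulr_ge0; [lra|exact: powR_ge0].
have D20 : 0 <= D2.
  by apply: mulr_ge0; [lra|exact: powR_ge0].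
have D30 : 0 <= D3.
  by apply: mulr_ge0 => //; apply: mulr_ge0; [exact: ltW|exact: powR_ge0].
have DD : 0 < 1 + D1 + D2 + D3 by rewrite !ltr_wpDr.
pose de := Num.min 1 (eps / 2 / (1 + D1 + D2 + D3)).
have de0 : 0 < de by rewrite lt_min ltr01 !divr_gt0.
have de1 : de <= 1 by rewrite ge_min lexx.
have deD : de * (1 + D1 + D2 + D3) <= eps / 2.
  by rewrite -ler_pdivlMr// ge_min lexx orbT.
have [Phi [P1 P2]] := majorant_poly f de0.
have e20 : 0 < eps / 2 by rewrite divr_gt0.
have [m0 hm0] := @exp_hypercontractive R (p%:C%C *: Phi) s r (eps / 2) s1 r0 rs e20.
exists m0 => m /hm0; set M := m.*2.+1; have M0 : (0 < M)%N by [].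
have eE rho t : expR (Re (p%:C%C *: Phi).[rc rho t]) = expR (Re Phi.[rc rho t]) `^ p.
  by rewrite hornerZ ReZ mulrC expRM.
have eE2 rho t : expR (s * Re (p%:C%C *: Phi).[rc rho t]) = expR (Re Phi.[rc rho t]) `^ (p * s).
  by rewrite mulrC expRM eE powRrM.
under eq_gavg do rewrite eE2; under [X in _ <= X `^ s + _ -> _]eq_gavg do rewrite eE rc1.
set X := (X in X <= _ -> _); set Y := (X in _ <= X `^ s + _ -> _) => XY.
set X' := gavg M _; set Y' := gavg M _.
have XX : X' <= X + D1 * de.
  rewrite -[D1 * de](gavg_cst _ M0) -gavgD; apply: ler_gavg => t.
  set x := normc _; set y := expR _.
  have h : x <= y + de := P1 r t r01.
  have x0 : 0 <= x := normc_ge0 _.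
  have xK : x <= K := hK r t r01.
  have y0 : 0 <= y := expR_ge0 _.
  have [xy|yx] := leP x y.
    apply: (@le_trans _ _ (y `^ (p * s))); last by rewrite lerDl mulr_ge0// ltW.
    by apply: ge0_ler_powR; rewrite ?nnegrE//; lra.
  have := @powR_lip _ (p * s) (K + 2) x y ps1; rewrite x0 y0 => /(_ ltac:(lra) ltac:(lra)).
  rewrite -/D1 [X in _ <= _ * X]gtr0_norm ?subr_gt0// => /(le_trans (ler_norm _)) H.
  have h' : x - y <= de by lra.
  by have := ler_wpM2l D10 h'; lra.
have YY : Y <= Y' + D2 * de.
  rewrite -[D2 * de](gavg_cst _ M0) -gavgD; apply: ler_gavg => t.
  set x := normc _; set y := expR _.
  have h : y <= x + de := P2 t.
  have x0 : 0 <= x := normc_ge0 _.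
  have xK : x <= K by rewrite /x -rc1; exact: hK.
  have y0 : 0 <= y := expR_ge0 _.
  have [xy|yx] := leP y x.
    apply: (@le_trans _ _ (x `^ p)); last by rewrite lerDl mulr_ge0// ltW.
    by apply: ge0_ler_powR; rewrite ?nnegrE//; lra.
  have := @powR_lip _ p (K + 2) y x p1; rewrite x0 y0 => /(_ ltac:(lra) ltac:(lra)).
  rewrite -/D2 [X in _ <= _ * X]gtr0_norm ?subr_gt0// => /(le_trans (ler_norm _)) H.
  have h' : y - x <= de by lra.
  by have := ler_wpM2l D20 h'; lra.
have Y0 : 0 <= Y by apply: gavg_ge0 => t; exact: powR_ge0.
have Y'0 : 0 <= Y' by apply: gavg_ge0 => t; exact: powR_ge0.
have YB : Y <= B.
  rewrite -[B](gavg_cst _ M0); apply: ler_gavg => t.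
  rewrite ge0_ler_powR ?nnegrE ?expR_ge0 ?(ltW p0)//; first by lra.
  apply: le_trans (P2 t) _; have := hK 1 t i01; rewrite rc1; lra.
have Ys : Y `^ s <= Y' `^ s + D3 * de.
  have [xy|yx] := leP Y Y'.
    apply: (@le_trans _ _ (Y' `^ s)); last by rewrite lerDl mulr_ge0// ltW.
    by apply: ge0_ler_powR; rewrite ?nnegrE//; lra.
  have := @powR_lip _ s (B + 1) Y Y' s1; rewrite Y0 Y'0 => /(_ ltac:(lra) ltac:(lra)).
  rewrite [X in _ <= _ * X]gtr0_norm ?subr_gt0// => /(le_trans (ler_norm _)) H.
  have c0 : 0 <= s * (B + 1) `^ (s - 1) by rewrite mulr_ge0 ?powR_ge0// ltW.
  rewrite -lerBlDl; apply: le_trans H _; rewrite /D3 -[leRHS]mulrA ler_wpM2l//.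
  by rewrite lerBlDl.
have dD2 : 0 <= de * D2 by rewrite mulr_ge0// ltW.
move: Ys XX XY; clearbody X Y X' Y' D3 D2 D1 => Ys XX XY.
by lra.
Qed.

Lemma normc_subX (w v : C) n : normc w <= 1 -> normc v <= 1 ->
  normc (w ^+ n - v ^+ n) <= n%:R * normc (w - v).
Proof.
move=> w1 v1; elim: n => [|n IH]; first by rewrite !expr0 subrr normc0 mul0r.
rewrite !exprS (_ : _ - _ = w * (w ^+ n - v ^+ n) + (w - v) * v ^+ n); last by ring.
apply: le_trans (le_normcD _ _) _; rewrite -natr1 [leRHS]mulrDl mul1r !normcM normcX.
apply: lerD.
  by apply: le_trans IH; rewrite ler_piMl ?normc_ge0.
by rewrite ler_piMr ?normc_ge0// exprn_ile1// normc_ge0.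
Qed.

Lemma normc_rc_sub (rho t u : R) : 0 <= rho <= 1 ->
  normc (rc rho t - rc rho u) <= 2 * `|t - u|.
Proof.
move=> /andP[r0 r1]; rewrite !rcE -mulrBr normcM normc_real ger0_norm//.
apply: (@le_trans _ _ (normc (cis t - cis u))); first by rewrite ler_piMl ?normc_ge0.
have hc := cos_lip t u; have hs := sin_lip t u.
have -> : cis t - cis u = (cos t - cos u)%:C%C + (sin t - sin u)%:C%C * 'i%C.
  by apply/eqP; rewrite eq_complex !(ReD, ImD, ReN, ImN, ReM, ImM, Re_cis, Im_cis) /=;
    apply/andP; split; apply/eqP; ring.
apply: le_trans (le_normcD _ _) _; rewrite normcM !normc_real.
have -> : normc ('i%C : C) = 1 by rewrite /= expr0n expr1n add0r sqrtr1.
lra.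
Qed.

(* m0 does not depend on f: the Lipschitz bounds are uniform, and [gavg_refine] compares the grid
   with a finer one, depending on f, where [one_var_hypercontractive] applies. *)
Lemma unif_one_var (d : nat) (K p s r eps : R) : 1 <= p -> 1 <= s -> 0 < r ->
  r ^+ 2 * s = 1 -> 0 < eps -> exists m0, forall m, (m0 <= m)%N ->
  forall f, (size f <= d)%N -> (forall i, normc f`_i <= K) ->
  gavg m.*2.+1 (fun t => normc f.[rc r t] `^ (p * s)) <=
  (gavg m.*2.+1 (fun t => normc f.[cis t] `^ p) + eps) `^ s.
Proof.
move=> p1 s1 r0 rs e0; have s0 : 0 < s by lra.
have p0 : 0 < p by lra.
have ps1 : 1 <= p * s by rewrite -[leLHS]mulr1 ler_pM.
have r01 : 0 <= r <= 1.
  rewrite ltW//=.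
  have : r ^+ 2 <= 1 by rewrite -[leRHS]rs ler_peMr// exprn_ge0// ltW.
  by rewrite expr_le1// ltW.
have i01 : 0 <= (1 : R) <= 1 by rewrite ler01 lexx.
pose B := d%:R * K.
pose L q := q * B `^ (q - 1) * (d%:R * d%:R * K * 2).
have lip (f : {poly C}) q rho : 1 <= q -> 0 <= rho <= 1 -> (size f <= d)%N -> (forall i, normc f`_i <= K) ->
    forall t u, `|normc f.[rc rho t] `^ q - normc f.[rc rho u] `^ q| <= L q * `|t - u|.
  move=> q1 rh sf fK t u; have /andP[rh0 rh1] := rh.
  have K0 : 0 <= K by apply: le_trans (fK 0%N); exact: normc_ge0.
  have nB x : 0 <= normc f.[rc rho x] <= B.
    rewrite normc_ge0 /= (horner_coef_wide _ sf); apply: le_trans (normc_sum _ _ _) _.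
    apply: (@le_trans _ _ (\sum_(i < d) K)); last by rewrite sumr_const card_ord /B mulr_natl.
    apply: ler_sum => i _; rewrite normcM normcX normc_rc//.
    by rewrite -[leRHS]mulr1 ler_pM ?normc_ge0 ?exprn_ge0// exprn_ile1.
  apply: le_trans (powR_lip q1 (nB t) (nB u)) _.
  rewrite /L -[leRHS]mulrA; apply: ler_wpM2l.
    by apply: mulr_ge0; [lra|exact: powR_ge0].
  apply: le_trans (ler_dist_normc _ _) _.
  rewrite !(horner_coef_wide _ sf) -sumrB; apply: le_trans (normc_sum _ _ _) _.
  apply: (@le_trans _ _ (\sum_(i < d) K * (d%:R * (2 * `|t - u|)))); last first.
    rewrite sumr_const card_ord -(mulr_natl (K * (d%:R * (2 * `|t - u|)))).
    by rewrite le_eqVlt; apply/orP; left; apply/eqP; ring.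
  apply: ler_sum => i _; rewrite -mulrBr normcM; apply: ler_pM; rewrite ?normc_ge0//.
  apply: (@le_trans _ _ (i%:R * normc (rc rho t - rc rho u))).
    by apply: normc_subX; rewrite normc_rc.
  apply: ler_pM; rewrite ?ler0n ?normc_ge0//; last exact: normc_rc_sub.
  by rewrite ler_nat ltnW.
(* Half of eps is spent on comparing the averages inside the power; the other half absorbs the outer
   errors, by (Y + e)^s + e^s <= (Y + 2 e)^s. *)
pose e := eps / 2.
have e20 : 0 < e by rewrite divr_gt0.
have es0 : 0 < e `^ s by rewrite powR_gt0.
pose eta := Num.min (e / 2) (e `^ s / 4).
have eta0 : 0 < eta by rewrite lt_min !divr_gt0.
have eta1 : eta <= e / 2 by rewrite ge_min lexx.
have eta2 : eta <= e `^ s / 4 by rewrite ge_min lexx orbT.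
pose Lam := Num.max (L (p * s)) (L p) * (pi *+ 2).
have big_M (m : nat) : ((Num.truncn (`|Lam| / eta)).+1 <= m)%N -> Lam / (m.*2.+1)%:R <= eta.
  move=> hm; rewrite ler_pdivrMr ?ltr0n// [leRHS]mulrC -ler_pdivrMr//.
  apply: (@le_trans _ _ (`|Lam| / eta)).
    by rewrite ler_wpM2r ?ler_norm// invr_ge0 ltW.
  apply/ltW/(lt_le_trans (truncnS_gt _)); rewrite ler_nat.
  by apply: leq_trans hm _; rewrite -addnn leqW// leq_addr.
exists (Num.truncn (`|Lam| / eta)).+1 => m hm f sf fK.
have [|m1 hm1] := @one_var_hypercontractive f p s r (e `^ s / 4) p1 s1 r0 rs.
  by rewrite divr_gt0.
pose m2 := maxn m m1.
have close (F : R -> R) q : L q <= Num.max (L (p * s)) (L p) ->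
   (forall t u, `|F t - F u| <= L q * `|t - u|) ->
   `|gavg m.*2.+1 F - gavg m2.*2.+1 F| <= 2 * eta.
  move=> hq hF.
  have H n : (m <= n)%N -> L q * (pi *+ 2) / (n.*2.+1)%:R <= eta.
    move=> mn; apply: le_trans (big_M n (leq_trans hm mn)).
    by rewrite ler_wpM2r ?invr_ge0 ?ler0n// ler_wpM2r// mulrn_wge0// pi_ge0.
  have h1 := @gavg_refine m.*2.+1 m2.*2.+1 F (L q) isT isT hF.
  have h2 := @gavg_refine m2.*2.+1 m.*2.+1 F (L q) isT isT hF.
  rewrite mulnC in h2.
  have H1 := H m (leqnn m); have H2 := H m2 (leq_maxl _ _).
  rewrite -(subrK (gavg (m.*2.+1 * m2.*2.+1) F) (gavg m.*2.+1 F)) -addrA.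
  apply: le_trans (ler_normD _ _) _; rewrite [X in _ + X]distrC.
  rewrite (_ : 2 * eta = eta + eta); last by ring.
  by apply: lerD; [exact: le_trans h1 H1|exact: le_trans h2 H2].
have cX := close _ (p * s) _ (lip f (p * s) r ps1 r01 sf fK).
have cY := close _ p _ (lip f p 1 p1 i01 sf fK).
move: cX cY; rewrite !le_max !lexx orbT /= => /(_ isT) + /(_ isT).
rewrite (@eq_gavg _ _ (fun t => normc f.[rc 1 t] `^ p) (fun t => normc f.[cis t] `^ p)); last first.
  by move=> t; rewrite rc1.
rewrite (@eq_gavg _ m2.*2.+1 (fun t => normc f.[rc 1 t] `^ p) (fun t => normc f.[cis t] `^ p)); last first.
  by move=> t; rewrite rc1.
have := hm1 m2 (leq_maxr _ _).
set X := gavg m.*2.+1 _; set X2 := gavg m2.*2.+1 _.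
set Y := gavg m.*2.+1 _; set Y2 := gavg m2.*2.+1 _ => XY.
rewrite !ler_norml => /andP[_ hX] /andP[hY _].
have Y0 : 0 <= Y by apply: gavg_ge0 => t; exact: powR_ge0.
have Y20 : 0 <= Y2 by apply: gavg_ge0 => t; exact: powR_ge0.
have : Y2 `^ s <= (Y + e) `^ s.
  by rewrite ge0_ler_powR ?nnegrE ?addr_ge0 ?(ltW s0) ?(ltW e20)//; lra.
have := @powR_superadd _ s (Y + e) e s1 (addr_ge0 Y0 (ltW e20)) (ltW e20).
have -> : Y + e + e = Y + eps by rewrite /e; field.
lra.
Qed.

End OneVariable.

(** * Several variables *)

Section Tensor.
Variable R : realType.
Local Notation C := R[i].
Implicit Types (z w : nat -> C) (F G : (nat -> C) -> R).

Definition upd z (j : nat) (x : C) : nat -> C := fun i => if i == j then x else z i.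

Lemma updC z i j x y : i != j -> upd (upd z i x) j y = upd (upd z j y) i x.
Proof.
move=> ij; apply/funext => k; rewrite /upd; case: eqVneq => // ->.
by rewrite eq_sym (negbTE ij).
Qed.

(** Points are infinite sequences, so one type serves all dimensions. The coordinates from n on keep
    their value in z, which is how inductions on n freeze variables. *)
Fixpoint tavg (M n : nat) F z : R :=
  if n is n'.+1 then gavg M (fun t => tavg M n' F (upd z n' (cis t))) else F z.

Lemma eq_tavg M n F G z : F =1 G -> tavg M n F z = tavg M n G z.
Proof. by move=> h; congr (tavg M n _ z); apply/funext. Qed.

Lemma tavg_upd M n F z j x : (n <= j)%N ->
  tavg M n F (upd z j x) = tavg M n (fun w => F (upd w j x)) z.
Proof.
elim: n z => [//|n IH] z nj /=; apply: eq_gavg => t.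
by rewrite updC ?IH ?(ltnW nj)// eq_sym ltn_eqF.
Qed.

Lemma tavgD M n F G z : tavg M n (fun w => F w + G w) z = tavg M n F z + tavg M n G z.
Proof.
elim: n z => [//|n IH] z /=; rewrite -gavgD; apply: eq_gavg => t; exact: IH.
Qed.

Lemma tavgZ M n c F z : tavg M n (fun w => c * F w) z = c * tavg M n F z.
Proof.
elim: n z => [//|n IH] z /=; rewrite -gavgZ; apply: eq_gavg => t; exact: IH.
Qed.

Lemma tavg_cst M n c z : (0 < M)%N -> tavg M n (fun=> c) z = c.
Proof.
move=> M0; elim: n z => [//|n IH] z /=; rewrite (@eq_gavg _ _ _ (fun=> c)) ?gavg_cst//.
Qed.

Lemma tavg_sum M n I (r : seq I) (F : I -> (nat -> C) -> R) z :
  tavg M n (fun w => \sum_(i <- r) F i w) z = \sum_(i <- r) tavg M n (F i) z.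
Proof.
elim: n z => [//|n IH] z /=; rewrite -gavg_sum; apply: eq_gavg => t; exact: IH.
Qed.

Lemma tavg_gavg M n F z j : (n <= j)%N ->
  gavg M (fun t => tavg M n F (upd z j (cis t))) =
  tavg M n (fun w => gavg M (fun t => F (upd w j (cis t)))) z.
Proof.
move=> nj; rewrite /gavg tavgZ tavg_sum; congr (_ * _); apply: eq_bigr => k _.
exact: tavg_upd.
Qed.

Definition in_disc z := forall j, normc (z j) <= 1.

Lemma in_disc_upd z j t : in_disc z -> in_disc (upd z j (cis t)).
Proof. by move=> h i; rewrite /upd; case: eqP => // _; rewrite normc_cis. Qed.

Lemma ler_tavg_in M n F G z : in_disc z -> (forall w, in_disc w -> F w <= G w) ->
  tavg M n F z <= tavg M n G z.
Proof.
move=> + h; elim: n z => [|n IH] z hz /=; first exact: h.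
by apply: ler_gavg => t; apply: IH; exact: in_disc_upd.
Qed.

Lemma ler_tavg M n F G z : (forall w, F w <= G w) -> tavg M n F z <= tavg M n G z.
Proof.
by move=> h; elim: n z => [|n IH] z //=; apply: ler_gavg => t; exact: IH.
Qed.

Lemma tavg_ge0 M n F z : (forall w, 0 <= F w) -> 0 <= tavg M n F z.
Proof.
by move=> h; elim: n z => [|n IH] z //=; apply: gavg_ge0 => t; exact: IH.
Qed.

(** Weighted sum of the tangent inequality at the mean m. *)
Lemma jensen_powR I (r : seq I) (lam x : I -> R) s : 1 <= s ->
  (forall i, 0 <= lam i) -> (forall i, 0 <= x i) -> \sum_(i <- r) lam i = 1 ->
  (\sum_(i <- r) lam i * x i) `^ s <= \sum_(i <- r) lam i * x i `^ s.
Proof.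
move=> s1 l0 x0 l1; set m := \sum_(i <- r) lam i * x i.
have m0 : 0 <= m by apply: sumr_ge0 => i _; rewrite mulr_ge0.
have s0 : s != 0 by rewrite gt_eqF//; lra.
move: m0; rewrite le_eqVlt => /orP[/eqP<-|m0].
  by rewrite powR0// sumr_ge0// => i _; rewrite mulr_ge0// powR_ge0.
have ms : 0 < m `^ s by rewrite powR_gt0.
apply: (@le_trans _ _ (\sum_(i <- r) lam i * (m `^ s * (s * (x i / m) - (s - 1))))).
  have -> : \sum_(i <- r) lam i * (m `^ s * (s * (x i / m) - (s - 1))) =
    m `^ s * s / m * (\sum_(i <- r) lam i * x i) - m `^ s * (s - 1) * \sum_(i <- r) lam i.
    rewrite !mulr_sumr -sumrB; apply: eq_bigr => i _.
    by field; rewrite gt_eqF.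
  by rewrite l1 -/m le_eqVlt; apply/orP; left; apply/eqP; field; rewrite gt_eqF.
apply: ler_sum => i _; rewrite ler_wpM2l//.
have := powR_tangent s1 (divr_ge0 (x0 i) (ltW m0)).
rewrite powRM ?invr_ge0 ?(ltW m0)//.
have -> : (m^-1) `^ s = (m `^ s)^-1.
  by rewrite -powR_inv1 ?(ltW m0)// powRAC powR_inv1 ?powR_ge0.
move=> hh; apply: le_trans (ler_wpM2l (ltW ms) hh) _.
by rewrite mulrCA divff ?mulr1// gt_eqF.
Qed.

(** Minkowski's inequality in L^s, with c i bounding the norm of h i: after division by c i all
    norms are at most 1, and Jensen's inequality applies with the weights wt i * c i / T. *)
Lemma minkowski_tavg M n z k (wt c : 'I_k -> R) (h : 'I_k -> (nat -> C) -> R) s :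
  1 <= s -> (forall i, 0 <= wt i) -> (forall i, 0 < c i) -> 0 < \sum_i wt i * c i ->
  (forall i w, 0 <= h i w) ->
  (forall i, tavg M n (fun w => h i w `^ s) z <= c i `^ s) ->
  tavg M n (fun w => (\sum_i wt i * h i w) `^ s) z <= (\sum_i wt i * c i) `^ s.
Proof.
move=> s1 w0 c0 T0 h0 hc; set T := \sum_i _ in T0 *.
have Ts : 0 < T `^ s by rewrite powR_gt0.
apply: (@le_trans _ _ (tavg M n (fun w => T `^ s *
    \sum_i wt i * c i / T * (c i `^ (- s) * h i w `^ s)) z)).
  apply: ler_tavg => w.
  have -> : \sum_i wt i * h i w = T * \sum_i (wt i * c i / T) * (h i w / c i).
    by rewrite mulr_sumr; apply: eq_bigr => i _; field; rewrite !gt_eqF.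
  rewrite powRM ?(ltW T0)//; last first.
    by apply: sumr_ge0 => i _; rewrite !mulr_ge0 ?invr_ge0 ?(ltW T0) ?(ltW (c0 i)).
  rewrite ler_pM2l//.
  apply: le_trans (jensen_powR s1 _ _ _) _.
  - by move=> i; rewrite !mulr_ge0 ?invr_ge0 ?(ltW T0) ?(ltW (c0 i)).
  - by move=> i; rewrite !mulr_ge0 ?invr_ge0 ?(ltW (c0 i)).
  - by rewrite -mulr_suml divff// gt_eqF.
  apply: ler_sum => i _; rewrite ler_wpM2l//.
    by rewrite !mulr_ge0 ?invr_ge0 ?(ltW T0) ?(ltW (c0 i)).
  rewrite powRM ?invr_ge0 ?(ltW (c0 i))// mulrC powRN -powR_inv1 ?(ltW (c0 i))//.
  by rewrite powRAC powR_inv1 ?powR_ge0.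
rewrite tavgZ -[leRHS]mulr1 ler_pM2l// tavg_sum.
have -> : 1 = \sum_i wt i * c i / T by rewrite -mulr_suml divff// gt_eqF.
apply: ler_sum => i _; rewrite tavgZ -[leRHS]mulr1 ler_wpM2l//.
  by rewrite !mulr_ge0 ?invr_ge0 ?(ltW T0) ?(ltW (c0 i)).
by rewrite tavgZ powRN mulrC ler_pdivrMr ?powR_gt0// mul1r.
Qed.

Section Peval.
Variables (N : nat) (I : finType) (a : I -> C) (e : I -> nat -> nat).

Definition peval z : C := \sum_i a i * \prod_(j < N) z j ^+ e i j.

(** The bounds on degree and coefficients are common to all slices, as [unif_one_var] requires for
    its threshold. *)
Lemma peval_slice n : (n < N)%N -> exists d K, forall w, in_disc w ->
  exists f : {poly C}, [/\ (size f <= d)%N, (forall i, normc f`_i <= K) &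
    forall x, peval (upd w n x) = f.[x]].
Proof.
move=> nN; exists (\max_i e i n).+1, (\sum_i normc (a i)) => w hw.
pose b i := a i * \prod_(j < N | j != Ordinal nN) w j ^+ e i j.
have nb i : normc (b i) <= normc (a i).
  rewrite normcM ler_piMr ?normc_ge0// normc_prod prodr_ile1// => j _.
  by rewrite normc_ge0 normcX exprn_ile1// normc_ge0.
exists (\sum_i b i *: 'X^(e i n)); split.
- apply: (leq_trans (size_sum _ _ _)); apply/bigmax_leqP => i _.
  apply: (leq_trans (size_scale_leq _ _)); rewrite size_polyXn ltnS.
  exact: (leq_bigmax i).
- move=> k; rewrite coef_sum; apply: le_trans (normc_sum _ _ _) _.
  apply: ler_sum => i _; rewrite coefZ coefXn; case: eqP => _; rewrite ?mulr1//.
  by rewrite mulr0 normc0 normc_ge0.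
- move=> x; rewrite horner_sum; apply: eq_bigr => i _.
  rewrite hornerZ hornerXn /b (bigD1 (Ordinal nN))//= /upd eqxx mulrCA mulrC.
  congr (_ * _ * _); apply: eq_bigr => j jn.
  by case: eqP => // E; move: jn; rewrite -val_eqE /= E eqxx.
Qed.

Definition dil (r : R) n z : nat -> C := fun j => if (j < n)%N then r%:C%C * z j else z j.

Lemma dil_disc r n z : 0 <= r <= 1 -> in_disc z -> in_disc (dil r n z).
Proof.
move=> /andP[r0 r1] h j; rewrite /dil; case: ifP => // _.
by rewrite normcM normc_real ger0_norm// mulr_ile1// normc_ge0.
Qed.

(** Induction on the number of dilated variables. The last one is treated by [unif_one_var] with the
    others fixed; this leaves an L^s norm, in the other variables, of an average over the last.
    Minkowski's inequality moves the norm inside, where the induction hypothesis applies to each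
    slice. *)
Lemma tensor_hypercontractive (p s r : R) n : 1 <= p -> 1 <= s -> 0 < r ->
  r ^+ 2 * s = 1 -> (n <= N)%N -> forall eps, 0 < eps ->
  exists m0, forall m, (m0 <= m)%N -> forall z, in_disc z ->
  tavg m.*2.+1 n (fun w => normc (peval (dil r n w)) `^ (p * s)) z <=
  (tavg m.*2.+1 n (fun w => normc (peval w) `^ p) z + eps) `^ s.
Proof.
move=> p1 s1 r0 rs; have s0 : 0 < s by lra.
have p0 : 0 < p by lra.
have r01 : 0 <= r <= 1.
  rewrite ltW//=.
  have : r ^+ 2 <= 1 by rewrite -[leRHS]rs ler_peMr// exprn_ge0// ltW.
  by rewrite expr_le1// ltW.
elim: n => [|n IH] nN eps e0.
  exists 0%N => m _ z hz /=.
  have -> : dil r 0 z = z by apply/funext.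
  rewrite powRrM; apply: ge0_ler_powR; rewrite ?nnegrE ?addr_ge0 ?powR_ge0 ?ltW//.
  by rewrite ltrDl.
have e20 : 0 < eps / 2 by rewrite divr_gt0.
have [m1 hm1] := IH (ltnW nN) _ e20.
have [d [K hf]] := peval_slice nN.
have [m2 hm2] := @unif_one_var R d K p s r (eps / 2) p1 s1 r0 rs e20.
exists (maxn m1 m2) => m; rewrite geq_max => /andP[mm1 mm2] z hz.
set M := m.*2.+1; have M0 : (0 < M)%N by [].
have MR : 0 < M%:R :> R by rewrite ltr0n.
rewrite /= tavg_gavg//.
pose h t w := normc (peval (dil r n (upd w n (cis t)))) `^ p.
pose c t := tavg M n (fun w => normc (peval w) `^ p) (upd z n (cis t)) + eps / 2.
have h0 t w : 0 <= h t w by exact: powR_ge0.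
have c0 t : 0 < c t by rewrite ltr_wpDl// tavg_ge0// => w; exact: powR_ge0.
apply: (@le_trans _ _ (tavg M n (fun w => (gavg M (fun t => h t w) + eps / 2) `^ s) z)).
  apply: ler_tavg_in => // w hw.
  have [f [sf fK fE]] := hf _ (dil_disc n r01 hw).
  have E1 x : dil r n (upd w n x) = upd (dil r n w) n x.
    by apply/funext => j; rewrite /dil /upd; case: (eqVneq j n) => [->|_]; rewrite ?ltnn.
  have E2 x : dil r n.+1 (upd w n x) = upd (dil r n w) n (r%:C%C * x).
    apply/funext => j; rewrite /dil /upd; case: (eqVneq j n) => [->|jn]; rewrite ?ltnSn//.
    by rewrite ltnS leq_eqVlt (negbTE jn).
  rewrite (@eq_gavg _ _ _ (fun t => normc f.[rc r t] `^ (p * s))); last first.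
    by move=> t; rewrite E2 fE rcE.
  rewrite /h (@eq_gavg _ _ (fun t => normc (peval (dil r n (upd w n (cis t)))) `^ p)
    (fun t => normc f.[cis t] `^ p)); last by move=> t; rewrite E1 fE.
  exact: hm2.
(* The error eps / 2 enters Minkowski's inequality as one more function, a constant of weight 1, at
   index M. *)
pose wt (i : 'I_M.+1) : R := if (i < M)%N then M%:R^-1 else 1.
pose h' (i : 'I_M.+1) w := if (i < M)%N then h (gpt R M i) w else eps / 2.
pose c' (i : 'I_M.+1) := if (i < M)%N then c (gpt R M i) else eps / 2.
have sumE (F : R -> R) : gavg M F + eps / 2 =
    \sum_i wt i * (if (i < M)%N then F (gpt R M i) else eps / 2).
  rewrite big_ord_recr /= /wt ltnn mul1r; congr (_ + _).
  by rewrite /gavg mulr_sumr; apply: eq_bigr => i _; rewrite ltn_ord.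
have cE : \sum_i wt i * c' i = tavg M n.+1 (fun w => normc (peval w) `^ p) z + eps.
  by rewrite -(sumE c) /c gavgD gavg_cst//= -addrA; congr (_ + _); field.
rewrite (@eq_tavg _ _ _ (fun w => (\sum_i wt i * h' i w) `^ s)); last first.
  by move=> w; rewrite (sumE (h^~ w)).
rewrite -[X in X + eps]/(tavg M n.+1 (fun w => normc (peval w) `^ p) z) -cE.
apply: minkowski_tavg => //.
- by move=> i; rewrite /wt; case: ifP => _; rewrite ?invr_ge0 ?ler0n.
- by move=> i; rewrite /c'; case: ifP.
- by rewrite cE ltr_wpDl// tavg_ge0// => w; exact: powR_ge0.
- by move=> i w; rewrite /h'; case: ifP => _ //; exact: ltW.
move=> i; rewrite /h' /c'; case: ifP => iM; last by rewrite tavg_cst.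
rewrite /c; apply: le_trans (hm1 m mm1 _ (in_disc_upd _ _ hz)).
rewrite tavg_upd//; apply: ler_tavg => w; rewrite /h powRrM; exact: lexx.
Qed.

End Peval.
End Tensor.

(** * Bohr's correspondence *)

Section TimeAverage.
Variable R : realType.
Implicit Types (g h : R -> R) (T : R).

Definition tmean T g : R := (2 * T)^-1 * \int[@lebesgue_measure R]_(t in `[- T, T]) g t.

Lemma integrable_itv T g : continuous g ->
  (@lebesgue_measure R).-integrable `[- T, T] (EFin \o g).
Proof.
move=> cg; apply: continuous_compact_integrable; first exact: segment_compact.
exact: continuous_subspaceT.
Qed.

Lemma tmeanD T g h : continuous g -> continuous h ->
  tmean T (fun t => g t + h t) = tmean T g + tmean T h.
Proof.
by move=> cg ch; rewrite /tmean RintegralD ?mulrDr//; exact: integrable_itv.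
Qed.

Lemma tmean_cst T c : 0 < T -> tmean T (fun=> c) = c.
Proof.
move=> T0; rewrite /tmean Rintegral_cst//.
have -> : fine (@lebesgue_measure R `[- T, T]%classic) = 2 * T.
  have := @lebesgue_measure_itv R `[- T, T]%R => /= ->.
  by rewrite lte_fin gtrN// opprK /=; ring.
by field; rewrite gt_eqF.
Qed.

Lemma ler_tmean T g h : 0 < T -> continuous g -> continuous h ->
  (forall t, g t <= h t) -> tmean T g <= tmean T h.
Proof.
move=> T0 cg ch gh; rewrite /tmean ler_wpM2l//.
  by rewrite invr_ge0 mulr_ge0// ltW.
by apply: le_Rintegral => //; exact: integrable_itv.
Qed.

Lemma ler_tmean_dist T g h e : 0 < T -> continuous g -> continuous h ->
  (forall t, `|g t - h t| <= e) -> `|tmean T g - tmean T h| <= e.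
Proof.
move=> T0 cg ch gh.
have cc : continuous (fun _ : R => e) by move=> x; exact: cvg_cst.
have h1 : tmean T g <= tmean T (fun t => h t + e).
  apply: ler_tmean => //; first by move=> x; apply: cvgD; [exact: ch|exact: cvg_cst].
  by move=> t; have := gh t; rewrite ler_norml => /andP[_]; rewrite lerBlDl addrC.
have h2 : tmean T h <= tmean T (fun t => g t + e).
  apply: ler_tmean => //; first by move=> x; apply: cvgD; [exact: cg|exact: cvg_cst].
  by move=> t; have := gh t; rewrite distrC ler_norml => /andP[_]; rewrite lerBlDl addrC.
move: h1 h2; rewrite !tmeanD// tmean_cst// => h1 h2.
by rewrite ler_norml; apply/andP; split; lra.
Qed.

Lemma tmean_deriv T (F f : R -> R) : 0 < T -> continuous f -> (forall t, dv F t (f t)) ->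
  tmean T f = (2 * T)^-1 * (F T - F (- T)).
Proof.
move=> T0 cf dF; rewrite /tmean; congr (_ * _).
have NT : - T < T by rewrite gtrN.
have dr x : derivable F x 1 by case: (dF x).
have cF : continuous F.
  by move=> x; apply: differentiable_continuous; exact/derivable1_diffP.
rewrite /Rintegral (@continuous_FTC2 _ f F)//.
- exact: continuous_subspaceT.
- split=> [x _||]; first exact: dr.
    exact/cvg_at_right_filter/cF.
  exact/cvg_at_left_filter/cF.
- by move=> x _; rewrite derive1E; case: (dF x).
Qed.

Lemma dv_continuous (F f : R -> R) : (forall t, dv F t (f t)) -> continuous F.
Proof.
move=> dF x; apply: differentiable_continuous; apply/derivable1_diffP.
by case: (dF x).
Qed.

Local Notation C := R[i].

Lemma Re_cis_wave (c : C) (om t : R) : Re (c * cis (- t * om)) = Re c * cos (t * om) + Im c * sin (t * om).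
Proof. by rewrite ReM Re_cis Im_cis mulNr cosN sinN mulrN opprK. Qed.

Lemma continuous_wave (c : C) (om : R) : continuous (fun t : R => Re (c * cis (- t * om))).
Proof.
rewrite (_ : (fun t => _) = (fun t => Re c * cos (t * om) + Im c * sin (t * om))); last first.
  by apply/funext => t; exact: Re_cis_wave.
apply: dv_continuous => t; apply: dvD; (apply: dvM; first exact: dv_cst).
  by apply: (@dv_comp _ cos); [exact: is_derive_cos|apply: dvM; [exact: dv_id|exact: dv_cst]].
by apply: (@dv_comp _ sin); [exact: is_derive_sin|apply: dvM; [exact: dv_id|exact: dv_cst]].
Qed.

(** A nonzero frequency has a bounded primitive F, so its mean over [-T, T] is O(1/T). *)
Lemma tmean_wave (c : C) (om : R) : om != 0 ->
  (fun T => tmean T (fun t : R => Re (c * cis (- t * om)))) @ +oo --> 0.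
Proof.
move=> om0; pose F t := (Re c * sin (t * om) - Im c * cos (t * om)) / om.
have dF t : dv F t (Re (c * cis (- t * om))).
  apply: dv_eq.
    apply: dvM; last exact: dv_cst.
    apply: dvB; (apply: dvM; first exact: dv_cst).
      by apply: (@dv_comp _ sin); [exact: is_derive_sin|apply: dvM; [exact: dv_id|exact: dv_cst]].
    by apply: (@dv_comp _ cos); [exact: is_derive_cos|apply: dvM; [exact: dv_id|exact: dv_cst]].
  by rewrite Re_cis_wave /=; field.
pose K := (`|Re c| + `|Im c|) / `|om|.
have FK t : `|F t| <= K.
  rewrite /F normrM normfV /K ler_wpM2r ?invr_ge0//.
  apply: le_trans (ler_normB _ _) _; rewrite !normrM; apply: lerD.
    by rewrite ler_piMr// sin_max.
  by rewrite ler_piMr// cos_max.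
apply/cvgrPdist_le => e e0; near=> T.
have T0 : 0 < T by near: T; exact: nbhs_pinfty_gt.
have TK : K / e <= T by near: T; apply: nbhs_pinfty_ge; rewrite num_real.
rewrite (tmean_deriv T0 (@continuous_wave c om) dF) sub0r normrN normrM.
have i0 : 0 < (2 * T)^-1 by rewrite invr_gt0 mulr_gt0.
rewrite (gtr0_norm i0).
apply: (@le_trans _ _ ((2 * T)^-1 * (K + K))).
  rewrite ler_pM2l//.
  by apply: le_trans (ler_normB _ _) _; rewrite lerD.
rewrite ler_pdivrMl ?mulr_gt0//; rewrite ler_pdivrMr// in TK.
lra.
Unshelve. all: by end_near. Qed.

End TimeAverage.

Section NormPowApprox.
Variable R : realType.

(** For a trigonometric polynomial h, |h|^2 is again one, while |h|^p is not in general. Here y^p is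
    approached by (y^2 + de^2)^(p/2) = exp (p/2 ln (y^2 + de^2)), where de keeps the logarithm away
    from 0; exp and ln are then replaced by polynomials. *)
Lemma norm_pow_approx (K p eps : R) : 0 <= K -> 1 <= p -> 0 < eps ->
  exists Q : {poly R}, forall y, 0 <= y <= K -> `|Q.[y ^+ 2] - y `^ p| <= eps.
Proof.
move=> K0 p1 e0; have p0 : 0 < p by lra.
pose D := p * (K + 1) `^ (p - 1).
have D0 : 0 <= D by apply: mulr_ge0; [lra|exact: powR_ge0].
pose de := Num.min 1 (eps / 3 / (D + 1)).
have D1 : 0 < D + 1 by lra.
have de0 : 0 < de by rewrite lt_min ltr01 !divr_gt0.
have de1 : de <= 1 by rewrite ge_min lexx.
have deD : de * (D + 1) <= eps / 3 by rewrite -ler_pdivlMr// ge_min lexx orbT.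
pose lo := de ^+ 2; pose hi := K ^+ 2 + de ^+ 2.
have lo0 : 0 < lo by rewrite exprn_gt0.
have lohi : lo <= hi by rewrite lerDr sqr_ge0.
pose be := p / 2 * (`|ln lo| + `|ln hi|) + 1.
have be0 : 0 <= be by rewrite /be addr_ge0// mulr_ge0 ?addr_ge0// divr_ge0// ltW.
pose e1 := Num.min (p / 2)^-1 (eps / 3 / (p / 2 * expR be)).
have p20 : 0 < p / 2 by rewrite divr_gt0.
have pe0 : 0 < p / 2 * expR be by rewrite mulr_gt0// expR_gt0.
have e10 : 0 < e1 by rewrite lt_min invr_gt0 p20 !divr_gt0.
have e1a : p / 2 * e1 <= 1.
  by rewrite -ler_pdivlMl// mulr1 ge_min lexx.
have e1b : p / 2 * expR be * e1 <= eps / 3.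
  by rewrite mulrC -ler_pdivlMr// ge_min lexx orbT.
have [Q2 hQ2] := ln_poly_approx lo0 lohi e10.
have e30 : 0 < eps / 3 by rewrite divr_gt0.
have [Q1 hQ1] := exp_poly_approx be0 e30.
exists (Q1 \Po ((p / 2) *: (Q2 \Po ('X + lo%:P)))) => y /andP[y0 yK].
rewrite horner_comp hornerZ horner_comp !hornerE.
set x := y ^+ 2 + lo.
have xlo : lo <= x by rewrite lerDr sqr_ge0.
have xhi : x <= hi by rewrite /x /hi lerD2r ler_sqr ?nnegrE.
have x0 : 0 < x by apply: lt_le_trans xlo.
have hi0 : 0 < hi by apply: lt_le_trans lohi.
have := hQ2 x; rewrite xlo xhi => /(_ isT) h2.
set u := p / 2 * Q2.[x]; pose v := p / 2 * ln x.
have uv : `|u - v| <= p / 2 * e1 by rewrite -mulrBr normrM gtr0_norm// ler_pM2l.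
have lx : `|ln x| <= `|ln lo| + `|ln hi|.
  have l1 : ln lo <= ln x by rewrite ler_ln.
  have l2 : ln x <= ln hi by rewrite ler_ln.
  have := ler_norm (- ln lo); rewrite normrN => l3; have l4 := ler_norm (ln hi).
  have l5 := normr_ge0 (ln lo); have l6 := normr_ge0 (ln hi).
  by rewrite ler_norml; apply/andP; split; lra.
have vb : `|v| <= be - 1.
  rewrite /v normrM gtr0_norm// /be addrK ler_pM2l//.
have ub : `|u| <= be.
  have := ler_normD (u - v) v; rewrite subrK; lra.
have q1 := hQ1 u ub.
have ev : `|expR u - expR v| <= expR be * `|u - v|.
  have lip a b : b <= a -> a <= be -> `|expR a - expR b| <= expR be * `|a - b|.
    move=> ab ha.
    have [c /andP[_ ca] ->] := mvt_seg ab (fun x _ => is_derive_expR x).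
    rewrite normrM ger0_norm ?expR_ge0// ler_wpM2r// ler_expR.
    exact: le_trans ca ha.
  have vbe : v <= be by apply: le_trans (ler_norm _) _; lra.
  have ube : u <= be by apply: le_trans (ler_norm _) _.
  have [uv'|/ltW vu] := leP v u; first exact: lip.
  by rewrite distrC [X in _ * X]distrC; exact: lip.
have ev2 : `|expR u - expR v| <= eps / 3.
  apply: le_trans ev _; apply: le_trans e1b; rewrite mulrAC mulrC.
  by rewrite ler_pM2r ?expR_gt0.
have evE : expR v = x `^ (p / 2) by rewrite /powR gt_eqF.
have sqp (b : R) : 0 <= b -> (b ^+ 2) `^ (p / 2) = b `^ p.
  by move=> b0; rewrite -powR_mulrn// -powRrM; congr (_ `^ _); field.
have h3 : y `^ p <= x `^ (p / 2).
  rewrite -sqp// ge0_ler_powR ?nnegrE ?sqr_ge0 ?(ltW p20) ?(ltW x0)//.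
  by rewrite lerDl ltW.
have h4 : x `^ (p / 2) <= (y + de) `^ p.
  rewrite -sqp ?addr_ge0 ?(ltW de0)// ge0_ler_powR ?nnegrE ?sqr_ge0 ?(ltW p20) ?(ltW x0)//.
  by rewrite /x /lo sqrrD lerD2r lerDl mulrn_wge0// mulr_ge0// ltW.
have h5 : `|(y + de) `^ p - y `^ p| <= D * de.
  have := @powR_lip _ p (K + 1) (y + de) y p1; rewrite y0 addr_ge0 ?(ltW de0)//=.
  have -> : y + de <= K + 1 by lra.
  have -> : y <= K + 1 by lra.
  move=> /(_ isT isT); rewrite (_ : y + de - y = de); last by ring.
  by rewrite (gtr0_norm de0).
have h6 := le_trans (ler_norm _) h5.
have h7 : D * de <= eps / 3 by apply: le_trans deD; rewrite mulrC ler_wpM2l ?(ltW de0)//; lra.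
move: q1 ev2; rewrite evE !ler_norml => /andP[a1 a2] /andP[b1 b2].
by clear -h3 h4 h6 h7 a1 a2 b1 b2; apply/andP; split; lra.
Qed.

End NormPowApprox.

Section Bohr.
Variable R : realType.
Local Notation C := R[i].
Implicit Types (z w : nat -> C) (h : (nat -> C) -> C).
Variable N : nat.

Definition smooth n := (0 < n)%N /\ forall p, (N <= p)%N -> logn p n = 0%N.

Lemma smoothM n m : smooth n -> smooth m -> smooth (n * m).
Proof.
move=> [n0 hn] [m0 hm]; split; first by rewrite muln_gt0 n0.
by move=> p Np; rewrite lognM// hn// hm.
Qed.

Lemma smooth_lt n : (0 < n)%N -> (n < N)%N -> smooth n.
Proof.
move=> n0 nN; split=> // p Np; apply/eqP; rewrite -leqn0 leqNgt logn_gt0.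
rewrite mem_primes n0 /=; apply/negP => /andP[_ /(dvdn_leq n0)].
by rewrite leqNgt (leq_trans nN Np).
Qed.

(* The variable z_j stands for the prime j itself; logn j n = 0 when j is not prime. *)
Definition chi z n : C := \prod_(j < N) z j ^+ logn j n.

Lemma chi1 z : chi z 1 = 1.
Proof. by rewrite /chi big1// => j _; rewrite logn1. Qed.

Lemma chiM z n m : (0 < n)%N -> (0 < m)%N -> chi z (n * m) = chi z n * chi z m.
Proof.
move=> n0 m0; rewrite /chi -big_split; apply: eq_bigr => j _.
by rewrite lognM// exprD.
Qed.

Lemma normc_chi z n : in_disc z -> normc (chi z n) <= 1.
Proof.
move=> hz; rewrite normc_prod prodr_ile1// => j _.
by rewrite normc_ge0 normcX exprn_ile1// normc_ge0.
Qed.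

(** The imaginary axis in Bohr's coordinates: z_p = p^(-it). *)
Definition vline (t : R) : nat -> C := fun j => cis (- t * ln j%:R).

Lemma vline_disc t : in_disc (vline t).
Proof. by move=> j; rewrite normc_cis. Qed.

Lemma smooth_prod n : smooth n -> n = (\prod_(j < N) j ^ logn j n)%N.
Proof.
move=> [n0 hn]; rewrite -{1}(partnT n0).
have -> : (n`_predT)%N = (\prod_(0 <= p < (maxn n N).+1) p ^ logn p n)%N.
  by rewrite (@widen_partn (maxn n N)) ?leq_maxl//; apply: eq_bigl.
rewrite (@big_cat_nat _ _ _ N)//=; last by rewrite leqW// leq_maxr.
rewrite [X in (_ * X)%N]big1_seq ?muln1 ?big_mkord// => p /andP[_].
by rewrite mem_index_iota => /andP[Np _]; rewrite hn.
Qed.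

Lemma chi_vline t n : smooth n -> chi (vline t) n = cis (- t * ln n%:R).
Proof.
move=> sn; rewrite [in RHS](smooth_prod sn) /chi.
pose Inv (a : C) (b : nat) := (0 < b)%N /\ a = cis (- t * ln b%:R).
suff [] : Inv (\prod_(j < N) vline t j ^+ logn j n) (\prod_(j < N) j ^ logn j n)%N by [].
apply: (big_ind2 Inv).
- by split=> //; rewrite (_ : 1%:R = 1 :> R)// ln1 mulr0 cis0.
- move=> x1 x2 y1 y2 [p1 ->] [p2 ->]; split; first by rewrite muln_gt0 p1.
  by rewrite natrM lnM ?posrE ?ltr0n// mulrDr cisD.
move=> j _; have [->|] := posnP (logn j n).
  by split=> //; rewrite expr0 expn0 (_ : 1%:R = 1 :> R)// ln1 mulr0 cis0.
rewrite logn_gt0 mem_primes => /andP[/prime_gt0 j0 _]; split; first by rewrite expn_gt0 j0.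
by rewrite /vline cisX natrX lnXn ?ltr0n// -[ln _ *+ _]mulr_natl mulrCA.
Qed.

(* trigonometric polynomials in the coordinates, indexed by pairs of N-smooth integers *)
Definition tpoly h := exists2 l : seq (C * (nat * nat)),
  (forall x, x \in l -> smooth x.2.1 /\ smooth x.2.2) &
  forall z, h z = \sum_(x <- l) x.1 * chi z x.2.1 * conjc (chi z x.2.2).

Lemma smooth1 : smooth 1.
Proof. by split=> // p _; rewrite logn1. Qed.

Lemma tpoly_mono c n m : smooth n -> smooth m ->
  tpoly (fun z => c * chi z n * conjc (chi z m)).
Proof.
move=> sn sm; exists [:: (c, (n, m))] => [x|z]; last by rewrite big_seq1.
by rewrite inE => /eqP->.
Qed.

Lemma tpoly_cst c : tpoly (fun=> c).
Proof.
have [l hl E] := tpoly_mono c smooth1 smooth1; exists l => // z.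
by rewrite -E !chi1 rmorph1 !mulr1.
Qed.

Lemma tpolyD h k : tpoly h -> tpoly k -> tpoly (fun z => h z + k z).
Proof.
move=> [l hl El] [l' hl' El']; exists (l ++ l') => [x|z].
  by rewrite mem_cat => /orP[/hl|/hl'].
by rewrite big_cat El El'.
Qed.

Lemma tpoly_sum I (r : seq I) (h : I -> (nat -> C) -> C) :
  (forall i, tpoly (h i)) -> tpoly (fun z => \sum_(i <- r) h i z).
Proof.
move=> hh; elim: r => [|i r IH].
  by under eq_fun do rewrite big_nil; exact: tpoly_cst.
by under eq_fun do rewrite big_cons; exact: tpolyD.
Qed.

Lemma tpolyM h k : tpoly h -> tpoly k -> tpoly (fun z => h z * k z).
Proof.
move=> [l hl El] [l' hl' El'].
pose f (x y : C * (nat * nat)) := (x.1 * y.1, (x.2.1 * y.2.1, x.2.2 * y.2.2)%N).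
exists [seq f xy.1 xy.2 | xy <- [seq (x, y) | x <- l, y <- l']] => [x|z].
  move=> /mapP[_ /allpairsP[[a b] /= [/hl [a1 a2] /hl' [b1 b2] ->]] ->] /=.
  by split; exact: smoothM.
rewrite big_map big_allpairs El El' mulr_suml big_seq [RHS]big_seq; apply: eq_bigr => x /hl [[x1 _] [x2 _]].
rewrite mulr_sumr big_seq [RHS]big_seq; apply: eq_bigr => y /hl' [[y1 _] [y2 _]].
by rewrite /f /= !chiM// rmorphM; ring.
Qed.

Lemma tpoly_conj h : tpoly h -> tpoly (fun z => conjc (h z)).
Proof.
move=> [l hl El]; exists [seq (conjc x.1, (x.2.2, x.2.1)) | x <- l] => [x|z].
  by move=> /mapP[y /hl [y1 y2] ->].
rewrite big_map El rmorph_sum; apply: eq_bigr => x _ /=.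
by rewrite !rmorphM /= conjcK; ring.
Qed.

Lemma tpoly_horner h (Q : {poly R}) : tpoly h -> tpoly (fun z => (Q.[normc (h z) ^+ 2])%:C%C).
Proof.
move=> hh; have hh2 : tpoly (fun z => (normc (h z) ^+ 2)%:C%C).
  by under eq_fun do rewrite -mulcJ; apply: tpolyM => //; exact: tpoly_conj.
elim/poly_ind: Q => [|Q c IH].
  by under eq_fun do rewrite horner0; exact: tpoly_cst.
under eq_fun do rewrite hornerMXaddC rmorphD rmorphM.
by apply: tpolyD; [exact: tpolyM|exact: tpoly_cst].
Qed.

Lemma chi_inj n m : smooth n -> smooth m -> (forall j, (j < N)%N -> logn j n = logn j m) -> n = m.
Proof.
move=> [n0 hn] [m0 hm] E; apply: eqn_from_log => // j.
by have [/E//|Nj] := ltnP j N; rewrite hn// hm.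
Qed.

Lemma tavg_mono M c (u v : nat -> nat) n z : (0 < M)%N ->
  (forall j, (j < n)%N -> (u j < M)%N /\ (v j < M)%N) ->
  tavg M n (fun w => Re (c * \prod_(j < n) (w j ^+ u j * conjc (w j) ^+ v j))) z =
  if [forall j : 'I_n, u j == v j] then Re c else 0.
Proof.
move=> M0; elim: n c z => [|n IH] c z huv.
  rewrite /= big_ord0 mulr1; case: forallP => // -[] [].
  by [].
rewrite [LHS]/= tavg_gavg//.
have huv' j : (j < n)%N -> (u j < M)%N /\ (v j < M)%N by move=> jn; apply: huv; rewrite ltnW.
have [un vn] := huv n (ltnSn n).
have E t w : Re (c * \prod_(j < n.+1) (upd w n (cis t) j ^+ u j * conjc (upd w n (cis t) j) ^+ v j)) =
    Re ((\prod_(j < n) (w j ^+ u j * conjc (w j) ^+ v j)) * c * cis t ^+ u n * conjc (cis t) ^+ v n).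
  rewrite big_ord_recr /= /upd eqxx; congr complex.Re.
  under eq_bigr => j _ do rewrite (ltn_eqF (ltn_ord j)).
  by ring.
under eq_tavg do under eq_gavg do rewrite E.
under eq_tavg do rewrite gavg_orth// !modn_small//.
case: eqVneq => uvn; last first.
  rewrite tavg_cst//; case: forallP => // /(_ ord_max) /=; rewrite (negbTE uvn); by [].
under eq_tavg do rewrite mulrC.
rewrite IH//; congr (if _ then _ else _); apply/forallP/forallP => h j.
  by have [j' ->|->] := unliftP ord_max j; [rewrite lift_max; exact: h|rewrite /= uvn].
by have := h (lift ord_max j); rewrite lift_max.
Qed.

Lemma tpoly_mean h : tpoly h -> exists c : R,
  [/\ continuous (fun t => Re (h (vline t))),
   (fun T => tmean T (fun t => Re (h (vline t)))) @ +oo --> c &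
   exists M0, forall M, (M0 <= M)%N -> forall z, tavg M N (fun w => Re (h w)) z = c].
Proof.
move=> [l hl El].
have -> : h = (fun z => \sum_(x <- l) x.1 * chi z x.2.1 * conjc (chi z x.2.2)).
  by apply/funext.
elim: l hl {h El} => [|[c [n m]] l IH] hl.
  exists 0; split.
  - by under eq_fun do rewrite big_nil; move=> x; exact: cvg_cst.
  - apply/cvgrPdist_le => e e0; near=> T; under eq_fun do rewrite big_nil.
    by rewrite tmean_cst ?subrr ?normr0 ?ltW//.
  - exists 1%N => M M0 z; under eq_tavg do rewrite big_nil.
    by rewrite tavg_cst.
have [|c0 [cc cT [M0 cM]]] := IH.
  by move=> x xl; apply: hl; rewrite inE xl orbT.
have /= [sn sm] := hl (c, (n, m)) (mem_head _ _).
have n0 : 0 < n%:R :> R by rewrite ltr0n; case: sn.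
have m0 : 0 < m%:R :> R by rewrite ltr0n; case: sm.
have E t : Re (c * chi (vline t) n * conjc (chi (vline t) m)) =
    Re (c * cis (- t * (ln n%:R - ln m%:R))).
  by rewrite !chi_vline// conj_cis -mulrA -cisD mulrBr.
have cw : continuous (fun t => Re (c * chi (vline t) n * conjc (chi (vline t) m))).
  by under eq_fun do rewrite E; exact: continuous_wave.
exists ((if n == m then Re c else 0) + c0); split.
- under eq_fun do rewrite big_cons ReD /=.
  by move=> x; apply: cvgD; [exact: cw|exact: cc].
- have -> : (fun T => tmean T (fun t => Re (\sum_(x <- (c, (n, m)) :: l)
      x.1 * chi (vline t) x.2.1 * conjc (chi (vline t) x.2.2)))) =
    (fun T => tmean T (fun t => Re (c * cis (- t * (ln n%:R - ln m%:R)))) +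
      tmean T (fun t => Re (\sum_(x <- l) x.1 * chi (vline t) x.2.1 * conjc (chi (vline t) x.2.2)))).
    apply/funext => T; rewrite -tmeanD//; last exact: continuous_wave.
    by congr tmean; apply/funext => t; rewrite big_cons ReD E.
  apply: cvgD => //; case: eqVneq => [->|nm].
    rewrite subrr; apply/cvgrPdist_le => e e0; near=> T.
    under eq_fun do rewrite mulr0 cis0 mulr1.
    by rewrite tmean_cst ?subrr ?normr0 ?ltW//.
  by apply: tmean_wave; rewrite subr_eq0; apply: contra nm => /eqP/ln_inj; rewrite !posrE => /(_ n0 m0)/eqP; rewrite eqr_nat.
- exists (maxn M0 (maxn n m).+1) => M; rewrite geq_max => /andP[hM0 hM] z.
  have Mp : (0 < M)%N by exact: leq_trans hM.
  under eq_tavg do rewrite big_cons ReD.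
  rewrite tavgD cM//; congr (_ + _) => /=.
  have EE w : Re (c * chi w n * conjc (chi w m)) =
     Re (c * \prod_(j < N) (w j ^+ logn j n * conjc (w j) ^+ logn j m)).
    rewrite big_split /= -mulrA; congr (complex.Re (_ * (_ * _))).
    by rewrite /chi rmorph_prod; apply: eq_bigr => j _; rewrite rmorphXn.
  under eq_tavg do rewrite EE.
  have lt_log k j : smooth k -> (k <= maxn n m)%N -> (logn j k < M)%N.
    move=> [k0 _] km; apply: leq_trans hM; rewrite ltnS; apply: leq_trans km.
    by apply/ltnW/ltn_logl.
  rewrite (@tavg_mono M c (logn^~ n) (logn^~ m))//; last first.
    by move=> j _; split; apply: lt_log => //; rewrite ?leq_maxl ?leq_maxr.
  case: forallP => [h|h].
    by rewrite (@chi_inj n m)// ?eqxx// => j jN; have /eqP := h (Ordinal jN).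
  by case: eqP => // nm; case: h => j; rewrite nm.
Unshelve. all: by end_near. Qed.

(** By [norm_pow_approx] the p-th power is uniformly close, on the unit polydisc, to a polynomial in
    |h|^2, to which [tpoly_mean] applies. The time averages are therefore Cauchy, and their limit is
    also that of the grid averages. *)
Lemma bohr h p : tpoly h -> 1 <= p -> exists l : R,
  (fun T => tmean T (fun t => normc (h (vline t)) `^ p)) @ +oo --> l /\
  forall eps, 0 < eps -> exists M0, forall M, (M0 <= M)%N -> forall z, in_disc z ->
    `|tavg M N (fun w => normc (h w) `^ p) z - l| <= eps.
Proof.
move=> hh p1.
have [K K0 hK] : exists2 K : R, 0 <= K & forall w, in_disc w -> normc (h w) <= K.
  have [l hl El] := hh; exists (\sum_(x <- l) normc x.1).
    by apply: sumr_ge0 => x _; exact: normc_ge0.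
  move=> w hw; rewrite El; apply: le_trans (normc_sum _ _ _) _; apply: ler_sum => x _.
  rewrite !normcM normcJ -mulrA ler_piMr ?normc_ge0// mulr_ile1 ?normc_ge0//; exact: normc_chi.
have app eps : 0 < eps -> exists Q : {poly R}, forall w, in_disc w ->
    `|Q.[normc (h w) ^+ 2] - normc (h w) `^ p| <= eps.
  move=> e0; have [Q hQ] := norm_pow_approx K0 p1 e0; exists Q => w hw.
  by apply: hQ; rewrite normc_ge0 hK.
have cg : continuous (fun t => normc (h (vline t)) `^ p).
  move=> t0; apply/cvgrPdist_le => e e0.
  have e3 : 0 < e / 3 by rewrite divr_gt0.
  have [Q hQ] := app _ e3.
  have [c [cc _ _]] := tpoly_mean (tpoly_horner Q hh).
  have /cvgrPdist_le /(_ _ e3) := cc t0; apply: filterS => t /= ht.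
  have := hQ _ (vline_disc t0); have := hQ _ (vline_disc t).
  by move: ht; rewrite !ler_norml => /andP[? ?] /andP[? ?] /andP[? ?]; apply/andP; split; lra.
have cauchyT : cauchy ((fun T => tmean T (fun t => normc (h (vline t)) `^ p)) @ +oo).
  apply: cauchy_exP => e e0; have e3 : 0 < e / 3 by rewrite divr_gt0.
  have [Q hQ] := app _ e3.
  have [c [cc /cvgrPdist_le /(_ _ e3) cT _]] := tpoly_mean (tpoly_horner Q hh).
  exists c; suff : \forall T \near +oo, ball c e (tmean T (fun t => normc (h (vline t)) `^ p)) by [].
  near=> T; rewrite /ball /=.
  have T0 : 0 < T by near: T; exact: nbhs_pinfty_gt.
  have h1 : `|c - tmean T (fun t => Re (Q.[normc (h (vline t)) ^+ 2])%:C%C)| <= e / 3.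
    by near: T.
  have h2 := ler_tmean_dist T0 cc cg (fun t => hQ _ (vline_disc t)).
  apply: (@le_lt_trans _ _ (e / 3 + e / 3)); last by lra.
  rewrite -(subrK (tmean T (fun t => Re (Q.[normc (h (vline t)) ^+ 2])%:C%C)) c) -addrA.
  by apply: le_trans (ler_normD _ _) _; apply: lerD.
have /cvg_ex[l hl] : cvg ((fun T => tmean T (fun t => normc (h (vline t)) `^ p)) @ +oo).
  by apply/cauchy_cvgP.
exists l; split => // e e0; have e4 : 0 < e / 4 by rewrite divr_gt0.
have [Q hQ] := app _ e4.
have [c [cc /cvgrPdist_le /(_ _ e4) cT [M0 cM]]] := tpoly_mean (tpoly_horner Q hh).
have lc : `|c - l| <= 3 * (e / 4).
  have /cvgrPdist_le /(_ _ e4) cl := hl.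
  near (+oo : set_system R) => T.
  have T0 : 0 < T by near: T; exact: nbhs_pinfty_gt.
  have h1 : `|c - tmean T (fun t => Re (Q.[normc (h (vline t)) ^+ 2])%:C%C)| <= e / 4.
    by near: T.
  have h2 := ler_tmean_dist T0 cc cg (fun t => hQ _ (vline_disc t)).
  have h3 : `|l - tmean T (fun t => normc (h (vline t)) `^ p)| <= e / 4 by near: T.
  move: h1 h2 h3; rewrite !ler_norml => /andP[? ?] /andP[? ?] /andP[? ?].
  by apply/andP; split; lra.
exists (maxn M0 1) => M; rewrite geq_max => /andP[M1 M2] z hz.
have b1 : tavg M N (fun w => normc (h w) `^ p) z <= c + e / 4.
  rewrite -(cM M M1 z) -[e / 4](tavg_cst N _ z M2) -tavgD; apply: ler_tavg_in => // w hw.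
  by have := hQ w hw; rewrite /= ler_norml => /andP[? ?]; lra.
have b2 : c <= tavg M N (fun w => normc (h w) `^ p) z + e / 4.
  rewrite -(cM M M1 z) -[e / 4](tavg_cst N _ z M2) -tavgD; apply: ler_tavg_in => // w hw.
  by have := hQ w hw; rewrite /= ler_norml => /andP[? ?]; lra.
by move: lc; rewrite !ler_norml => /andP[? ?]; apply/andP; split; lra.
Unshelve. all: by end_near. Qed.

End Bohr.

Section HnormMean.
Variable R : realType.
Local Notation C := R[i].
Implicit Types (D : C -> C) (p l x : R).

(** The Bohr lift of the sum of a_n n^-s over 1 <= n <= X, hence the shift of the index. *)
Definition hdir N (a : nat -> C) (X : nat) (z : nat -> C) : C :=
  \sum_(n < X) a n.+1 * chi N z n.+1.

Lemma hdir_tpoly N a X : (X < N)%N -> tpoly N (hdir N a X).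
Proof.
move=> XN; apply: tpoly_sum => n.
have sn : smooth N n.+1 by apply: smooth_lt => //; apply: leq_ltn_trans XN.
have [l hl E] := tpoly_mono (a n.+1) sn (@smooth1 N); exists l => // z.
by rewrite -E chi1 rmorph1 mulr1.
Qed.

Lemma natpowC_vline n t : natpowC n (- (t *i)%C) = cis (- t * ln n%:R) :> C.
Proof.
rewrite /natpowC /cexp /cis /=.
have -> : - 0 * ln n%:R - - t * 0 = 0 :> R by ring.
have -> : - 0 * 0 + - t * ln n%:R = - t * ln n%:R :> R by ring.
by rewrite expR0 mul1r.
Qed.

Lemma dirichlet_hdir x D : dirichlet_poly x D -> exists a, forall t,
  D (t *i)%C = hdir (Num.truncn x).+1 a (Num.truncn x) (vline t).
Proof.
move=> [a hD]; exists a => t; rewrite hD big_add1 big_mkord /=.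
apply: eq_bigr => n _; rewrite natpowC_vline chi_vline//.
by apply: smooth_lt => //; rewrite ltnS ltn_ord.
Qed.

Lemma cvg_powR (F : R -> R) l a : 0 < a -> 0 <= l -> (forall T, 0 < T -> 0 <= F T) ->
  F @ +oo --> l -> (fun T => F T `^ a) @ +oo --> l `^ a.
Proof.
move=> a0 l0 F0 Fl; move: l0; rewrite le_eqVlt => /orP[/eqP l0|l0].
  rewrite -l0 powR0 ?gt_eqF//; apply/cvgrPdist_le => e e0.
  have ea : 0 < e `^ a^-1 by rewrite powR_gt0.
  move/cvgrPdist_le : Fl => /(_ _ ea) H; near=> T.
  have T0 : 0 < T by near: T; exact: nbhs_pinfty_gt.
  have : `|l - F T| <= e `^ a^-1 by near: T.
  rewrite -l0 !sub0r !normrN !ger0_norm ?powR_ge0 ?F0// => h.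
  rewrite (_ : e = (e `^ a^-1) `^ a); last first.
    by rewrite -powRrM mulVf ?gt_eqF// powRr1// ltW.
  by rewrite ge0_ler_powR ?nnegrE ?F0 ?(ltW a0) ?powR_ge0.
apply: (cvg_comp F (fun y => y `^ a) Fl).
have : differentiable (fun y : R => y `^ a) l.
  by apply/derivable1_diffP; apply: derivable_powR; rewrite in_itv /= l0.
by move=> df; exact: (differentiable_continuous df).
Unshelve. all: by end_near. Qed.

Lemma Hnorm_tmean D p l : 1 <= p ->
  (fun T => tmean T (fun t => normc (D (t *i)%C) `^ p)) @ +oo --> l ->
  0 <= l /\ Hnorm p D = l `^ p^-1.
Proof.
move=> p1 hl; have p0 : 0 < p by lra.
have F0 T : 0 < T -> 0 <= tmean T (fun t => normc (D (t *i)%C) `^ p).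
  move=> T0; apply: mulr_ge0; first by rewrite invr_ge0 mulr_ge0// ltW.
  by apply: Rintegral_ge0 => t _; exact: powR_ge0.
have l0 : 0 <= l.
  rewrite -(cvg_lim _ hl)//; apply: limr_ge; first by apply/cvg_ex; exists l.
  by near=> T; apply: F0; near: T; exact: nbhs_pinfty_gt.
split=> //; rewrite /Hnorm; apply: cvg_lim => //.
apply: (cvg_powR _ l0 F0 hl); by rewrite invr_gt0.
Unshelve. all: by end_near. Qed.

End HnormMean.

(** * Upper bound *)

Section Torus.
Variable R : realType.
Local Notation C := R[i].
Implicit Types (z w : nat -> C) (F G : (nat -> C) -> R).

(** Stronger than [in_disc]: a monomial in the small primes drops out of a modulus only if these
    coordinates are unimodular. *)
Definition in_torus z := forall j, normc (z j) = 1.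

Lemma in_torus_disc z : in_torus z -> in_disc z.
Proof. by move=> h j; rewrite h. Qed.

Lemma in_torus_upd z j t : in_torus z -> in_torus (upd z j (cis t)).
Proof. by move=> h i; rewrite /upd; case: eqP => // _; rewrite normc_cis. Qed.

Lemma ler_tavg_torus M n F G z : in_torus z -> (forall w, in_torus w -> F w <= G w) ->
  tavg M n F z <= tavg M n G z.
Proof.
move=> + h; elim: n z => [|n IH] z hz /=; first exact: h.
by apply: ler_gavg => t; apply: IH; exact: in_torus_upd.
Qed.

Lemma eq_tavg_torus M n F G z : in_torus z -> (forall w, in_torus w -> F w = G w) ->
  tavg M n F z = tavg M n G z.
Proof.
by move=> hz h; apply/eqP; rewrite eq_le !ler_tavg_torus// => w /h ->.
Qed.

Lemma tavg_agree M n F z z' : (forall j, (n <= j)%N -> z j = z' j) ->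
  tavg M n F z = tavg M n F z'.
Proof.
elim: n z z' => [|n IH] z z' h /=; first by congr F; apply/funext => j; exact: h.
apply: eq_gavg => t; apply: IH => j nj; rewrite /upd; case: eqVneq => // jn.
by apply: h; rewrite ltn_neqAle eq_sym jn.
Qed.

(** The one-parameter rotation with weights c at a grid angle; it preserves grid averages and
    multiplies a monomial by the angle raised to its [grade]. *)
Definition rot M N (c : nat -> nat) l z : nat -> C :=
  fun j => if (j < N)%N then cis (gpt R M l) ^+ c j * z j else z j.

Lemma tavg_rot M N c l F z n : (n <= N)%N ->
  tavg M n (fun w => F (rot M N c l w)) z = tavg M n F (rot M N c l z).
Proof.
elim: n z => [//|n IH] z nN /=.
under eq_gavg do rewrite IH ?(ltnW nN)//.
have E t : rot M N c l (upd z n (cis t)) =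
    upd (rot M N c l z) n (cis (gpt R M (c n * l) + t)).
  apply/funext => j; rewrite /rot /upd; case: (eqVneq j n) => // ->.
  by rewrite nN cisD; congr (_ * _); rewrite [RHS]cis_gpt mulnC exprM -cis_gpt.
under eq_gavg do rewrite E.
apply: (@gavg_shift R M (fun t => tavg M n F (upd (rot M N c l z) n (cis t)))) => t.
by rewrite cisD cis2pi mulr1.
Qed.

Lemma tavg_rot_inv M N c l F z :
  tavg M N (fun w => F (rot M N c l w)) z = tavg M N F z.
Proof.
rewrite tavg_rot//; apply: tavg_agree => j Nj.
by rewrite /rot ltnNge Nj.
Qed.

Definition grade N (c : nat -> nat) (n : nat) : nat := (\sum_(j < N) c j * logn j n)%N.

Lemma chi_rot M N c l z n :
  chi N (rot M N c l z) n = cis (gpt R M l) ^+ grade N c n * chi N z n.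
Proof.
rewrite /chi /grade -prodrXr -big_split; apply: eq_bigr => j _ /=.
by rewrite /rot ltn_ord exprMn exprM.
Qed.

(** The terms of grade k are the average of the rotations of the polynomial against a character, so
    convexity of the p-th power makes the projection a contraction. Grades below M are not confused
    by the grid. *)
Lemma tavg_grade_le M N c X k (a : nat -> C) (p : R) z : 1 <= p -> (k < M)%N ->
  (forall n, (n < X)%N -> (grade N c n.+1 < M)%N) ->
  tavg M N (fun w => normc (hdir N (fun n => if grade N c n == k then a n else 0) X w) `^ p) z <=
  tavg M N (fun w => normc (hdir N a X w) `^ p) z.
Proof.
move=> p1 kM hM; have M0 : (0 < M)%N by exact: leq_ltn_trans kM.
have MR : 0 < M%:R :> R by rewrite ltr0n.
have p0 : 0 < p by lra.
have MC : (M%:R : C) != 0 by rewrite pnatr_eq0 -lt0n.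
have E w : hdir N (fun n => if grade N c n == k then a n else 0) X w =
    \sum_(l < M) (M%:R^-1)%:C%C * (conjc (cis (gpt R M l)) ^+ k * hdir N a X (rot M N c l w)).
  rewrite -mulr_sumr.
  under eq_bigr => l _ do rewrite mulr_sumr.
  rewrite exchange_big /= mulr_sumr; apply: eq_bigr => n _.
  have H (l : 'I_M) : conjc (cis (gpt R M l)) ^+ k * (a n.+1 * chi N (rot M N c l w) n.+1) =
      (a n.+1 * chi N w n.+1) *
      (cis (gpt R M l) ^+ grade N c n.+1 * conjc (cis (gpt R M l)) ^+ k).
    by rewrite chi_rot; ring.
  under eq_bigr => l _ do rewrite H.
  rewrite -mulr_sumr grid_orth// !modn_small// ?hM//.
  case: eqP => _; last by rewrite !mulr0 mul0r.
  by rewrite fmorphV rmorph_nat mulrCA mulVf ?mulr1.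
apply: (@le_trans _ _ (tavg M N (fun w => \sum_(l < M) M%:R^-1 *
    normc (hdir N a X (rot M N c l w)) `^ p) z)).
  apply: ler_tavg => w; rewrite E.
  apply: (@le_trans _ _ ((\sum_(l < M) M%:R^-1 * normc (hdir N a X (rot M N c l w))) `^ p)).
    apply: ge0_ler_powR; rewrite ?nnegrE ?normc_ge0 ?(ltW p0)//.
      by apply: sumr_ge0 => l _; rewrite mulr_ge0 ?invr_ge0 ?(ltW MR) ?normc_ge0.
    apply: le_trans (normc_sum _ _ _) _; apply: ler_sum => l _.
    rewrite !normcM normcX normcJ normc_cis expr1n mul1r normc_real.
    by rewrite ger0_norm ?invr_ge0 ?ler0n.
  apply: (jensen_powR p1) => [l|l|].
  - by rewrite invr_ge0 ler0n.
  - exact: normc_ge0.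
  - by rewrite sumr_const card_ord -[_ *+ M]mulr_natr mulVf// gt_eqF.
rewrite tavg_sum; under eq_bigr => l _.
  rewrite tavgZ (@tavg_rot_inv M N c l (fun w => normc (hdir N a X w) `^ p)).
  over.
by rewrite -mulr_suml sumr_const card_ord -[_ *+ M]mulr_natr mulVf ?gt_eqF// mul1r.
Qed.

End Torus.

Section Upper.
Variable R : realType.
Local Notation C := R[i].
Implicit Types (z w : nat -> C).

Lemma tavg_grades_le M N (I : Type) (s : seq I) (c : I -> nat -> nat) (tau : I -> nat) X
    (a : nat -> C) (p : R) z : 1 <= p -> (forall i, (tau i < M)%N) ->
  (forall i n, (n < X)%N -> (grade N (c i) n.+1 < M)%N) ->
  tavg M N (fun w => normc (hdir N (fun n => if all (fun i => grade N (c i) n == tau i) s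
                                     then a n else 0) X w) `^ p) z <=
  tavg M N (fun w => normc (hdir N a X w) `^ p) z.
Proof.
move=> p1 tM hM; elim: s => [|i s IH] /=; first exact: lexx.
apply: le_trans IH.
have := @tavg_grade_le R M N (c i) X (tau i)
  (fun n => if all (fun i => grade N (c i) n == tau i) s then a n else 0) p z p1 (tM i) (hM i).
congr (tavg M N _ z <= _); apply/funext => w; congr (normc _ `^ _).
by apply: eq_bigr => n _; case: (grade N (c i) n.+1 == tau i).
Qed.

(** The grade counts prime factors of n, with multiplicity, each of which is at least b. *)
Lemma grade_exp_le N (c : nat -> nat) b n : smooth N n ->
  (forall j, (c j <= 1)%N) -> (forall j, prime j -> c j = 1%N -> (b <= j)%N) ->
  (b ^ grade N c n <= n)%N.
Proof.
move=> sn c1 cb; rewrite [leqRHS](smooth_prod sn) /grade expn_sum.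
apply: leq_prod => j _; have [->|l0] := posnP (logn j n); first by rewrite muln0.
have /andP[pj _] : prime j && (0 < n)%N && (j %| n)%N by move: l0; rewrite logn_gt0 mem_primes andbA.
have {pj} pj : prime j by case/andP: pj.
have := c1 j; case E: (c j) => [|[|//]] _.
  by rewrite mul0n expn0 expn_gt0 prime_gt0.
by rewrite mul1n leq_exp2r// cb.
Qed.

Lemma le_of_eps (u v A s : R) : 1 <= s -> 0 <= v -> 0 <= A ->
  (forall eps, 0 < eps -> u <= A * (v + eps) `^ s + eps) -> u <= A * v `^ s.
Proof.
move=> s1 v0 A0 h; apply/ler_addgt0Pr => e e0.
pose L := s * (v + 1) `^ (s - 1).
have L0 : 0 <= L by apply: mulr_ge0; [lra|exact: powR_ge0].
have AL : 0 < A * L + 1 by rewrite ltr_wpDl// mulr_ge0.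
pose d := Num.min 1 (e / (A * L + 1)).
have d0 : 0 < d by rewrite lt_min ltr01 divr_gt0.
have d1 : d <= 1 by rewrite ge_min lexx.
have dA : d * (A * L + 1) <= e by rewrite -ler_pdivlMr// ge_min lexx orbT.
apply: le_trans (h d d0) _.
have := @powR_lip _ s (v + 1) (v + d) v s1.
have -> : 0 <= v + d <= v + 1 by apply/andP; split; lra.
have -> : 0 <= v <= v + 1 by apply/andP; split; lra.
move=> /(_ isT isT); rewrite (_ : v + d - v = d); last by ring.
rewrite (gtr0_norm d0) -/L => /(le_trans (ler_norm _)) H.
have := ler_wpM2l A0 H; rewrite mulrBr => H2.
by move: dA H2; clearbody L d; lra.
Qed.

Section Split.
Variables (N X Y : nat) (a : nat -> C).
Hypothesis XN : (X < N)%N.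

(* grad i, for i <= Y, counts the prime i; the last one counts the prime factors > Y. *)
Definition grad (i : 'I_Y.+2) (j : nat) : nat := if (i < Y.+1)%N then j == i else (Y < j)%N.

Let B := (trunc_log 2 X).+1.

Lemma grad_lt i n : (n < X)%N -> (grade N (grad i) n.+1 < B)%N.
Proof.
move=> nX; rewrite ltnS; apply: trunc_log_max => //; apply: (leq_trans _ nX).
apply: grade_exp_le.
- by apply: smooth_lt => //; exact: (leq_ltn_trans nX XN).
- by move=> j; rewrite /grad; case: ifP => _; exact: leq_b1.
- by move=> j /prime_gt1.
Qed.

Definition mask (tau : {ffun 'I_Y.+2 -> 'I_B}) (n : nat) : C :=
  if all (fun i => grade N (grad i) n == tau i) (enum 'I_Y.+2) then a n else 0.

Lemma maskP tau n : mask tau n != 0 -> forall i, grade N (grad i) n = tau i.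
Proof.
rewrite /mask; case: allP; last by rewrite eqxx.
by move=> h _ i; apply/eqP/h; rewrite mem_enum.
Qed.

Lemma hdir_split w : hdir N a X w = \sum_tau hdir N (mask tau) X w.
Proof.
rewrite /hdir exchange_big /=; apply: eq_bigr => n _.
rewrite -mulr_suml; congr (_ * _).
pose ty : {ffun 'I_Y.+2 -> 'I_B} := [ffun i => inord (grade N (grad i) n.+1)].
have tyE i : grade N (grad i) n.+1 = ty i by rewrite ffunE inordK// grad_lt.
rewrite (bigD1 ty)//= big1 ?addr0.
  rewrite /mask; case: allP => // h; case: h => i _; apply/eqP; exact: tyE.
move=> tau nt; apply/eqP; apply: contraNT nt => /maskP h.
by apply/eqP/ffunP => i; apply/val_inj; rewrite /= -h tyE.
Qed.

Definition rexp (i : 'I_X) (j : nat) : nat := if (Y < j)%N then logn j i.+1 else 0%N.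

(** All n of a piece have the same exponents at the primes <= Y, so these contribute a common
    unimodular factor; what remains involves the large primes only. *)
Lemma normc_hdir_mask tau w : in_torus w ->
  normc (hdir N (mask tau) X w) = normc (peval N (fun i : 'I_X => mask tau i.+1) rexp w).
Proof.
move=> hw.
pose th := \prod_(j < N) w j ^+ (if (j <= Y)%N then tau (inord j) : nat else 0%N).
have nth_ : normc th = 1.
  by rewrite normc_prod big1// => j _; rewrite normcX hw expr1n.
have -> : hdir N (mask tau) X w = th * peval N (fun i : 'I_X => mask tau i.+1) rexp w.
  rewrite mulr_sumr; apply: eq_bigr => n _; rewrite mulrCA.
  have [->|m0] := eqVneq (mask tau n.+1) 0; first by rewrite !mul0r.
  congr (_ * _); rewrite /chi /th -big_split; apply: eq_bigr => j _ /=.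
  rewrite -exprD; congr (_ ^+ _); rewrite /rexp ltnNge; case: leqP => jY /=; last by rewrite add0n.
  have jY2 : (j < Y.+2)%N by rewrite ltnW// ltnS.
  rewrite addn0 -(maskP m0) /grade (bigD1 j)//= /grad !inordK// ltnS jY eqxx mul1n.
  rewrite big1 ?addn0// => k kj; case: eqP => // E.
  by move: kj; rewrite -val_eqE /= E eqxx.
by rewrite normcM nth_ mul1r.
Qed.

Lemma peval_dil_mask tau (r : R) w :
  peval N (fun i : 'I_X => mask tau i.+1) rexp (dil r N w) =
  r%:C%C ^+ tau ord_max * peval N (fun i : 'I_X => mask tau i.+1) rexp w.
Proof.
rewrite mulr_sumr; apply: eq_bigr => n _; rewrite mulrCA.
have [->|m0] := eqVneq (mask tau n.+1) 0; first by rewrite !mul0r.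
congr (_ * _); rewrite -(maskP m0) /grade -prodrXr -big_split; apply: eq_bigr => j _ /=.
rewrite /dil ltn_ord exprMn /rexp /grad /= ltnn.
by case: ltnP => _; rewrite ?mul1n ?mul0n ?expr0.
Qed.

(** The triangle inequality over the B^(Y+2) pieces. With k large prime factors, a piece is r^-k
    times its dilate up to a unimodular factor; the dilate is controlled by
    [tensor_hypercontractive], and the piece itself by D through the contraction property. *)
Lemma tavg_hdir_le (p s : R) : 1 <= p -> 1 <= s -> forall eps, 0 < eps ->
  (0 < Y)%N -> (0 < X)%N ->
  exists m0, forall m, (m0 <= m)%N -> forall z, in_torus z ->
  tavg m.*2.+1 N (fun w => normc (hdir N a X w) `^ (p * s)) z <=
  (B ^ Y.+2)%:R `^ (p * s) * expR (p * s * (ln s / 2 * (ln X%:R / ln Y.+1%:R))) *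
  (tavg m.*2.+1 N (fun w => normc (hdir N a X w) `^ p) z + eps) `^ s.
Proof.
move=> p1 s1 eps e0 Y0 X0; have s0 : 0 < s by lra.
have p0 : 0 < p by lra.
have ps1 : 1 <= p * s by rewrite -[leLHS]mulr1 ler_pM.
have ps0 : 0 < p * s by rewrite mulr_gt0.
(* That is r = s^(-1/2). *)
pose r := expR (- (ln s / 2)).
have r0 : 0 < r by exact: expR_gt0.
have rs : r ^+ 2 * s = 1.
  rewrite /r -expRM_natl -{2}[s]lnK ?posrE// -expRD.
  by rewrite (_ : _ + _ = 0) ?expR0//; field.
pose I := {ffun 'I_Y.+2 -> 'I_B}.
have /choice[f hf] : forall tau : I, exists m0, forall m, (m0 <= m)%N -> forall z, in_disc z ->
    tavg m.*2.+1 N (fun w => normc (peval N (fun i : 'I_X => mask tau i.+1) rexp (dil r N w)) `^ (p * s)) z <=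
    (tavg m.*2.+1 N (fun w => normc (peval N (fun i : 'I_X => mask tau i.+1) rexp w) `^ p) z + eps) `^ s.
  by move=> tau; exact: tensor_hypercontractive.
exists (maxn B (\max_tau f tau)) => m; rewrite geq_max => /andP[Bm fm] z hz.
set M := m.*2.+1; have M0 : (0 < M)%N by [].
have BM : (B <= M)%N by rewrite (leq_trans Bm)// /M -addnn leqW// leq_addr.
set A := tavg M N (fun w => normc (hdir N a X w) `^ p) z.
have A0 : 0 <= A by apply: tavg_ge0 => w; exact: powR_ge0.
pose kap := ln X%:R / ln Y.+1%:R : R.
have lnY : 0 < ln Y.+1%:R :> R by rewrite ln_gt0// ltr1n ltnS.
have X1 : 1 <= X%:R :> R by rewrite ler1n.
have lnX : 0 <= ln X%:R :> R by rewrite ln_ge0.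
pose W := expR (p * s * (ln s / 2 * kap)).
have key tau : tavg M N (fun w => normc (hdir N (mask tau) X w) `^ (p * s)) z <=
    W * (A + eps) `^ s.
  pose P := peval N (fun i : 'I_X => mask tau i.+1) rexp.
  have E q : tavg M N (fun w => normc (hdir N (mask tau) X w) `^ q) z =
     tavg M N (fun w => normc (P w) `^ q) z.
    by apply: eq_tavg_torus => // w hw; rewrite normc_hdir_mask.
  (* The bound on tau ord_max needs an n that has the exponents tau; without one the piece is
     zero. *)
  have [/existsP[n mn]|/existsPn none] := boolP [exists n : 'I_X, mask tau n.+1 != 0]; last first.
    rewrite (@eq_tavg _ _ _ _ (fun=> 0)) ?tavg_cst ?mulr_ge0 ?expR_ge0 ?powR_ge0//.
    move=> w; rewrite /hdir big1 ?normc0 ?powR0 ?gt_eqF// => n _.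
    by have := none n; rewrite negbK => /eqP ->; rewrite mul0r.
  have tk : (tau ord_max : nat)%:R <= kap.
    rewrite ler_pdivlMr// mulr_natl -lnXn ?ltr0n// -natrX ler_ln ?posrE ?ltr0n ?expn_gt0// ler_nat.
    rewrite -(maskP mn); apply: leq_trans (ltn_ord n); apply: grade_exp_le.
    - by apply: smooth_lt => //; apply: leq_ltn_trans XN; exact: ltn_ord.
    - by move=> j; rewrite /grad; case: ifP => _; exact: leq_b1.
    - by move=> j _; rewrite /grad /= ltnn; case: ltnP.
  have rk : r `^ (p * s * (tau ord_max)%:R) * W >= 1.
    have -> : r `^ (p * s * (tau ord_max)%:R) = expR (- (p * s * (ln s / 2 * (tau ord_max)%:R))).
      by rewrite /r -expRM; congr expR; ring.
    rewrite -expRD -[leLHS]expR0 ler_expR addrC subr_ge0 ler_pM2l// ler_wpM2l//.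
    by rewrite divr_ge0// ln_ge0.
  have h1 : tavg M N (fun w => normc (P (dil r N w)) `^ (p * s)) z <= (A + eps) `^ s.
    have fmt : (f tau <= m)%N by apply: leq_trans fm; exact: leq_bigmax.
    apply: le_trans (hf tau m fmt _ (in_torus_disc hz)) _.
    apply: ge0_ler_powR; rewrite ?nnegrE ?(ltW s0)//.
    - by rewrite addr_ge0 ?(ltW e0)// tavg_ge0// => w; exact: powR_ge0.
    - by rewrite addr_ge0 ?(ltW e0).
    - rewrite lerD2r -E; apply: tavg_grades_le => //.
        by move=> i; apply: leq_trans BM; exact: ltn_ord.
      by move=> i k kX; apply: leq_trans BM; exact: grad_lt.
  have h2 : tavg M N (fun w => normc (P (dil r N w)) `^ (p * s)) z =
      r `^ (p * s * (tau ord_max)%:R) * tavg M N (fun w => normc (P w) `^ (p * s)) z.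
    rewrite -tavgZ; apply: eq_tavg => w.
    rewrite /P peval_dil_mask normcM normcX normc_real (gtr0_norm r0).
    rewrite powRM ?normc_ge0 ?exprn_ge0 ?(ltW r0)//; congr (_ * _).
    by rewrite -powR_mulrn ?(ltW r0)// -powRrM mulrC.
  have t0 : 0 <= tavg M N (fun w => normc (P w) `^ (p * s)) z.
    by apply: tavg_ge0 => w; exact: powR_ge0.
  rewrite E; apply: (@le_trans _ _ (r `^ (p * s * (tau ord_max)%:R) * W *
      tavg M N (fun w => normc (P w) `^ (p * s)) z)).
    by rewrite ler_peMl.
  by rewrite mulrAC -h2 mulrC ler_wpM2l ?expR_ge0.
have cardI : #|I| = (B ^ Y.+2)%N by rewrite card_ffun !card_ord.
pose K : R := (B ^ Y.+2)%:R.
have K0 : 0 < K by rewrite ltr0n expn_gt0.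
apply: (@le_trans _ _ (tavg M N (fun w => K `^ (p * s) *
    \sum_(tau : I) K^-1 * normc (hdir N (mask tau) X w) `^ (p * s)) z)).
  apply: ler_tavg => w; rewrite hdir_split.
  apply: (@le_trans _ _ ((K * \sum_(tau : I) K^-1 * normc (hdir N (mask tau) X w)) `^ (p * s))).
    apply: ge0_ler_powR; rewrite ?nnegrE ?normc_ge0 ?(ltW ps0)//.
      rewrite mulr_ge0 ?(ltW K0)// sumr_ge0// => tau _.
      by rewrite mulr_ge0 ?normc_ge0// invr_ge0 ltW.
    apply: le_trans (normc_sum _ _ _) _; rewrite -mulr_sumr mulrA divff ?gt_eqF// mul1r.
    exact: lexx.
  rewrite powRM ?(ltW K0)//; last first.
    by apply: sumr_ge0 => tau _; rewrite mulr_ge0 ?normc_ge0// invr_ge0 ltW.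
  rewrite ler_wpM2l ?powR_ge0//; apply: (jensen_powR ps1) => [tau|tau|].
  - by rewrite invr_ge0 ltW.
  - exact: normc_ge0.
  - by rewrite sumr_const cardI -[_ *+ _]mulr_natr mulVf// gt_eqF.
rewrite tavgZ -mulrA ler_wpM2l ?powR_ge0// tavg_sum.
apply: (@le_trans _ _ (\sum_(tau : I) K^-1 * (W * (A + eps) `^ s))).
  by apply: ler_sum => tau _; rewrite tavgZ ler_wpM2l ?invr_ge0 ?(ltW K0).
by rewrite sumr_const cardI -[_ *+ _]mulr_natr mulrAC mulVf ?gt_eqF// mul1r.
Qed.

End Split.

Lemma Hnorm_upper (p q x : R) (D : C -> C) (Y : nat) : 1 <= p -> p < q -> 1 <= x ->
  dirichlet_poly x D -> (0 < Y)%N ->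
  Hnorm q D <= ((trunc_log 2 (Num.truncn x)).+1 ^ Y.+2)%:R *
    expR (ln (q / p) / 2 * (ln x / ln Y.+1%:R)) * Hnorm p D.
Proof.
move=> p1 pq x1 hD Y0.
have [a ha] := dirichlet_hdir hD.
set X := Num.truncn x in ha *.
have X0 : (0 < X)%N by rewrite /X truncn_gt0.
have hT := hdir_tpoly a (ltnSn X).
have p0 : 0 < p by lra.
have q0 : 0 < q by lra.
have q1 : 1 <= q by lra.
pose s := q / p.
have s1 : 1 <= s by rewrite ler_pdivlMr// mul1r ltW.
have s0 : 0 < s by lra.
have psq : p * s = q by rewrite /s; field; rewrite gt_eqF.
have [lp [cp hp]] := bohr hT p1; have [lq [cq hq]] := bohr hT q1.
have tE (u : R) : (fun T => tmean T (fun t => normc (D (t *i)%C) `^ u)) =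
    (fun T => tmean T (fun t => normc (hdir X.+1 a X (vline t)) `^ u)).
  by apply/funext => T; congr tmean; apply/funext => t; rewrite ha.
rewrite -(tE p) in cp; rewrite -(tE q) in cq.
have [lp0 ->] := Hnorm_tmean p1 cp; have [lq0 ->] := Hnorm_tmean q1 cq.
pose K : R := ((trunc_log 2 X).+1 ^ Y.+2)%:R.
have K0 : 0 <= K by exact: ler0n.
pose V : R := ln s / 2 * (ln X%:R / ln Y.+1%:R).
have main : lq <= K `^ q * expR (q * V) * lp `^ s.
  apply: le_of_eps => //; first by rewrite mulr_ge0 ?powR_ge0 ?expR_ge0.
  move=> e e0; have e2 : 0 < e / 2 by rewrite divr_gt0.
  have [m0 hm0] := tavg_hdir_le a (ltnSn X) p1 s1 e2 Y0 X0.
  have [Mp hMp] := hp _ e2; have [Mq hMq] := hq _ e0.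
  pose m := maxn m0 (maxn Mp Mq).
  have mM : (m <= m.*2.+1)%N by rewrite -addnn leqW// leq_addr.
  pose z : nat -> C := fun=> 1.
  have hz : in_torus z by move=> j; rewrite /z normc1.
  have := hMp m.*2.+1 (leq_trans (leq_trans (leq_maxl _ _) (leq_maxr m0 _)) mM) _ (in_torus_disc hz).
  have := hMq m.*2.+1 (leq_trans (leq_trans (leq_maxr _ _) (leq_maxr m0 _)) mM) _ (in_torus_disc hz).
  have := hm0 m (leq_maxl _ _) _ hz; rewrite psq -/K -/V.
  set Tq := tavg _ _ _ _; set Tp := tavg _ _ _ _ => h.
  rewrite !ler_norml => /andP[h1 _] /andP[_ h2].
  have : (Tp + e / 2) `^ s <= (lp + e) `^ s.
    apply: ge0_ler_powR; rewrite ?nnegrE ?(ltW s0)//; last by lra.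
      by rewrite addr_ge0 ?(ltW e2)// tavg_ge0// => w; exact: powR_ge0.
    by rewrite addr_ge0// ltW.
  have c0 : 0 <= K `^ q * expR (q * V) by rewrite mulr_ge0 ?powR_ge0 ?expR_ge0.
  move=> /(ler_wpM2l c0) h3; have h4 := le_trans h h3.
  by move: h4; clearbody Tq Tp; lra.
have : lq `^ q^-1 <= (K `^ q * expR (q * V) * lp `^ s) `^ q^-1.
  apply: ge0_ler_powR; rewrite ?nnegrE ?invr_ge0 ?(ltW q0)//.
  by rewrite !mulr_ge0 ?powR_ge0 ?expR_ge0.
move=> H; apply: le_trans H _.
rewrite !powRM ?mulr_ge0 ?powR_ge0 ?expR_ge0// -!powRrM divff ?gt_eqF// powRr1//.
have -> : s / q = p^-1 by rewrite /s; field; rewrite !gt_eqF.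
rewrite ler_wpM2r ?powR_ge0// ler_wpM2l// -expRM ler_expR.
have -> : q * V / q = V by field; rewrite gt_eqF.
rewrite /V ler_wpM2l//; first by rewrite divr_ge0// ln_ge0.
rewrite ler_wpM2r ?invr_ge0 ?ln_ge0 ?ler1n//.
rewrite ler_ln ?posrE ?ltr0n//; last by lra.
by have := truncn_itv (le_trans ler01 x1) => /andP[].
Qed.

End Upper.

(** * Lower bound *)

Section Moments.
Variable R : realType.
Local Notation C := R[i].
Implicit Types (z w : nat -> C).

(** Parseval's identity for (b + z)^k. *)
Lemma gavg_binomial_moment M k (b : C) : (k < M)%N ->
  gavg M (fun t => normc (b + cis t) ^+ (2 * k)) =
  \sum_(j < k.+1) ('C(k, j) ^ 2)%:R * normc b ^+ (2 * (k - j)).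
Proof.
move=> kM; have M0 : (0 < M)%N by exact: leq_ltn_trans kM.
have E t : normc (b + cis t) ^+ (2 * k) =
    \sum_(i < k.+1) \sum_(j < k.+1) Re ((('C(k, i) * 'C(k, j))%:R *
      (b ^+ (k - i) * conjc b ^+ (k - j))) * cis t ^+ i * conjc (cis t) ^+ j).
  have -> : normc (b + cis t) ^+ (2 * k) = Re ((b + cis t) ^+ k * conjc (b + cis t) ^+ k).
    by rewrite -exprMn mulcJ -rmorphXn /= exprM.
  rewrite rmorphD !exprDn mulr_suml Re_sum; apply: eq_bigr => i _.
  rewrite mulr_sumr Re_sum; apply: eq_bigr => j _; congr complex.Re.
  by rewrite -[_ *+ 'C(k, i)]mulr_natl -[_ *+ 'C(k, j)]mulr_natl natrM; ring.
rewrite (eq_gavg _ E) gavg_sum; apply: eq_bigr => i _.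
rewrite gavg_sum (bigD1 i)//= gavg_orth// eqxx big1 ?addr0.
  rewrite -exprMn mulcJ mulnn.
  have -> : (('C(k, i) ^ 2)%:R : C) = (('C(k, i) ^ 2)%:R)%:C%C by rewrite rmorph_nat.
  by rewrite ReZ -rmorphXn /= exprM.
move=> j ji; rewrite gavg_orth// !modn_small//.
- by rewrite eq_sym -val_eqE in ji *; rewrite (negbTE ji).
- by apply: leq_trans kM; exact: ltn_ord.
- by apply: leq_trans kM; exact: ltn_ord.
Qed.

Definition psum (n : nat) z : C := \sum_(j < n | prime j) z j.
(** The primes counted are < n: pi (y) is [npr y.+1]. *)
Definition npr (n : nat) : nat := (\sum_(j < n | prime j) 1)%N.

Lemma psum_upd n z x : psum n (upd z n x) = psum n z.
Proof. by apply: eq_bigr => j _; rewrite /upd ltn_eqF. Qed.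

Lemma psumS n z : psum n.+1 z = psum n z + (if prime n then z n else 0).
Proof. by rewrite /psum big_mkcond big_ord_recr /= -big_mkcond. Qed.

Lemma nprS n : npr n.+1 = (npr n + prime n)%N.
Proof. by rewrite /npr big_mkcond big_ord_recr /= -big_mkcond; case: (prime n). Qed.

(* Orthogonality of the last coordinate; this gives the recursion of sum of (k! / alpha!)^2 over |alpha| = k. *)
Lemma moment_step M n k z : (k < M)%N -> prime n ->
  tavg M n.+1 (fun w => normc (psum n.+1 w) ^+ (2 * k)) z =
  \sum_(j < k.+1) ('C(k, j) ^ 2)%:R * tavg M n (fun w => normc (psum n w) ^+ (2 * (k - j))) z.
Proof.
move=> kM pn; rewrite [LHS]/= tavg_gavg//.
rewrite (@eq_tavg _ _ _ _ (fun w => \sum_(j < k.+1) ('C(k, j) ^ 2)%:R * normc (psum n w) ^+ (2 * (k - j)))).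
  by rewrite tavg_sum; apply: eq_bigr => j _; rewrite tavgZ.
move=> w; rewrite -(gavg_binomial_moment _ kM); apply: eq_gavg => t.
by rewrite psumS psum_upd pn /upd eqxx.
Qed.

Lemma moment_step0 M n k z : (0 < M)%N -> ~~ prime n ->
  tavg M n.+1 (fun w => normc (psum n.+1 w) ^+ (2 * k)) z =
  tavg M n (fun w => normc (psum n w) ^+ (2 * k)) z.
Proof.
move=> M0 pn; rewrite [LHS]/= tavg_gavg//; apply: eq_tavg => w.
rewrite (@eq_gavg _ _ _ (fun=> normc (psum n w) ^+ (2 * k))) ?gavg_cst// => t.
by rewrite psumS psum_upd (negbTE pn) addr0.
Qed.

Lemma ffactS_pascal n k : (n.+1 ^_ k.+1 = n ^_ k.+1 + k.+1 * n ^_ k)%N.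
Proof.
rewrite ffactSS ffactnSr; have [kn|nk] := leqP k n.
  by rewrite [(k.+1 * _)%N]mulnC -mulnDr addnS subnK// mulnC.
by rewrite ffact_small// !muln0.
Qed.

(** Induction through [moment_step]. For the lower bound the terms j = 0 and j = 1 suffice: they
    reproduce Pascal's rule for falling factorials. For the upper bound, C(k, j) (k - j)! <= k!
    reduces the sum to the binomial expansion of (P + 1)^k. *)
Lemma moment_bounds M n k z : (k < M)%N ->
  (k`! * npr n ^_ k)%:R <= tavg M n (fun w => normc (psum n w) ^+ (2 * k)) z <=
  (k`! * npr n ^ k)%:R.
Proof.
move=> kM; have M0 : (0 < M)%N by exact: leq_ltn_trans kM.
elim: n k kM => [|n IH] k kM.
  rewrite /= /psum /npr !big_ord0 normc0; case: k kM => [|k] kM.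
    by rewrite muln0 expr0 fact0 ffactn0 expn0 lexx.
  by rewrite mulnS exprS mul0r ffact0n/= exp0n// muln0 lexx.
rewrite nprS; have [pn|pn] := boolP (prime n); last first.
  by rewrite moment_step0// addn0 IH.
rewrite moment_step// addn1.
have IHj (j : 'I_k.+1) := IH (k - j)%N (leq_ltn_trans (leq_subr j k) kM).
apply/andP; split.
  case: k kM IHj => [|k] kM IHj.
    rewrite big_ord_recr big_ord0 /= add0r bin0 exp1n mul1r subnn muln0.
    by under eq_tavg do rewrite expr0; rewrite tavg_cst.
  rewrite big_ord_recl big_ord_recl /= /bump /= addrA.
  apply: (@le_trans _ _ (('C(k.+1, 0) ^ 2)%:R * tavg M n (fun w => normc (psum n w) ^+ (2 * (k.+1 - 0))) z +
     ('C(k.+1, 1 + 0) ^ 2)%:R * tavg M n (fun w => normc (psum n w) ^+ (2 * (k.+1 - (1 + 0)))) z)); last first.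
    rewrite lerDl; apply: sumr_ge0 => j _; rewrite mulr_ge0 ?ler0n//.
    by apply: tavg_ge0 => w; rewrite exprn_ge0// normc_ge0.
  rewrite addn0 bin0 bin1 exp1n mul1r subn0 subSS subn0 ffactS_pascal mulnDr natrD.
  apply: lerD; first by have /andP[] := IH k.+1 kM.
  have -> : (k.+1`! * (k.+1 * npr n ^_ k))%N = (k.+1 ^ 2 * (k`! * npr n ^_ k))%N.
    by rewrite factS -mulnn !mulnA; congr (_ * _)%N; rewrite mulnAC.
  by rewrite natrM ler_wpM2l ?ler0n//; have /andP[] := IH k (ltnW kM).
apply: (@le_trans _ _ (\sum_(j < k.+1) ('C(k, j) ^ 2)%:R * ((k - j)`! * npr n ^ (k - j))%:R)).
  by apply: ler_sum => j _; rewrite ler_wpM2l ?ler0n//; have /andP[] := IHj j.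
under eq_bigr do rewrite -natrM.
rewrite -natr_sum ler_nat -[(npr n).+1]addn1 expnDn big_distrr /=; apply: leq_sum => j _.
have jk : (j <= k)%N by rewrite -ltnS.
rewrite exp1n muln1 -mulnn mulnACA leq_mul2r; apply/orP; right.
by rewrite -(bin_fact jk) leq_mul2l leq_pmull ?orbT ?fact_gt0.
Qed.

Lemma tavg_jensen M n F z (s : R) : 1 <= s -> (0 < M)%N -> (forall w, 0 <= F w) ->
  (tavg M n F z) `^ s <= tavg M n (fun w => F w `^ s) z.
Proof.
move=> s1 M0 F0; set m := tavg M n F z.
have m0 : 0 <= m by exact: tavg_ge0.
move: m0; rewrite le_eqVlt => /orP[/eqP m0|m0].
  rewrite -m0 powR0; last by rewrite gt_eqF//; lra.
  by apply: tavg_ge0 => w; exact: powR_ge0.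
have ms : 0 < m `^ s by rewrite powR_gt0.
apply: (@le_trans _ _ (tavg M n (fun w => m `^ s * s / m * F w + (- (m `^ s * (s - 1)))) z)).
  rewrite tavgD tavgZ tavg_cst// -/m le_eqVlt; apply/orP; left; apply/eqP; field.
  by rewrite gt_eqF.
apply: ler_tavg => w.
have hh := powR_tangent s1 (divr_ge0 (F0 w) (ltW m0)).
have -> : m `^ s * s / m * F w + (- (m `^ s * (s - 1))) =
    m `^ s * (s * (F w / m) - (s - 1)) by field; rewrite gt_eqF.
apply: le_trans (ler_wpM2l (ltW ms) hh) _.
rewrite powRM ?invr_ge0 ?(ltW m0)//.
have -> : (m^-1) `^ s = (m `^ s)^-1.
  by rewrite -powR_inv1 ?(ltW m0)// powRAC powR_inv1 ?powR_ge0.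
by rewrite mulrCA divff ?mulr1// gt_eqF.
Qed.

End Moments.

(** * Products and powers of Dirichlet polynomials *)

Section DirichletAlgebra.
Variable R : realType.
Local Notation C := R[i].

Definition dirN (X : nat) (D : C -> C) := exists a : nat -> C, forall s,
  D s = \sum_(1 <= n < X.+1) a n * natpowC n (- s).

Lemma natpowCE n (s : C) : natpowC n s = (expR (Re s * ln n%:R))%:C%C * cis (Im s * ln n%:R).
Proof.
rewrite /natpowC /cexp /cis; case: s => a b /=.
by rewrite !mulr0 subr0 add0r.
Qed.

Lemma natpowCM n m (s : C) : (0 < n)%N -> (0 < m)%N ->
  natpowC (n * m) s = natpowC n s * natpowC m s.
Proof.
move=> n0 m0; rewrite !natpowCE natrM lnM ?posrE ?ltr0n// !mulrDr expRD cisD rmorphM /=.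
by ring.
Qed.

Lemma dirNM X Y D E : dirN X D -> dirN Y E -> dirN (X * Y) (fun s => D s * E s).
Proof.
move=> [a hD] [b hE].
exists (fun n => \sum_(i < X) \sum_(j < Y) if (i.+1 * j.+1 == n)%N then a i.+1 * b j.+1 else 0).
move=> s; rewrite hD hE !big_add1 !big_mkord /= mulr_suml.
under [RHS]eq_bigr => n _ do rewrite mulr_suml.
rewrite exchange_big /=; apply: eq_bigr => i _.
under [RHS]eq_bigr => n _ do rewrite mulr_suml.
rewrite exchange_big /= mulr_sumr; apply: eq_bigr => j _.
have [k kE] : exists k, (i.+1 * j.+1 = k.+1)%N.
  by exists (i.+1 * j.+1).-1; rewrite prednK ?muln_gt0.
have ij : (k < X * Y)%N by rewrite -kE leq_mul.
rewrite kE (bigD1 (Ordinal ij))//= eqxx big1 ?addr0.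
  by rewrite -kE natpowCM//; ring.
move=> n ne; case: eqP => [E1|]; last by rewrite mul0r.
by case: E1 => E1; move: ne; rewrite -val_eqE /= E1 eqxx.
Qed.

Lemma dirN_le X Y D : (X <= Y)%N -> dirN X D -> dirN Y D.
Proof.
move=> XY [a hD]; exists (fun n => if (n <= X)%N then a n else 0) => s.
rewrite hD (@big_cat_nat _ _ _ X.+1 1 Y.+1)//= [X in _ + X]big1_seq ?addr0.
  by apply: eq_big_nat => n /andP[_]; rewrite ltnS => ->.
move=> n /andP[_]; rewrite mem_index_iota => /andP[Xn _].
by rewrite leqNgt Xn mul0r.
Qed.

Lemma dirN1 : dirN 1 (fun=> 1).
Proof.
by exists (fun=> 1) => s; rewrite big_nat1 natpowCE ln1 !mulr0 expR0 cis0 !mulr1.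
Qed.

Lemma dirNX X D m : dirN X D -> dirN (X ^ m) (fun s => D s ^+ m).
Proof.
move=> hD; elim: m => [|m IH]; first exact: dirN1.
by rewrite expnS; under eq_fun do rewrite exprS; exact: dirNM.
Qed.

End DirichletAlgebra.

Section Lower.
Variable R : realType.
Local Notation C := R[i].

Definition primeS (y : nat) (s : C) : C :=
  \sum_(1 <= n < y.+1) (if prime n then 1 else 0) * natpowC n (- s).

Lemma primeS_dirN y : dirN y (primeS y).
Proof. by exists (fun n => if prime n then 1 else 0). Qed.

Lemma primeS_vline y t : primeS y (t *i)%C = psum y.+1 (vline t).
Proof.
rewrite /primeS /psum -(big_mkord prime (fun j => vline t j)).
rewrite [RHS]big_ltn_cond//= [RHS]big_mkcond; apply: eq_bigr => n _.
by rewrite natpowC_vline; case: ifP => _; rewrite ?mul1r ?mul0r.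
Qed.

Lemma psum_tpoly N : tpoly N (psum (R := R) N).
Proof.
have -> : psum (R := R) N = (fun z => \sum_(j < N) (if prime j then 1 else 0) * chi N z j).
  apply/funext => z; rewrite /psum big_mkcond; apply: eq_bigr => j _.
  case: ifP => pj; rewrite ?mul0r// mul1r /chi (bigD1 j)//= logn_prime// eqxx expr1.
  rewrite big1 ?mulr1// => i ij; rewrite logn_prime//.
  by rewrite -val_eqE /= in ij; rewrite (negbTE ij) expr0.
apply: tpoly_sum => j; have [pj|_] := ifPn; last first.
  by under eq_fun do rewrite mul0r; exact: tpoly_cst.
have sj : smooth N j by apply: smooth_lt; rewrite ?prime_gt0.
have [l hl E] := tpoly_mono (1 : C) sj (@smooth1 N); exists l => // z.
by rewrite -E chi1 rmorph1 mulr1.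
Qed.

(** Moments as limits of grid averages, the form in which [bohr] delivers them. *)
Definition is_moment N (h : (nat -> C) -> C) (u l : R) := forall eps, 0 < eps ->
  exists M0, forall M, (M0 <= M)%N -> forall z, in_disc z ->
    `|tavg M N (fun w => normc (h w) `^ u) z - l| <= eps.

Let one : nat -> C := fun=> 1.
Let one_disc : in_disc one.
Proof. by move=> j; rewrite /one normc1. Qed.

(** Monotonicity of L^u norms in u: Jensen's inequality on the grid, passed to the limit. *)
Lemma moment_mono N h u s lu lv : 1 <= s -> 0 <= lu ->
  is_moment N h u lu -> is_moment N h (u * s) lv -> lu `^ s <= lv.
Proof.
move=> s1 lu0 hu hv; have s0 : 0 < s by lra.
pose L := s * (lu + 2) `^ (s - 1).
have L0 : 0 <= L by apply: mulr_ge0; [lra|exact: powR_ge0].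
apply/ler_addgt0Pr => e e0.
pose d := Num.min 1 (e / (L + 1)).
have L1 : 0 < L + 1 by lra.
have d0 : 0 < d by rewrite lt_min ltr01 divr_gt0.
have d1 : d <= 1 by rewrite ge_min lexx.
have dA : d * (L + 1) <= e by rewrite -ler_pdivlMr// ge_min lexx orbT.
have [M1 h1] := hu _ d0; have [M2 h2] := hv _ d0.
pose M := maxn (maxn M1 M2) 1.
have M0 : (0 < M)%N by exact: leq_maxr.
have := h1 M (leq_trans (leq_maxl _ _) (leq_maxl _ _)) _ one_disc.
have := h2 M (leq_trans (leq_maxr _ _) (leq_maxl _ _)) _ one_disc.
have J := @tavg_jensen R M N (fun w => normc (h w) `^ u) one s s1 M0 (fun w => powR_ge0 _ _).
have Tu0 : 0 <= tavg M N (fun w => normc (h w) `^ u) one.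
  by apply: tavg_ge0 => w; exact: powR_ge0.
rewrite (_ : tavg M N (fun w => (normc (h w) `^ u) `^ s) one =
    tavg M N (fun w => normc (h w) `^ (u * s)) one) in J; last first.
  by apply: eq_tavg => w; rewrite powRrM.
move: J Tu0; set Tu := tavg _ _ _ _; set Tv := tavg _ _ _ _ => J Tu0.
rewrite !ler_norml => /andP[a1 a2] /andP[b1 b2].
have [le|/ltW le] := leP lu Tu.
  have : lu `^ s <= Tu `^ s by apply: ge0_ler_powR; rewrite ?nnegrE ?(ltW s0).
  have : 0 <= d * L by rewrite mulr_ge0// ltW.
  by clearbody Tu Tv L d; lra.
have := @powR_lip _ s (lu + 2) lu Tu s1.
have -> : 0 <= lu <= lu + 2 by apply/andP; split; lra.
have -> : 0 <= Tu <= lu + 2 by apply/andP; split; lra.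
move=> /(_ isT isT) /(le_trans (ler_norm _)); rewrite -/L ger0_norm ?subr_ge0// => H.
have H2 : L * (lu - Tu) <= L * d by rewrite ler_wpM2l//; lra.
by move: dA H H2; clearbody Tu Tv L d; lra.
Qed.

Lemma psum_moment_bounds N k l : is_moment N (psum N) (2 * k)%:R l ->
  (k`! * npr N ^_ k)%:R <= l <= (k`! * npr N ^ k)%:R.
Proof.
move=> hl.
have H e : 0 < e -> (k`! * npr N ^_ k)%:R <= l + e /\ l <= (k`! * npr N ^ k)%:R + e.
  move=> e0; have [M0 hM] := hl e e0; pose M := maxn M0 k.+1.
  have := hM M (leq_maxl _ _) one one_disc.
  rewrite (@eq_tavg _ _ _ _ (fun w => normc (psum N w) ^+ (2 * k))); last first.
    by move=> w; rewrite powR_mulrn ?normc_ge0.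
  have /andP[] := @moment_bounds R M N k one (leq_maxr _ _).
  set T := tavg _ _ _ _ => b1 b2; rewrite ler_norml => /andP[a1 a2]; clearbody T.
  by split; lra.
by apply/andP; split; apply/ler_addgt0Pr => e /H [].
Qed.

(** The norms are moments of order m q and m p of the prime sum, which need not be even integers.
    Monotonicity in the order replaces them by 2k <= m q and 2k' >= m p, where [moment_bounds]
    applies. *)
Lemma Hnorm_lower (p q x : R) (y m k k' : nat) : 1 <= p -> p < q -> (2 <= m)%N ->
  (0 < k)%N -> (2 * k)%:R <= m%:R * q -> m%:R * p <= (2 * k')%:R ->
  (y ^ m <= Num.truncn x)%N -> (k <= npr y.+1)%N ->
  exists D, [/\ dirichlet_poly x D, exists s, D s != 0 &
    expR (m%:R / (2 * k)%:R * ln (k`! * npr y.+1 ^_ k)%:R -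
          m%:R / (2 * k')%:R * ln (k'`! * npr y.+1 ^ k')%:R) <= Hnorm q D / Hnorm p D].
Proof.
move=> p1 pq m2 k0 hk hk' hx kN; set N := y.+1 in kN *; set P := npr N in kN *.
have P0 : (0 < P)%N by exact: leq_trans kN.
have p0 : 0 < p by lra.
have q0 : 0 < q by lra.
have q1 : 1 <= q by lra.
have m0 : (0 < m)%N by exact: leq_trans m2.
have mR : 2 <= m%:R :> R by rewrite ler_nat.
have mR0 : 0 < m%:R :> R by rewrite ltr0n.
pose D s := primeS y s ^+ m.
have Dt (u : R) : 1 <= u -> exists l, is_moment N (psum N) (m%:R * u) l /\ 0 <= l /\ Hnorm u D = l `^ u^-1.
  move=> u1; have mu1 : 1 <= m%:R * u by apply: mulr_ege1 => //; lra.
  have [l [cl hl]] := bohr (psum_tpoly N) mu1.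
  exists l; split; [exact: hl|apply: (Hnorm_tmean u1)].
  congr (_ @ +oo --> l): cl; apply/funext => T; congr tmean; apply/funext => t.
  by rewrite /D primeS_vline normcX -powR_mulrn ?normc_ge0// -powRrM.
have [lq [mq [lq0 Eq]]] := Dt q q1; have [lp [mp [lp0 Ep]]] := Dt p p1.
have mom (j : nat) : (0 < j)%N -> exists l, is_moment N (psum N) (2 * j)%:R l /\
    (j`! * P ^_ j)%:R <= l <= (j`! * P ^ j)%:R.
  move=> j0; have j1 : 1 <= (2 * j)%:R :> R by rewrite ler1n muln_gt0.
  have [l [_ hl]] := bohr (psum_tpoly N) j1.
  by exists l; split => //; exact: psum_moment_bounds.
have mp0 : 0 < m%:R * p := mulr_gt0 mR0 p0.
have k'0 : (0 < k')%N.
  by rewrite lt0n; apply: contraTneq hk' => ->; rewrite muln0 -ltNge.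
have [lk [hlk /andP[lk1 _]]] := mom k k0.
have [lk' [hlk' /andP[_ lk'2]]] := mom k' k'0.
have [l1 [hl1 /andP[l11 _]]] := mom 1%N isT.
have kR : 0 < (2 * k)%:R :> R by rewrite ltr0n muln_gt0.
have k'R : 0 < (2 * k')%:R :> R by rewrite ltr0n muln_gt0.
have F1 : 0 < (k`! * P ^_ k)%:R :> R by rewrite ltr0n muln_gt0 fact_gt0 ffact_gt0.
have F2 : 0 < (k'`! * P ^ k')%:R :> R by rewrite ltr0n muln_gt0 fact_gt0 expn_gt0 P0.
have l1p : 0 < l1 by apply: lt_le_trans l11; rewrite ltr0n muln_gt0 fact_gt0 ffact_gt0.
have lkp : 0 < lk by apply: lt_le_trans lk1.
(* The second moment, at least P > 0, keeps the H_p norm away from 0; m >= 2 ensures m p >= 2. *)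
have Hq : l1 `^ (m%:R * p / 2) <= lp.
  apply: (@moment_mono N (psum N) (2 * 1)%:R _ l1 lp _ (ltW l1p) hl1).
    by rewrite ler_pdivlMr// mul1r -[leLHS]mulr1; apply: ler_pM.
  by rewrite (_ : (2 * 1)%:R * (m%:R * p / 2) = m%:R * p)//; field.
have lpp : 0 < lp by apply: lt_le_trans Hq; rewrite powR_gt0.
have Hk : lk `^ (m%:R * q / (2 * k)%:R) <= lq.
  apply: (@moment_mono N (psum N) (2 * k)%:R _ lk lq _ (ltW lkp) hlk).
    by rewrite ler_pdivlMr// mul1r.
  by rewrite mulrC divfK ?gt_eqF.
have Hk' : lp `^ ((2 * k')%:R / (m%:R * p)) <= lk'.
  apply: (@moment_mono N (psum N) (m%:R * p) _ lp lk' _ lp0 mp).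
    by rewrite ler_pdivlMr// mul1r.
  by rewrite mulrC divfK ?gt_eqF.
exists D; split.
- have [a ha] : dirN (Num.truncn x) D by apply: (dirN_le hx); exact: dirNX (primeS_dirN y).
  by exists a.
- exists 0; rewrite /D expf_eq0 m0 /=.
  have -> : primeS y 0 = P%:R.
    rewrite /primeS /P /npr natr_sum -(big_mkord prime (fun=> 1)) [RHS]big_ltn_cond//= [RHS]big_mkcond.
    apply: eq_big_nat => n /andP[n1 _]; rewrite natpowCE oppr0 /= !mul0r expR0 cis0 !mulr1.
    by case: ifP.
  by rewrite pnatr_eq0 -lt0n.
rewrite Eq Ep expRB; set A := m%:R / (2 * k)%:R; set B := m%:R / (2 * k')%:R.
have A0 : 0 <= A by rewrite divr_ge0 ?ler0n.
have B0 : 0 <= B by rewrite divr_ge0 ?ler0n.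
have EA : expR (A * ln (k`! * P ^_ k)%:R) <= lq `^ q^-1.
  rewrite mulrC expRM lnK ?posrE//.
  apply: (@le_trans _ _ ((lk `^ (m%:R * q / (2 * k)%:R)) `^ q^-1)).
    rewrite -powRrM (_ : _ / q = A); last by rewrite /A mulrAC mulfK ?gt_eqF.
    by apply: ge0_ler_powR; rewrite ?nnegrE ?(ltW F1) ?(ltW lkp).
  by apply: ge0_ler_powR; rewrite ?nnegrE ?powR_ge0 ?invr_ge0 ?(ltW q0).
have EB : lp `^ p^-1 <= expR (B * ln (k'`! * P ^ k')%:R).
  rewrite mulrC expRM lnK ?posrE//.
  have -> : lp `^ p^-1 = (lp `^ ((2 * k')%:R / (m%:R * p))) `^ B.
    have E (a b c : R) : a != 0 -> b != 0 -> c != 0 -> c^-1 = a / (b * c) * (b / a).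
      by move=> *; field; apply/and3P.
    by rewrite -powRrM -E ?gt_eqF.
  apply: ge0_ler_powR; rewrite ?nnegrE ?powR_ge0 ?(ltW F2)//.
  exact: le_trans Hk' lk'2.
apply: ler_pM; rewrite ?expR_ge0 ?invr_ge0 ?expR_ge0//.
by rewrite lef_pV2 ?posrE ?expR_gt0 ?powR_gt0.
Qed.

End Lower.

(** * Chebyshev's lower bound on the number of primes, and Stirling's bounds *)

Section Chebyshev.

(* Legendre's formula: each of the trunc_log p (2n) powers p^i <= 2n contributes 0 or 1. *)
Lemma logn_central_bin_le p n : prime p -> (0 < n)%N ->
  (logn p 'C(n.*2, n) <= trunc_log p n.*2)%N.
Proof.
move=> pp n0; set T := trunc_log p n.*2.
have p1 := prime_gt1 pp.
have n2 : (n <= n.*2)%N by rewrite -addnn leq_addr.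
have E : (logn p 'C(n.*2, n) + (logn p n`!).*2 = logn p (n.*2)`!)%N.
  have := bin_fact n2; rewrite -{2}addnn addnK => <-.
  by rewrite !lognM ?bin_gt0 ?muln_gt0 ?fact_gt0// addnn.
have F : logn p n`! = (\sum_(1 <= k < n.*2.+1) n %/ p ^ k)%N.
  rewrite logn_fact// (@big_cat_nat _ _ _ n.+1 1 n.*2.+1)//=.
  rewrite [X in _ = (_ + X)%N]big_nat [X in _ = (_ + X)%N]big1 ?addn0// => k /andP[nk _].
  by rewrite divn_small// (ltn_trans nk)// ltn_expl.
have G : (logn p (n.*2)`! <= (logn p n`!).*2 + T)%N.
  rewrite [in X in (X <= _)%N]logn_fact// F -[X in (_ <= X + _)%N]mul2n big_distrr /=.
  have -> : T = (\sum_(1 <= k < n.*2.+1) (k <= T))%N.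
    have Tn : (T <= n.*2)%N.
      rewrite -ltnS (leq_trans (ltn_expl T p1))// (leq_trans _ (leqnSn _))//.
      by apply: trunc_logP => //; rewrite double_gt0.
    rewrite (@big_cat_nat _ _ _ T.+1 1 n.*2.+1)//=.
    rewrite (eq_big_nat _ _ (F2 := fun=> 1%N)); last first.
      by move=> k /andP[_]; rewrite ltnS => ->.
    rewrite sum_nat_const_nat subn1 muln1 [X in _ = (_ + X)%N]big_nat [X in _ = (_ + X)%N]big1 ?addn0//.
    by move=> k /andP[Tk _]; rewrite leqNgt Tk.
  rewrite -big_split /= leq_sum// => k _; have [kT|Tk] := leqP k T.
    have pk : (0 < p ^ k)%N by rewrite expn_gt0 prime_gt0.
    rewrite -ltnS ltn_divLR// -muln2 {1}(divn_eq n (p ^ k)).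
    have -> : (2 * (n %/ p ^ k)%N + true).+1 = ((n %/ p ^ k)%N * 2 + 2)%N by rewrite mulnC addn1 addn2.
    rewrite mulnDl [ltnRHS]mulnDl mulnAC ltn_add2l.
    by rewrite mulnC ltn_mul2l ltn_mod.
  rewrite divn_small// (leq_trans (trunc_log_ltn _ p1))//.
  by rewrite leq_exp2l.
by move: E G; set a := logn _ _; set b := logn _ _; set c := logn _ _ => <-; rewrite addnC leq_add2l.
Qed.

Lemma central_bin_ge n : (2 ^ n <= 'C(n.*2, n))%N.
Proof.
elim: n => // n IH; rewrite doubleS binS expnS mul2n -addnn.
have H : ('C(n.*2, n) <= 'C(n.*2.+1, n))%N.
  by case: n {IH} => // n; rewrite binS leq_addr.
have -> : 'C(n.*2.+1, n.+1) = 'C(n.*2.+1, n).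
  by rewrite -bin_sub -addnn ?ltnS ?leq_addr// subSS addnK.
by apply: leq_add; exact: leq_trans H.
Qed.

(** Every full prime power dividing the binomial is at most 2n, and so is every prime involved. *)
Lemma central_bin_le n : (0 < n)%N -> ('C(n.*2, n) <= n.*2 ^ npr n.*2.+1)%N.
Proof.
move=> n0; have n2 : (n <= n.*2)%N by rewrite -addnn leq_addr.
have C0 : (0 < 'C(n.*2, n))%N by rewrite bin_gt0.
have H p : prime p -> (p ^ logn p 'C(n.*2, n) <= n.*2)%N.
  move=> pp; apply: (@leq_trans (p ^ trunc_log p n.*2)).
    by rewrite leq_exp2l ?prime_gt1// logn_central_bin_le.
  by apply: trunc_logP; rewrite ?prime_gt1 ?double_gt0.
rewrite [leqLHS](prod_prime_decomp C0) prime_decompE big_map /=.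
apply: (@leq_trans (\prod_(p <- primes 'C(n.*2, n)) n.*2)).
  by rewrite !big_seq; apply: leq_prod => p; rewrite mem_primes => /andP[pp _]; exact: H.
rewrite big_const_seq count_predT iter_muln_1 leq_exp2l; last by rewrite -(doubleS 0) leq_double.
rewrite /npr -(big_mkord prime (fun=> 1%N)) -big_filter sum1_size.
rewrite uniq_leq_size ?primes_uniq// => p; rewrite mem_filter mem_primes.
move=> /and3P[pp _ pC]; rewrite pp mem_index_iota ltnS /=.
by rewrite (leq_trans _ (H p pp))// -[leqLHS]expn1 leq_exp2l ?prime_gt1// logn_gt0 mem_primes pp C0.
Qed.

(** Chebyshev's bound, by taking logarithms in 2^n <= C(2n, n) <= (2n)^pi(2n). *)
Lemma npr_ge (R : realType) n : (0 < n)%N ->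
  n%:R * ln 2 <= (npr n.*2.+1)%:R * ln n.*2%:R :> R.
Proof.
move=> n0; have n2 : (0 < n.*2)%N by rewrite double_gt0.
have H := leq_trans (central_bin_ge n) (central_bin_le n0).
rewrite !mulr_natl -!lnXn ?ltr0n// ler_ln ?posrE ?exprn_gt0 ?ltr0n//.
by rewrite -!natrX ler_nat.
Qed.

Lemma ln_fact_ge (R : realType) k : k%:R * ln k%:R - k%:R <= ln k`!%:R :> R.
Proof.
elim: k => [|k IH]; first by rewrite mul0r subr0 fact0 ln1.
rewrite factS natrM lnM ?posrE ?ltr0n ?fact_gt0//.
have [->|k0] := posnP k; first by rewrite fact0 ln1; lra.
have kR : 0 < k%:R :> R by rewrite ltr0n.
have : ln (1 + k%:R^-1) <= k%:R^-1 :> R.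
  by apply: le_ln1Dx; apply: (@lt_trans _ _ 0); rewrite ?invr_gt0// ltrN10.
have -> : 1 + k%:R^-1 = k.+1%:R / k%:R :> R by rewrite -natr1; field; rewrite gt_eqF.
rewrite ln_div ?posrE ?ltr0n// -(ler_pM2l kR) divff ?gt_eqF// -[k.+1%:R]natr1.
by move: IH; set a := ln _; set b := ln _; lra.
Qed.

Lemma ln_fact_le (R : realType) k : (0 < k)%N ->
  ln k`!%:R <= k%:R * ln k%:R - k%:R + ln k%:R + 1 :> R.
Proof.
case: k => // k _; elim: k => [|k IH]; first by rewrite ln1; lra.
rewrite factS natrM lnM ?posrE ?ltr0n ?fact_gt0//.
have kR : 0 < k.+1%:R :> R by rewrite ltr0n.
have kR2 : 0 < k.+2%:R :> R by rewrite ltr0n.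
have : ln (1 + - k.+2%:R^-1) <= - k.+2%:R^-1 :> R.
  by apply: le_ln1Dx; rewrite ltrN2 invf_lt1// ltr1n.
have -> : 1 + - k.+2%:R^-1 = k.+1%:R / k.+2%:R :> R by rewrite -[k.+2%:R]natr1; field; apply/lt0r_neq0; lra.
rewrite ln_div ?posrE// -(ler_pM2l kR2) mulrN divff ?gt_eqF// -[k.+2%:R]natr1.
by move: IH; set a := ln _; set b := ln _; lra.
Qed.

End Chebyshev.

Lemma Hnorm_ge0 (R : realType) (p x : R) D : 1 <= p -> dirichlet_poly x D -> 0 <= Hnorm p D.
Proof.
move=> p1 /dirichlet_hdir[a ha].
have [l [cl _]] := bohr (hdir_tpoly a (ltnSn (Num.truncn x))) p1.
have E : (fun T => tmean T (fun t => normc (D (t *i)%C) `^ p)) =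
    (fun T => tmean T (fun t => normc (hdir (Num.truncn x).+1 a (Num.truncn x) (vline t)) `^ p)).
  by apply/funext => T; congr tmean; apply/funext => t; rewrite ha.
rewrite -E in cl.
by have [_ ->] := Hnorm_tmean p1 cl; exact: powR_ge0.
Qed.

(** * Asymptotics *)

Section Asymptotics.
Variables (R : realType) (p q x L1 L2 L3 : R).
Hypotheses (p1 : 1 <= p) (pq : p < q).
Hypotheses (xE : x = expR L1) (L1E : L1 = expR L2) (L2E : L2 = expR L3).
Hypotheses (L31 : 1 <= L3) (L32 : 6 * L3 <= L2).
Let c := ln (q / p) / 2.

Let c0 : 0 <= c.
Proof.
have p0 : 0 < p := lt_le_trans ltr01 p1.
by rewrite divr_ge0// ln_ge0// ler_pdivlMr// mul1r ltW.
Qed.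

Let L20 : 6 <= L2. Proof. by apply: le_trans L32; rewrite -[leLHS]mulr1 ler_wpM2l. Qed.

Let L1L2 : L2 ^+ 4 <= L1.
Proof.
have := L31; have := L32 => h1 h2.
by rewrite L1E [in X in X ^+ _]L2E -expRM_natl ler_expR; lra.
Qed.

Let lnL1 : ln L1 = L2. Proof. by rewrite L1E expRK. Qed.
Let lnL2 : ln L2 = L3. Proof. by rewrite L2E expRK. Qed.

Lemma ln2_ge : 1 / 2 <= ln 2 :> R.
Proof.
have : ln (1 + - (1 / 2)) <= - (1 / 2) :> R by apply: le_ln1Dx; lra.
have -> : 1 + - (1 / 2) = 2^-1 :> R by field.
by rewrite lnV ?posrE//; lra.
Qed.

(** As 6 L3 <= L2, the bound ln (Y + 1) >= L2 - 3 L3 gives 1 / ln (Y + 1) <= 1 / L2 + 6 L3 / L2^2,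
    hence 6 c. The other 6 is 3 times 2: Y + 2 <= 3 L1 / L2^3, and ln B <= 2 L2 for the number B of
    possible exponents. *)
Lemma Hnorm_upper_asymp D : dirichlet_poly x D ->
  Hnorm q D <= expR (L1 / L2 * (c + (6 * c + 6) * (L3 / L2))) * Hnorm p D.
Proof.
move=> hD; have h31 := L31; have h32 := L32; have h20 := L20.
have L10 : 0 < L1 by rewrite L1E expR_gt0.
have L2p : 0 < L2 by lra.
have L23 : 0 < L2 ^+ 3 by rewrite exprn_gt0.
have x1 : 1 <= x by rewrite xE -expR0 ler_expR ltW.
have a1 : 1 <= L1 / L2 ^+ 3.
  rewrite ler_pdivlMr// mul1r (le_trans _ L1L2)// ler_weXn2l//; lra.
set a := L1 / L2 ^+ 3 in a1.
have a0 : 0 <= a by lra.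
pose Y := Num.truncn a.
have Y0 : (0 < Y)%N by rewrite truncn_gt0.
have Yle : Y%:R <= a by rewrite truncn_le.
have Ylt : a < Y.+1%:R by exact: truncnS_gt.
have lnY : L2 - 3 * L3 <= ln Y.+1%:R.
  have -> : L2 - 3 * L3 = ln a.
    by rewrite /a ln_div ?posrE// lnXn// lnL1 lnL2; ring.
  by rewrite ler_ln ?posrE ?ltr0n// ?(ltW Ylt)//; lra.
have hn : 0 <= Hnorm p D by exact: Hnorm_ge0 hD.
apply: le_trans (Hnorm_upper p1 pq x1 hD Y0) _; apply: ler_wpM2r => //.
set B := (trunc_log 2 _).+1.
have lnB : ln B%:R <= 2 * L2.
  have B3 : B%:R <= 3 * L1.
    have : (2 ^ (trunc_log 2 (Num.truncn x)))%:R <= x :> R.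
      apply: (@le_trans _ _ (Num.truncn x)%:R); last by rewrite truncn_le; lra.
      by rewrite ler_nat trunc_logP// truncn_gt0.
    rewrite natrX -ler_ln ?posrE ?exprn_gt0//; last by lra.
    rewrite lnXn// -[ln _ *+ _]mulr_natl /B -natr1 xE expRK.
    set t := (trunc_log _ _)%:R => h3; have h2 := ln2_ge.
    have t0 : 0 <= t by exact: ler0n.
    have : t * (1 / 2) <= t * ln 2 by rewrite ler_wpM2l.
    have : L2 <= L1.
      apply: le_trans L1L2; rewrite -[leLHS]expr1 ler_weXn2l//; lra.
    lra.
  apply: (@le_trans _ _ (ln (3 * L1))).
    by rewrite ler_ln ?posrE ?ltr0n// mulr_gt0.
  rewrite lnM ?posrE// lnL1.
  have : ln (1 + 2) <= 2 :> R by apply: le_ln1Dx; lra.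
  by rewrite (_ : 1 + 2 = 3)//; lra.
rewrite natrX -[X in X ^+ _]lnK ?posrE ?ltr0n// -expRM_natl -expRD ler_expR.
have E1 : c * (ln x / ln Y.+1%:R) <= L1 / L2 * (c + 6 * c * (L3 / L2)).
  have d0 : 0 < L2 - 3 * L3 by lra.
  rewrite xE expRK.
  apply: (@le_trans _ _ (c * (L1 / (L2 - 3 * L3)))).
    apply: ler_wpM2l => //; apply: ler_wpM2l; first exact: ltW.
    by rewrite lef_pV2 ?posrE//; lra.
  have -> : L1 / L2 * (c + 6 * c * (L3 / L2)) = c * (L1 * (1 / L2 + 6 * L3 / L2 ^+ 2)).
    by field; lra.
  apply: ler_wpM2l => //; apply: ler_wpM2l; first exact: ltW.
  rewrite -[leLHS]mul1r ler_pdivrMr//.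
  have -> : (1 / L2 + 6 * L3 / L2 ^+ 2) * (L2 - 3 * L3) = 1 + 3 * L3 * (L2 - 6 * L3) / L2 ^+ 2.
    by field; lra.
  rewrite lerDl divr_ge0 ?exprn_ge0 ?mulr_ge0 ?subr_ge0//; lra.
have E2 : Y.+2%:R * ln B%:R <= L1 / L2 * (6 * (L3 / L2)).
  apply: (@le_trans _ _ ((3 * a) * (2 * L2))).
    apply: ler_pM => //; rewrite ?ln_ge0 ?ler1n//.
    by rewrite -!natr1; lra.
  have -> : 3 * a * (2 * L2) = L1 / L2 * (6 * (1 / L2)) by rewrite /a; field; lra.
  apply: ler_wpM2l; first by rewrite divr_ge0; lra.
  by apply: ler_wpM2l => //; apply: ler_wpM2r => //; rewrite invr_ge0; lra.
rewrite (_ : _ * (c + _) = L1 / L2 * (6 * (L3 / L2)) + L1 / L2 * (c + 6 * c * (L3 / L2))); last by ring.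
exact: lerD.
Qed.

End Asymptotics.

(** Every factor is at least N - k, and ln (N - k) >= ln N - 2 k / N because k <= N / 2. *)
Lemma ln_ffact_ge (R : realType) (N k : nat) : (k.*2 <= N)%N -> (0 < N)%N ->
  k%:R * (ln N%:R - 2 * (k%:R / N%:R)) <= ln (N ^_ k)%:R :> R.
Proof.
move=> kN N0; have NR : 0 < N%:R :> R by rewrite ltr0n.
have kN' : (k <= N)%N by rewrite (leq_trans _ kN)// -addnn leq_addr.
have d0 : (0 < N - k)%N.
  rewrite subn_gt0 ltn_neqAle kN' andbT; apply: contraTneq kN => ->.
  by rewrite -ltnNge -addnn -[X in (X < _)%N]addn0 ltn_add2l.
apply: (@le_trans _ _ (k%:R * ln (N - k)%:R)).
  apply: ler_wpM2l => //; rewrite natrB//.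
  have dR : 0 < N%:R - k%:R :> R by rewrite -natrB// ltr0n.
  have : ln (1 + k%:R / (N%:R - k%:R)) <= k%:R / (N%:R - k%:R) :> R.
    by apply: le_ln1Dx; rewrite (@lt_le_trans _ _ 0)// divr_ge0// ltW.
  have -> : 1 + k%:R / (N%:R - k%:R) = N%:R / (N%:R - k%:R) :> R by field; rewrite gt_eqF.
  rewrite ln_div ?posrE//.
  have : k%:R / (N%:R - k%:R) <= 2 * (k%:R / N%:R) :> R.
    rewrite mulrCA ler_wpM2l// -[leLHS]mul1r ler_pdivrMr// mulrAC ler_pdivlMr// mul1r.
    have : (k.*2)%:R <= N%:R :> R by rewrite ler_nat.
    by rewrite -mul2n natrM; lra.
  by set a := ln _; set b := ln _; lra.
rewrite mulr_natl -lnXn ?ltr0n// ler_ln ?posrE ?exprn_gt0 ?ltr0n ?ffact_gt0// -natrX ler_nat.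
suff H j : (j <= k)%N -> ((N - k) ^ j <= N ^_ j)%N by exact: H.
elim: j => // j IH jk; rewrite expnS ffactnSr mulnC.
by apply: leq_mul; [exact: IH (ltnW jk)|exact: leq_sub2l (ltnW jk)].
Qed.

(** By Stirling the two logarithms, divided by k and k', are close to ln k - 1 + ln N and ln k' - 1
    + ln N; the difference ln k - ln k' is nearly ln (q / p). The errors are 6 / m for rounding m q
    / 2 and m p / 2, (ln k' + 1) / k' from k'!, and 2 k / N from the falling factorial. *)
Lemma lower_exponent (R : realType) (p q : R) (m k k' N : nat) : 1 <= p -> 1 <= q ->
  (4 <= m)%N -> k = Num.truncn (m%:R * q / 2) -> k' = (Num.truncn (m%:R * p / 2)).+1 ->
  (k.*2 <= N)%N -> (0 < N)%N ->
  m%:R / 2 * (ln (q / p) - 6 / m%:R - (ln k'%:R + 1) / k'%:R - 2 * (k%:R / N%:R)) <=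
  m%:R / (2 * k)%:R * ln (k`! * N ^_ k)%:R -
  m%:R / (2 * k')%:R * ln (k'`! * N ^ k')%:R :> R.
Proof.
move=> p1 q1 m4 kE k'E kN N0.
have mR : 4 <= m%:R :> R by rewrite (ler_nat _ 4).
have m0 : 0 < m%:R :> R by lra.
have NR : 0 < N%:R :> R by rewrite ltr0n.
have mq : 4 <= m%:R * q by rewrite -[leLHS]mulr1 ler_pM.
have mp : 4 <= m%:R * p by rewrite -[leLHS]mulr1 ler_pM.
have k1 : m%:R * q / 2 - 1 <= k%:R.
  have := truncnS_gt (m%:R * q / 2); rewrite -kE -natr1; lra.
have k'1 : k'%:R <= m%:R * p / 2 + 1.
  by rewrite k'E -natr1 lerD2r truncn_le; lra.
have kR : 0 < k%:R :> R by lra.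
have k0 : (0 < k)%N by rewrite -(ltr0n R).
have k'0 : (0 < k')%N by rewrite k'E.
have k'R : 0 < k'%:R :> R by rewrite ltr0n.
have kN' : (k <= N)%N by rewrite (leq_trans _ kN)// -addnn leq_addr.
have A : k%:R * (ln k%:R - 1 + ln N%:R - 2 * (k%:R / N%:R)) <= ln (k`! * N ^_ k)%:R :> R.
  rewrite natrM lnM ?posrE ?ltr0n ?fact_gt0 ?ffact_gt0//.
  have := ln_fact_ge R k; have := ln_ffact_ge R kN N0.
  by set a := ln _; set b := ln _; set d := ln _; set e := ln _; lra.
have B : ln (k'`! * N ^ k')%:R <= k'%:R * (ln k'%:R - 1 + (ln k'%:R + 1) / k'%:R + ln N%:R) :> R.
  rewrite natrM lnM ?posrE ?ltr0n ?fact_gt0 ?expn_gt0 ?N0// natrX lnXn//.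
  have := ln_fact_le R k'0; rewrite -[ln N%:R *+ _]mulr_natl.
  rewrite 2!mulrDr [k'%:R * (_ / _)]mulrCA divff ?gt_eqF// mulr1.
  by set a := ln _; set b := ln _; set d := ln _; lra.
have Lg : ln (q / p) - 6 / m%:R <= ln k%:R - ln k'%:R.
  clear -p1 q1 m0 mR mq mp k1 k'1 kR k'R.
  have E1 : ln (1 + (m%:R * q - 2 * k%:R) / (2 * k%:R)) <= (m%:R * q - 2 * k%:R) / (2 * k%:R).
    apply: le_ln1Dx.
    have -> : (m%:R * q - 2 * k%:R) / (2 * k%:R) = m%:R * q / (2 * k%:R) - 1.
      by field; rewrite gt_eqF.
    by rewrite ltrDr divr_gt0//; lra.
  have E2 : ln (1 + 2 / (m%:R * p)) <= 2 / (m%:R * p).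
    by apply: le_ln1Dx; rewrite (@lt_le_trans _ _ 0)// divr_ge0//; lra.
  have E3 : (m%:R * q - 2 * k%:R) / (2 * k%:R) <= 4 / m%:R.
    rewrite ler_pdivrMr ?mulr_gt0// mulrAC ler_pdivlMr//.
    have hq : m%:R <= m%:R * q by rewrite ler_peMr// ltW.
    have h2 : m%:R * q - 2 * k%:R <= 2 by lra.
    by have := ler_wpM2r (ltW m0) h2; lra.
  have E4 : 2 / (m%:R * p) <= 2 / m%:R.
    by rewrite ler_wpM2l// lef_pV2 ?posrE ?mulr_gt0//; [rewrite ler_peMr// ltW|lra].
  have E5 : ln k'%:R <= ln (m%:R * p / 2 * (1 + 2 / (m%:R * p))).
    rewrite ler_ln ?posrE//; last by rewrite mulr_gt0// ?addr_gt0// divr_gt0//; lra.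
    by rewrite (_ : _ * _ = m%:R * p / 2 + 1)//; field; apply/andP; split; lra.
  move: E1 E5.
  have -> : 1 + (m%:R * q - 2 * k%:R) / (2 * k%:R) = m%:R * q / 2 / k%:R.
    by field; rewrite gt_eqF.
  have dp : 0 < 2 / (m%:R * p) by rewrite divr_gt0//; lra.
  rewrite !(lnM, ln_div) ?posrE ?divr_gt0 ?mulr_gt0 ?invr_gt0 ?addr_gt0//; try lra.
  by rewrite !lnV ?posrE//; lra.
apply: (@le_trans _ _ (m%:R / 2 * (ln k%:R - 1 + ln N%:R - 2 * (k%:R / N%:R)) -
   m%:R / 2 * (ln k'%:R - 1 + (ln k'%:R + 1) / k'%:R + ln N%:R))).
  rewrite -mulrBr ler_wpM2l ?divr_ge0//.
  by move: Lg; set a := ln _; set b := ln _; set d := ln _; set e := _ / _; set f := _ / _; lra.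
have G (j : nat) (z : R) : 0 < j%:R :> R -> m%:R / (2 * j)%:R * (j%:R * z) = m%:R / 2 * z.
  by move=> j0; rewrite natrM; field; rewrite gt_eqF.
apply: lerB.
  by have := ler_wpM2l (divr_ge0 (ltW m0) (ler0n R (2 * k))) A; rewrite G.
by have := ler_wpM2l (divr_ge0 (ltW m0) (ler0n R (2 * k'))) B; rewrite G.
Qed.

(** With y = 2n about 2 L1 L2^2 one has ln y <= L2 + 3 L3, and m is the largest exponent with y^m <=
    x. By Chebyshev pi (y) is at least L1 L2 / 8, larger than m by a factor of order L2^2, so that
    falling factorials are close to powers. *)
Lemma lower_params (R : realType) (L1 L2 L3 : R) :
  L1 = expR L2 -> L2 = expR L3 -> 1 <= L3 -> 6 * L3 <= L2 ->
  exists n m, [/\ (0 < n)%N, (n.*2 ^ m <= Num.truncn (expR L1))%N,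
    L1 / L2 * (1 - 3 * (L3 / L2)) - 1 <= m%:R, m%:R <= L1 / L2 &
    L1 * L2 / 8 <= (npr n.*2.+1)%:R].
Proof.
move=> L1E L2E L31 L32.
have L2p : 0 < L2 by lra.
have L1p : 0 < L1 by rewrite L1E expR_gt0.
have L1L2 : L2 <= L1 by rewrite L1E (le_trans _ (expR_ge1Dx L2))//; lra.
pose a := L1 * L2 ^+ 2.
have L22 : 1 <= L2 ^+ 2 by rewrite expr_ge1//; lra.
have aL1 : L1 <= a by rewrite /a ler_peMr// ltW.
have a6 : 6 <= a by lra.
pose n := Num.truncn a.
have n0 : (0 < n)%N by rewrite truncn_gt0; lra.
have n1 : n%:R <= a by rewrite truncn_le; lra.
have n2 : a < n%:R + 1 by rewrite natr1 truncnS_gt.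
have N2 : n.*2%:R = 2 * n%:R :> R by rewrite -mul2n natrM.
have nR : 0 < n.*2%:R :> R by rewrite N2; lra.
pose l := ln n.*2%:R : R.
have lge : L2 <= l.
  by rewrite /l -[L2]expRK -L1E ler_ln ?posrE// N2; lra.
have l0 : 0 < l by lra.
have ll : l <= L2 + 3 * L3.
  apply: (@le_trans _ _ (ln (2 * a))).
    by rewrite ler_ln ?posrE//; [rewrite N2; lra|lra].
  rewrite /a !lnM ?posrE ?mulr_gt0 ?exprn_gt0//.
  have := @le_ln1Dx R 1; rewrite [in ln L1]L1E [in ln L2]L2E !expRK.
  by move=> /(_ (lt_trans (ltrN10 R) ltr01)); rewrite (_ : 1 + 1 = 2)//; lra.
pose m := Num.truncn (L1 / l).
have L1l : 0 <= L1 / l by rewrite divr_ge0// ltW.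
have m1 : m%:R <= L1 / l by rewrite truncn_le.
exists n, m; split => //.
- rewrite truncn_ge_nat ?expR_ge0// natrX -ler_ln ?posrE ?exprn_gt0 ?expR_gt0//.
  by rewrite expRK lnXn// -[_ *+ m]mulr_natl -ler_pdivlMr.
- have := truncnS_gt (L1 / l); rewrite -/m -natr1.
  have : L1 / L2 * (1 - 3 * (L3 / L2)) <= L1 / l.
    rewrite ler_pdivlMr//.
    have t : 0 <= 1 - 3 * (L3 / L2).
      have -> : 1 - 3 * (L3 / L2) = (L2 - 3 * L3) / L2 by field; lra.
      by rewrite divr_ge0//; lra.
    apply: (@le_trans _ _ (L1 / L2 * (1 - 3 * (L3 / L2)) * (L2 + 3 * L3))).
      by rewrite ler_wpM2l// mulr_ge0// divr_ge0// ltW.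
    have -> : L1 / L2 * (1 - 3 * (L3 / L2)) * (L2 + 3 * L3) = L1 * (1 - (3 * (L3 / L2)) ^+ 2).
      by field; lra.
    by rewrite ler_piMr ?(ltW L1p)// gerBl sqr_ge0.
  by lra.
- apply: le_trans m1 _; apply: ler_wpM2l; first exact: ltW.
  by rewrite lef_pV2.
have := npr_ge R n0; rewrite -/l; have := ln2_ge R.
set P := (npr _)%:R => h2 h3.
have P0 : 0 <= P by exact: ler0n.
have h4 : n%:R * (1 / 2) <= n%:R * ln 2 :> R by rewrite ler_wpM2l.
have h5 : P * l <= P * (2 * L2) by rewrite ler_wpM2l//; lra.
have h6 : L1 * L2 / 8 * (2 * L2) <= P * (2 * L2).
  rewrite (_ : L1 * L2 / 8 * (2 * L2) = a / 4); last by rewrite /a; field.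
  by lra.
by rewrite -(@ler_pM2r _ (2 * L2))// mulr_gt0.
Qed.

(** The constant 24 + 4 q is half of 24 + 24 + 8 q, which bound the rounding, Stirling and falling
    factorial errors of [lower_exponent]. The term 2 ln (q / p) pays for m falling short of L1 / L2:
    3/2 from the factor 1 - 3 L3 / L2, and 1/2 from the integer part. *)
Lemma Hnorm_lower_asymp (R : realType) (p q x L1 L2 L3 : R) : 1 <= p -> p < q ->
  x = expR L1 -> L1 = expR L2 -> L2 = expR L3 -> 1 <= L3 -> 6 * L3 <= L2 -> 8 * q <= L2 ->
  exists D, [/\ dirichlet_poly x D, exists s, D s != 0 &
    expR (L1 / L2 * (ln (q / p) / 2 - (2 * ln (q / p) + 24 + 4 * q) * (L3 / L2))) <=
    Hnorm q D / Hnorm p D].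
Proof.
move=> p1 pq xE L1E L2E L31 L32 qL2.
have [n [m [n0 nm m1 m2 hP]]] := lower_params L1E L2E L31 L32.
move: nm; rewrite -xE => nm; set N := npr n.*2.+1 in hP.
have p0 : 0 < p by lra.
have q1 : 1 <= q by lra.
have L2p : 8 <= L2 by lra.
have L2p0 : 0 < L2 by lra.
have L1L2 : L2 ^+ 4 <= L1 by rewrite L1E [in X in X ^+ _]L2E -expRM_natl ler_expR; lra.
have L13 : L2 ^+ 3 <= L1 / L2 by rewrite ler_pdivlMr// -exprSr.
set U := L1 / L2 in m1 m2 L13 *.
have L22 : 8 * L2 ^+ 2 <= L2 ^+ 3 by rewrite [leRHS]exprS ler_wpM2r ?exprn_ge0//; lra.
have L28 : 8 * L2 <= L2 ^+ 2 by rewrite expr2 ler_wpM2r//; lra.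
have U64 : 64 <= U by lra.
have L1U : L1 = U * L2 by rewrite /U; field; lra.
have L2L23 : L2 <= L2 ^+ 3 by lra.
have U0 : 0 <= U by lra.
have q0 : 0 <= q by lra.
have L20 : 0 <= L2 by lra.
have L21 : 1 <= L2 by lra.
have L30 : 0 <= L3 by lra.
clearbody U; clear L1L2.
have L3r : 3 * (L3 / L2) <= 1 / 2.
  by rewrite mulrA ler_pdivrMr//; lra.
have m3 : U / 4 <= m%:R.
  have : U * (1 / 2) <= U * (1 - 3 * (L3 / L2)) by rewrite ler_wpM2l//; lra.
  by lra.
have mR : 0 < m%:R :> R by lra.
have m4 : (4 <= m)%N by rewrite -(ler_nat R); lra.
have [k kE] : exists k, k = Num.truncn (m%:R * q / 2) by eexists.
have [k' k'E] : exists k', k' = (Num.truncn (m%:R * p / 2)).+1 by eexists.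
have mq : m%:R <= m%:R * q by rewrite ler_peMr// ltW.
have mp : m%:R <= m%:R * p by rewrite ler_peMr// ltW.
have kle : k%:R <= m%:R * q / 2 by rewrite kE truncn_le; lra.
have k'lt : m%:R * p / 2 < k'%:R by rewrite k'E; exact: truncnS_gt.
have k'le : k'%:R <= m%:R * p / 2 + 1 by rewrite k'E -natr1 lerD2r truncn_le; lra.
have Uq : k%:R <= U * q / 2.
  have : m%:R * q <= U * q by rewrite ler_wpM2r.
  by lra.
have N1 : U * L2 ^+ 2 / 8 <= N%:R by rewrite expr2 mulrA -L1U.
clear hP.
have UL2 : U * (8 * q) * 8 <= U * L2 ^+ 2.
  by rewrite expr2 -mulrA ler_wpM2l// ler_pM// mulr_ge0.
have NR : 0 < N%:R :> R.
  by apply: lt_le_trans N1; rewrite divr_gt0// mulr_gt0 ?exprn_gt0// (lt_le_trans _ U64).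
have kN : (k.*2 <= N)%N by rewrite -(ler_nat R) -mul2n natrM; lra.
have k0 : (0 < k)%N by rewrite kE truncn_gt0; lra.
have kN' : (k <= N)%N by rewrite (leq_trans _ kN)// -addnn leq_addr.
have N0 : (0 < N)%N by exact: leq_trans kN'.
have H1 : (2 * k)%:R <= m%:R * q by rewrite natrM mulrC -ler_pdivlMr.
have H2 : m%:R * p <= (2 * k')%:R by rewrite natrM [leRHS]mulrC -ler_pdivrMr// ltW.
have [D [hD D0 hDle]] := Hnorm_lower p1 pq (leq_trans (isT : (2 <= 4)%N) m4) k0 H1 H2 nm kN'.
exists D; split => //; apply: le_trans hDle; rewrite ler_expR.
apply: le_trans (lower_exponent p1 q1 m4 kE k'E kN N0).
set c := ln (q / p).
have c0 : 0 <= c by rewrite ln_ge0// ler_pdivlMr// mul1r ltW.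
have V0 : 0 < L2^-1 by rewrite invr_gt0.
have e1 : 6 / m%:R <= 24 / L2.
  rewrite ler_pdivrMr// mulrAC ler_pdivlMr//.
  by lra.
have e2 : (ln k'%:R + 1) / k'%:R <= 24 / L2.
  have k'R : 0 < k'%:R :> R by rewrite k'E ltr0n.
  clear -L1E L2E L1U L22 L20 L21 L2p L2p0 L13 U0 U64 m2 m3 mR k'R k'le k'lt mp p1 p0 pq qL2 L32 L31.
  have lk : ln k'%:R <= 2 * L2.
    apply: (@le_trans _ _ (ln (L1 * L2))).
      rewrite ler_ln ?posrE ?mulr_gt0//; last by rewrite L1E expR_gt0.
      rewrite L1U.
      have pL2 : p <= L2 by lra.
      have : m%:R * p <= U * L2 by apply: ler_pM => //; exact: ltW.
      have : U * 1 <= U * L2 * L2.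
        by rewrite -mulrA ler_wpM2l// -expr2 expr_ge1.
      have : U * L2 * 8 <= U * L2 * L2 by rewrite ler_wpM2l// mulr_ge0.
      by lra.
    rewrite lnM ?posrE//; last by rewrite L1E expR_gt0.
    by rewrite [in ln L1]L1E [in ln L2]L2E !expRK; lra.
  rewrite ler_pdivrMr// mulrAC ler_pdivlMr//.
  have lk3 : ln k'%:R + 1 <= 3 * L2 by lra.
  have : (ln k'%:R + 1) * L2 <= (3 * L2) * L2 by rewrite ler_wpM2r.
  by lra.
have e3 : 2 * (k%:R / N%:R) <= 8 * q / L2.
  clear -L2p L2p0 L20 U0 U64 q0 q1 Uq N1 NR.
  rewrite mulrA ler_pdivrMr// mulrAC ler_pdivlMr//.
  have : U * q * L2 <= U * q * L2 ^+ 2 / 8.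
    have : U * q * L2 * 8 <= U * q * L2 * L2 by apply: ler_wpM2l => //; rewrite !mulr_ge0.
    by rewrite expr2; lra.
  have k2 : 2 * k%:R <= U * q by lra.
  have : 2 * k%:R * L2 <= U * q * L2 by rewrite ler_wpM2r.
  have : q * (U * L2 ^+ 2 / 8) <= q * N%:R by rewrite ler_wpM2l.
  have : 0 <= q * N%:R by rewrite mulr_ge0.
  by lra.
have q48 : 0 <= 48 + 8 * q by rewrite addr_ge0// mulr_ge0.
have e4 : (48 + 8 * q) / L2 <= (48 + 8 * q) * (L3 / L2).
  by rewrite mulrA ler_pM2r// ler_peMr.
apply: (@le_trans _ _ (m%:R / 2 * (c - (48 + 8 * q) * (L3 / L2)))); last first.
  clear -e1 e2 e3 e4 mR.
  by rewrite ler_wpM2l ?divr_ge0//; lra.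
set r := L3 / L2 in m1 L3r e4 *.
have r0 : 0 <= r by rewrite divr_ge0.
clear -m1 m2 c0 r0 U0 q48 L13 L2p0 L31 L2L23.
have h1 : (U * (1 - 3 * r) - 1) * c <= m%:R * c by rewrite ler_wpM2r.
have h2 : m%:R * ((48 + 8 * q) * r) <= U * ((48 + 8 * q) * r).
  by rewrite ler_wpM2r// mulr_ge0.
have h3 : 1 * c <= U * r * c.
  rewrite ler_wpM2r// /r mulrA ler_pdivlMr// mul1r.
  have : U * 1 <= U * L3 by rewrite ler_wpM2l.
  by lra.
by lra.
Qed.

Lemma iln3_large (R : realType) (A : R) : \forall x \near +oo, exists L1 L2 L3 : R,
  [/\ x = expR L1, L1 = expR L2, L2 = expR L3 & A <= L3].
Proof.
near=> x; exists (ln x), (ln (ln x)), (ln (ln (ln x))).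
have h : expR (expR (expR A)) <= x by near: x; apply: nbhs_pinfty_ge; rewrite num_real.
have x0 : 0 < x by apply: lt_le_trans h; exact: expR_gt0.
have h1 : expR (expR A) <= ln x by rewrite -ler_expR lnK ?posrE.
have x1 : 0 < ln x by apply: lt_le_trans h1; exact: expR_gt0.
have h2 : expR A <= ln (ln x) by rewrite -ler_expR lnK ?posrE.
have x2 : 0 < ln (ln x) by apply: lt_le_trans h2; exact: expR_gt0.
by rewrite !lnK ?posrE//; split => //; rewrite -ler_expR lnK ?posrE.
Unshelve. all: by end_near. Qed.

Lemma mho_bounds (R : realType) (p q x L1 L2 L3 : R) : 1 <= p -> p < q ->
  x = expR L1 -> L1 = expR L2 -> L2 = expR L3 -> 24 + 8 * q <= L3 ->
  exists2 r : R, mho q p x = r%:E &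
  expR (L1 / L2 * (ln (q / p) / 2 - (2 * ln (q / p) + 24 + 4 * q) * (L3 / L2))) <= r <=
  expR (L1 / L2 * (ln (q / p) / 2 + (6 * (ln (q / p) / 2) + 6) * (L3 / L2))).
Proof.
move=> p1 pq xE L1E L2E hL3.
have L31 : 1 <= L3 by lra.
have L32 : 6 * L3 <= L2.
  rewrite L2E (_ : L3 = L3 / 2 + L3 / 2); last by field.
  rewrite expRD; have h := expR_ge1Dx (L3 / 2).
  have : (1 + L3 / 2) * (1 + L3 / 2) <= expR (L3 / 2) * expR (L3 / 2).
    by apply: ler_pM => //; lra.
  have : L3 * 24 <= L3 * L3 by rewrite ler_wpM2l//; lra.
  by lra.
have qL2 : 8 * q <= L2 by lra.
have [D [hD D0 hlo]] := Hnorm_lower_asymp p1 pq xE L1E L2E L31 L32 qL2.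
set lo := expR _ in hlo *; set hi := expR _.
have lom : (lo%:E <= mho q p x)%E.
  apply: (@le_trans _ _ (Hnorm q D / Hnorm p D)%:E); first by rewrite lee_fin.
  by apply: ereal_sup_ubound; exists D.
have him : (mho q p x <= hi%:E)%E.
  apply: ge_ereal_sup => _ [D' [hD' _] <-]; rewrite lee_fin.
  have := Hnorm_upper_asymp p1 pq xE L1E L2E L31 L32 hD'; rewrite -/hi.
  (* If the H_p norm is 0, so is the quotient, as x / 0 = 0. *)
  have := Hnorm_ge0 p1 hD'; rewrite le_eqVlt => /predU1P[<- _|h0].
    by rewrite invr0 mulr0 expR_ge0.
  by rewrite ler_pdivrMr.
case: (mho q p x) lom him => [r| |] //=; rewrite !lee_fin => h1 h2.
by exists r => //; rewrite h1.
Qed.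

Theorem theorem1p1 (R : realType) (p q : R) (hp : 1 <= p) (hpq : p < q) :
  exists E : R -> R,
    E =O_ +oo (fun x : R => iln 3 x / iln 2 x) /\
    \forall x \near +oo,
      mho q p x =
        (expR (ln x / iln 2 x * (ln (Num.sqrt (q / p)) + E x)))%:E.
Proof.
have q1 : 1 <= q by lra.
have qp : 0 < q / p by rewrite divr_gt0//; lra.
have sE : ln (Num.sqrt (q / p)) = ln (q / p) / 2.
  have := sqr_sqrtr (ltW qp) => /(congr1 (@ln R)).
  by rewrite lnXn ?sqrtr_gt0// -[_ *+ 2]mulr_natl => <-; field.
have c0 : 0 <= ln (q / p) by rewrite ln_ge0// ler_pdivlMr ?mul1r ?ltW//; lra.
(* The equation solved for E: the formula then holds as soon as the supremum is finite and positive,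
   and only the size of E remains to be estimated. *)
pose E (x : R) := ln (fine (mho q p x)) / (ln x / iln 2 x) - ln (Num.sqrt (q / p)).
have H : \forall x \near +oo,
    mho q p x = (expR (ln x / iln 2 x * (ln (Num.sqrt (q / p)) + E x)))%:E /\
    (* This constant dominates those of both the lower and the upper bound. *)
    `|E x| <= (8 * ln (q / p) + 30 + 4 * q) * `|iln 3 x / iln 2 x|.
  near=> x.
  have [L1 [L2 [L3 [xE L1E L2E hL3]]]] : exists L1 L2 L3 : R,
    [/\ x = expR L1, L1 = expR L2, L2 = expR L3 & 24 + 8 * q <= L3].
    by near: x; exact: iln3_large.
  have [r rE /andP[r1 r2]] := mho_bounds hp hpq xE L1E L2E hL3.
  rewrite /E rE /= /iln /= xE expRK [in ln L1]L1E expRK [in ln L2]L2E expRK sE.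
  have L10 : 0 < L1 by rewrite L1E expR_gt0.
  have L20 : 0 < L2 by rewrite L2E expR_gt0.
  have U0 : 0 < L1 / L2 by rewrite divr_gt0.
  have r0 : 0 < r by rewrite (lt_le_trans _ r1)// expR_gt0.
  have t0 : 0 <= L3 / L2 by rewrite divr_ge0//; lra.
  set v := ln r / (L1 / L2).
  have vE : L1 / L2 * v = ln r by rewrite /v mulrCA divff ?mulr1// gt_eqF.
  rewrite addrC subrK vE lnK ?posrE//; split => //.
  move: r1 r2; rewrite -{1 2}(lnK r0) !ler_expR -vE !ler_pM2l//; clearbody v.
  rewrite (ger0_norm t0) ler_norml => h1 h2.
  have g1 : 0 <= ln (q / p) * (L3 / L2) by rewrite mulr_ge0.
  have g2 : 0 <= q * (L3 / L2) by rewrite mulr_ge0//; lra.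
  by apply/andP; split; lra.
exists E; split; last by apply: filterS H => x [].
apply/eqO_exP; exists (8 * ln (q / p) + 30 + 4 * q); first by lra.
by apply: filterS H => x [].
Unshelve. all: by end_near. Qed.
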